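(* Let $0<\alpha\le 1$, $0<\kappa<1$ and let $w\in A_1$ be a weight on $\mathbb R^n$. Then there is a constant $C>0$ independent of $f$ such that for all $f\in L^{1,\kappa}(w)$, $$\big\|g_\alpha(f)\big\|_{WL^{1,\kappa}(w)}\le C\,\|f\|_{L^{1,\kappa}(w)}.$$
   Context: A weight $w$ is a nonnegative, locally integrable function on $\mathbb R^n$; for measurable $E\subseteq\mathbb R^n$ write $w(E)=\int_E w(x)\,dx$, and $|E|$ for Lebesgue measure. $w\in A_1$ means there is a constant $C$ such that $\frac1{|B|}\int_B w(x)\,dx\le C\,\operatorname{ess\,inf}_{x\in B} w(x)$ for every ball $B\subseteq\mathbb R^n$. Weighted Morrey space: $L^{1,\kappa}(w)$ is the set of $f\in L^1_{loc}(w)$ (i.e. $|f|w$ locally integrable) with $\|f\|_{L^{1,\kappa}(w)}=\sup_B \frac{1}{w(B)^\kappa}\int_B|f(x)|w(x)\,dx<\infty$, supremum over all balls $B$ in $\mathbb R^n$. Weighted weak Morrey space: $WL^{1,\kappa}(w)$ is the set of measurable $h$ with $\|h\|_{WL^{1,\kappa}(w)}=\sup_B\sup_{\sigma>0}\frac{1}{w(B)^{\kappa}}\,\sigma\, w(\{x\in B:|h(x)|>\sigma\})<\infty$. Intrinsic Littlewood-Paley $g$-function: for $0<\alpha\le1$, $\mathcal C_\alpha$ is the family of functions $\varphi$ on $\mathbb R^n$ with support contained in $\{x:|x|\le1\}$, $\int_{\mathbb R^n}\varphi(x)\,dx=0$, and $|\varphi(x)-\varphi(x')|\le|x-x'|^\alpha$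 for all $x,x'\in\mathbb R^n$. Put $\varphi_t(x)=t^{-n}\varphi(x/t)$. For $f\in L^1_{loc}(\mathbb R^n)$ and $(y,t)\in\mathbb R^n\times(0,\infty)$ set $A_\alpha(f)(y,t)=\sup_{\varphi\in\mathcal C_\alpha}|f*\varphi_t(y)|=\sup_{\varphi\in\mathcal C_\alpha}\left|\int_{\mathbb R^n}\varphi_t(y-z)f(z)\,dz\right|$. Define $$g_\alpha(f)(x)=\left(\int_0^\infty\big(A_\alpha(f)(x,t)\big)^2\frac{dt}{t}\right)^{1/2}.$$ *)

(* Defs.v *)
From HB Require Import structures.
From mathcomp Require Import all_boot all_order all_algebra.
From mathcomp Require Import all_classical all_reals all_analysis.
From mathcomp Require Import measurable_realfun.

Set Implicit Arguments.
Unset Strict Implicit.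
Unset Printing Implicit Defensive.

Import Order.TTheory GRing.Theory Num.Theory.
Import numFieldNormedType.Exports.

Local Open Scope classical_set_scope.
Local Open Scope ring_scope.

(* R^n is 'rV[R]_n, with its Borel sigma-algebra: the one generated by the
   coordinate functions. *)
Section measurable_rV.
Context {R : realType} {n : nat}.

Let coord : 'I_n -> 'rV[R]_n -> measurableTypeR R := fun i x => x ord0 i.

Let rV_set0 : g_sigma_preimage coord set0.
Proof. exact: sigma_algebra0. Qed.

Let rV_setC A : g_sigma_preimage coord A -> g_sigma_preimage coord (~` A).
Proof. exact: sigma_algebraC. Qed.

Let rV_bigcup (F : _^nat) : (forall i, g_sigma_preimage coord (F i)) ->
  g_sigma_preimage coord (\bigcup_i (F i)).
Proof. exact: sigma_algebra_bigcup. Qed.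

HB.instance Definition _ :=
  @isMeasurable.Build default_measure_display 'rV[R]_n
    (g_sigma_preimage coord) rV_set0 rV_setC rV_bigcup.

End measurable_rV.

Lemma measurable_coord (R : realType) n (i : 'I_n) :
  measurable_fun [set: 'rV[R]_n] (fun x => x ord0 i : measurableTypeR R).
Proof.
move=> _ Y mY; rewrite setTI; apply: sub_sigma_algebra => /=.
rewrite -bigcup_seq/=; exists i => /=; first by rewrite mem_index_enum.
by exists Y => //; rewrite setTI.
Qed.

Lemma measurable_fun_rVP d (T : measurableType d) (R : realType) n
    (f : T -> 'rV[R]_n) :
  measurable_fun [set: T] f <->
  forall i, measurable_fun [set: T] (fun x => f x ord0 i : measurableTypeR R).
Proof.
split=> [mf i|mf].
  apply: (@measurableT_comp _ _ _ _ _ _ (fun x : 'rV[R]_n => x ord0 i)) => //.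
  exact: measurable_coord.
move=> _ A mA; rewrite setTI; move: A mA.
apply: smallest_sub.
  split=> [|A mA|F mF]; rewrite /=.
  - by rewrite preimage_set0.
  - by rewrite setTD preimage_setC; exact: measurableC.
  - by rewrite preimage_bigcup; exact: bigcupT_measurable.
rewrite -bigcup_seq/= => A [i _ [B mB <-]] /=.
by rewrite setTI; have := mf i measurableT B mB; rewrite setTI.
Qed.

Definition cons_rV (R : realType) n (p : measurableTypeR R * 'rV[R]_n) :
    'rV[R]_n.+1 :=
  \row_i (if unlift ord0 i is Some j then p.2 ord0 j else p.1).

Lemma measurable_cons_rV (R : realType) n : measurable_fun setT (@cons_rV R n).
Proof.
apply/measurable_fun_rVP => i; under eq_fun do rewrite mxE.
case: unliftP => [j _|_]; last exact: measurable_fst.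
apply: (@measurableT_comp _ _ _ _ _ _ (fun x : 'rV[R]_n => x ord0 j)) => //.
exact: measurable_coord.
Qed.

Definition uncons_rV (R : realType) n (x : 'rV[R]_n.+1) :
    measurableTypeR R * 'rV[R]_n :=
  (x ord0 ord0, \row_j x ord0 (lift ord0 j)).

Lemma cons_rVK (R : realType) n : cancel (@cons_rV R n) (@uncons_rV R n).
Proof.
move=> [a y]; rewrite /uncons_rV mxE unlift_none; congr pair.
by apply/rowP => j; rewrite !mxE liftK.
Qed.

Lemma measurable_uncons_rV (R : realType) n :
  measurable_fun setT (@uncons_rV R n).
Proof.
apply: measurable_fun_pair; first exact: measurable_coord.
apply/measurable_fun_rVP => i; under eq_fun do rewrite mxE.
exact: measurable_coord.
Qed.

(* The n-fold product of the Lebesgue measure of the line, on Borel sets. *)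
Fixpoint borel_lebesgue (R : realType) (n : nat) : set 'rV[R]_n -> \bar R :=
  if n is m.+1 then
    pushforward (@lebesgue_measure R \x @borel_lebesgue R m)%E (@cons_rV R m)
  else dirac (0 : 'rV[R]_0).

Section borel_lebesgue_measure.
Context (R : realType).
Local Open Scope ereal_scope.

Let pushforward_cons_rV n (m : {sigma_finite_measure set 'rV[R]_n -> \bar R}) :
  exists p : {measure set 'rV[R]_n.+1 -> \bar R},
    pushforward (@lebesgue_measure R \x m) (@cons_rV R n) = p :> (set _ -> _).
Proof.
by eexists; reflexivity.
Unshelve. exact: measurable_cons_rV.
Qed.

Let borel_lebesgueP n :
  exists m : {sigma_finite_measure set 'rV[R]_n -> \bar R},
    @borel_lebesgue R n = m :> (set _ -> _).
Proof.
elim: n => [|n [m mE]].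
  by exists [the {sigma_finite_measure set _ -> \bar R}
             of dirac (0%R : 'rV[R]_0)].
have [p] := pushforward_cons_rV m; rewrite -mE => pE.
have ps : sigma_finite setT p.
  have /sigma_finiteP[F [TF ndF Foo]] := sigma_finiteT (@lebesgue_measure R).
  have /sigma_finiteP[G [TG ndG Goo]] := sigma_finiteT m.
  exists (fun k => @uncons_rV R n @^-1` (F k `*` G k)).
    apply/seteqP; split=> // x _.
    have [i _ Fi] : (\bigcup_i F i) (x ord0 ord0) by rewrite -TF.
    have [j _ Gj] : (\bigcup_i G i) (\row_j x ord0 (lift ord0 j)) by rewrite -TG.
    exists (maxn i j) => //; split.
    - by move: Fi; exact/subsetPset/ndF/leq_maxl.
    - by move: Gj; exact/subsetPset/ndG/leq_maxr.
  move=> k; have [mF Fk] := Foo k; have [mG Gk] := Goo k; split.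
    rewrite -[X in measurable X]setTI.
    by apply: measurable_uncons_rV => //; exact: measurableX.
  rewrite -pE mE /pushforward -comp_preimage.
  rewrite (_ : _ \o _ = id); last by apply/funext => x; exact: cons_rVK.
  by rewrite preimage_id product_measure1E// lte_mul_pinfty// ge0_fin_numE.
pose sf := isSFinite.Build _ _ _ (p : set _ -> _) (sfinite_measure_sigma_finite ps).
pose sg := isSigmaFinite.Build _ _ _ (p : set _ -> _) ps.
pose p' : {sigma_finite_measure set 'rV[R]_n.+1 -> \bar R} :=
  HB.pack (p : set _ -> _) (Measure.on p) sf sg.
by exists p'.
Qed.

Let borel_lebesgue0 n : @borel_lebesgue R n set0 = 0.
Proof. by have [m ->] := borel_lebesgueP n. Qed.

Let borel_lebesgue_ge0 n A : 0 <= @borel_lebesgue R n A.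
Proof. by have [m ->] := borel_lebesgueP n. Qed.

Let borel_lebesgue_sigma_additive n :
  semi_sigma_additive (@borel_lebesgue R n).
Proof.
by have [m ->] := borel_lebesgueP n; exact: measure_semi_sigma_additive.
Qed.

HB.instance Definition _ n := isMeasure.Build _ _ _ (@borel_lebesgue R n)
  (@borel_lebesgue0 n) (@borel_lebesgue_ge0 n)
  (@borel_lebesgue_sigma_additive n).

Let borel_lebesgue_sigma_finite n : sigma_finite setT (@borel_lebesgue R n).
Proof. by have [m ->] := borel_lebesgueP n; exact: sigma_finiteT. Qed.

HB.instance Definition _ n := Measure_isSigmaFinite.Build _ _ _
  (@borel_lebesgue R n) (@borel_lebesgue_sigma_finite n).

End borel_lebesgue_measure.

Lemma measurable_box (R : realType) n (A : 'I_n -> set (measurableTypeR R)) :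
  (forall i, measurable (A i)) ->
  measurable [set x : 'rV[R]_n | forall i, A i (x ord0 i)].
Proof.
move=> mA; rewrite (_ : [set x | _] = \bigcap_(i in [set: 'I_n])
    ((fun x : 'rV[R]_n => x ord0 i) @^-1` A i)); last first.
  by apply/seteqP; split=> x /= h i => [_|]; exact: h.
apply: fin_bigcap_measurable => // i _.
by rewrite -[X in measurable X]setTI; apply: measurable_coord.
Qed.

Lemma borel_lebesgue_box (R : realType) n (A : 'I_n -> set (measurableTypeR R)) :
  (forall i, measurable (A i)) ->
  borel_lebesgue [set x : 'rV[R]_n | forall i, A i (x ord0 i)] =
  (\prod_(i < n) lebesgue_measure (A i))%E.
Proof.
elim: n A => [|n IHn] A mA.
  rewrite big_ord0 /= diracE mem_set //=; by case.
rewrite big_ord_recl -IHn; last by move=> i; exact: mA.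
rewrite -(product_measure1E (@lebesgue_measure R) (@borel_lebesgue R n)) //=;
  last by apply: (@measurable_box _ _ (fun i => A (lift ord0 i))).
rewrite /pushforward; congr (_ _); apply/seteqP; split => [[a y]|[a y]] /= h.
  split=> [|i]; first by have := h ord0; rewrite mxE unlift_none.
  by have := h (lift ord0 i); rewrite mxE liftK.
move=> i; rewrite mxE; case: unliftP => [j ->|->]; last exact: h.1.
exact: h.2.
Qed.

(* 'rV[R]_n with the Lebesgue (i.e. Caratheodory) measurable sets. *)
Notation lebesgue_rV R n :=
  (caratheodory_type (mu_ext (@borel_lebesgue R n))).

Definition lebesgueRn (R : realType) (n : nat) : set (lebesgue_rV R n) -> \bar R
  := @completed_measure_extension _ _ _ (@borel_lebesgue R n).

HB.instance Definition _ (R : realType) n := Measure.on (@lebesgueRn R n).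

Lemma lebesgueRn_sigma_finite (R : realType) n :
  sigma_finite setT (@lebesgueRn R n).
Proof. exact/completed_measure_extension_sigma_finite/sigma_finiteT. Qed.

HB.instance Definition _ (R : realType) n := Measure_isSigmaFinite.Build _ _ _
  (@lebesgueRn R n) (@lebesgueRn_sigma_finite R n).

Lemma lebesgueRn_box (R : realType) n (A : 'I_n -> set (measurableTypeR R)) :
  (forall i, measurable (A i)) ->
  lebesgueRn [set x : 'rV[R]_n | forall i, A i (x ord0 i)] =
  (\prod_(i < n) lebesgue_measure (A i))%E.
Proof.
move=> mA; rewrite -borel_lebesgue_box//.
by apply: measurable_mu_extE; exact: measurable_box.
Qed.

Section weighted_morrey.
Context {R : realType} {n : nat}.
Implicit Types (x y z : 'rV[R]_n) (B E : set 'rV[R]_n) (w f : 'rV[R]_n -> R).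
Local Open Scope ereal_scope.

Local Notation leb := (@lebesgueRn R n).

(* The library norm on 'rV[R]_n is the sup norm. *)
Definition enorm x : R := Num.sqrt (\sum_(i < n) x ord0 i ^+ 2)%R.

Definition eball x (r : R) : set 'rV[R]_n := [set y | (enorm (y - x)%R < r)%R].

Definition balls : set (set 'rV[R]_n) :=
  [set B | exists x (r : R), (0 < r)%R /\ B = eball x r].

(* Integrability includes measurability, and balls cover the space, so f is
   in particular Lebesgue measurable. *)
Definition locally_integrable_rV f :=
  forall B, balls B -> leb.-integrable B (EFin \o f).

Definition weight w := (forall x, 0 <= w x)%R /\ locally_integrable_rV w.

Definition wmeas w E : \bar R := \int[leb]_(x in E) (w x)%:E.

(* ess inf over E; the library's [ess_inf] is over the whole space. *)
Definition ess_inf_on E (h : 'rV[R]_n -> \bar R) : \bar R :=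
  ereal_sup [set a | {ae leb, forall x, E x -> a <= h x}].

Definition A1 w := exists C : R, forall B, balls B ->
  (leb B)^-1 * (\int[leb]_(x in B) (w x)%:E)
    <= C%:E * ess_inf_on B (EFin \o w).

Definition L1loc w f :=
  measurable_fun [set: lebesgue_rV R n] f /\
  locally_integrable_rV (fun x => `|f x| * w x)%R.

Definition morrey_norm (kappa : R) w f : \bar R :=
  ereal_sup [set (wmeas w B `^ kappa)^-1 *
                 \int[leb]_(x in B) (`|f x| * w x)%:E | B in balls].

Definition morrey (kappa : R) w : set ('rV[R]_n -> R) :=
  [set f | L1loc w f /\ morrey_norm kappa w f < +oo].

Definition weak_morrey_norm (kappa : R) w (h : 'rV[R]_n -> \bar R) : \bar R :=
  ereal_sup [set ereal_sup
    [set (wmeas w B `^ kappa)^-1 *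
         (sigma%:E * wmeas w [set x | B x /\ sigma%:E < `|h x|])
    | sigma in [set sigma : R | (0 < sigma)%R]] | B in balls].

Definition weak_morrey (kappa : R) w : set ('rV[R]_n -> \bar R) :=
  [set h | measurable_fun [set: lebesgue_rV R n] h /\
           weak_morrey_norm kappa w h < +oo].

End weighted_morrey.

Section intrinsic_square_function.
Context {R : realType} {n : nat}.
Implicit Types (x y z : 'rV[R]_n) (f phi : 'rV[R]_n -> R) (t alpha : R).
Local Open Scope ereal_scope.

Local Notation leb := (@lebesgueRn R n).

(* The closed unit ball contains the support of phi as soon as it contains
   the points where phi is nonzero. *)
Definition Calpha alpha : set ('rV[R]_n -> R) :=
  [set phi | [/\ forall x, phi x != 0%R -> (enorm x <= 1)%R,
                 \int[leb]_x (phi x)%:E = 0 &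
                 forall x x', (`|phi x - phi x'| <= enorm (x - x') `^ alpha)%R]].

Definition dilate phi t x : R := (t ^- n * phi (t^-1 *: x))%R.

Definition Aalpha alpha f y t : \bar R :=
  ereal_sup [set `| \int[leb]_z (dilate phi t (y - z)%R * f z)%:E |
            | phi in Calpha alpha].

Definition galpha alpha f x : \bar R :=
  (\int[@lebesgue_measure R]_(t in `]0%R, +oo[)
     ((Aalpha alpha f x t) ^+ 2 * (t^-1)%:E)) `^ (2^-1).

End intrinsic_square_function.

(* Main.v *)
Require Import Defs.
From mathcomp Require Import all_boot all_order all_algebra.
From mathcomp Require Import all_classical all_reals all_analysis.
From mathcomp Require Import measurable_realfun.
From mathcomp Require Import ring lra zify.

Set Implicit Arguments.
Unset Strict Implicit.
Unset Printing Implicit Defensive.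

Import Order.TTheory GRing.Theory Num.Theory.
Import numFieldNormedType.Exports.

Local Open Scope classical_set_scope.
Local Open Scope ring_scope.

(** Write [A(x,t)] for [Aalpha alpha f x t], so that [galpha] is the square root
    of the integral of [A(x,t)^2 dt/t].  The proof has four ingredients.

    Discretisation.  A test function living on the ball of centre [y] and radius
    [t] is, up to the factor [(t/s)^(n+alpha)], a test function for the ball of
    centre [x] and radius [s] whenever that ball contains the first one.  Hence
    [t^(n+alpha) A(y,t)] increases along cones ([Aalpha_mono]), and on a dyadic
    range of [t] the values [A(x,t)] are dominated by the single number attached
    to the cube of side comparable to [t] that contains [x].  The square function
    over [h/2 < t <= 2^N h/2] is therefore bounded by a finite sum [Gsq] over
    the cubes of sides [h 2^m], [m < N], around [x] ([square_integral_le]).  No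
    constant below depends on [h], on [N] or on the origin of the grid, so that
    the cutoffs are removed at the end by monotone convergence.

    Weighted weak type (1,1) for [Gsq] ([weak_type]).  In [L^2] without weight,
    test functions attached to different cubes are almost orthogonal: the one of
    larger scale is nearly constant on the support of the other, whose integral
    vanishes ([testfun_orthogonal]).  Schur's test and Bessel's inequality give
    the [L^2] bound ([energy_le]).  An [A_1] weight is, almost everywhere on a
    ball, bounded below by a multiple of its average there; slicing the weight
    at these constants reduces the weighted bound to the unweighted one
    ([energy_weighted], [Gsq_weighted]).  For the weak type one makes a
    Calderon-Zygmund decomposition on the same grid, stopped at the cubes of
    side [h]: since [Gsq] does not see smaller scales, on these last cubes the
    bad part is controlled by its cancellation alone, whatever the average of
    [f].  Elsewhere cancellation is used away from the cubes, and [A_1] turns each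
    product of the weight of a ball by the integral of [f] on a cube into the
    integral of [f] against the weight on that cube.

    Localisation.  Fix a ball [B] of centre [x0] and radius [r].  The part of
    [f] inside [2B] is covered by the weak type inequality and by doubling of
    the weight.  For the part outside, [A(.,t)] vanishes on [B] unless [t] is at
    least comparable to [r], and then it is at most a constant times the Morrey
    norm times the [(kappa-1)]-th power of the weight of a ball of radius
    comparable to [t].  These weights grow geometrically in the scale
    ([vol_reverse_doubling]) and [kappa < 1], hence the sum over the scales is
    comparable to its first term ([Gsq_far]).  Both parts yield the required
    bound for the level sets in [B] ([morrey_level_le]).

    Measurability.  [A] is a supremum over an uncountable family, but
    monotonicity along cones squeezes it between its values on countable grids:
    the function [leftA] so obtained is jointly measurable and differs from
    [t^(n+alpha) A(x,t)], for each [x], at countably many [t] only, hence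
    Tonelli's theorem applies ([square_integral_measurable]). *)

(** * Affine changes of variables *)

Lemma pushforward_measure d d' (T : measurableType d) (T' : measurableType d')
  (R : realType) (m : {measure set T -> \bar R}) (f : T -> T') :
  measurable_fun setT f ->
  exists m' : {measure set T' -> \bar R}, m' = pushforward m f :> (set _ -> _).
Proof. by move=> mf; eexists; reflexivity. Unshelve. exact: mf. Qed.

(** By uniqueness of the Lebesgue measure: rescaling its image under the affine
    map gives a measure with the same values on intervals. *)
Lemma lebesgue_measure_affine (R : realType) (a b : R)
    (X : set (measurableTypeR R)) :
  0 < a -> measurable X ->
  (lebesgue_measure ((fun u : R => b - a * u)%R @^-1` X) =
   (a^-1)%:E * lebesgue_measure X)%E.
Proof.
move=> a0 mX.
pose f : measurableTypeR R -> measurableTypeR R := fun u => b - a * u.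
have mf : measurable_fun setT f.
  by apply: measurable_funB => //; exact: measurable_funM.
have [m1 m1E] := pushforward_measure (@lebesgue_measure R) mf.
suff H : (lebesgue_measure X = a%:E * m1 X)%E.
  by rewrite H muleA -EFinM mulVf ?gt_eqF// mul1e m1E.
have a0' : 0 <= a by exact: ltW.
have := @lebesgue_measure_unique R (mscale (NngNum a0') m1) _ _ mX.
rewrite /mscale/=; apply => _ [[c d]] _ <-.
rewrite /mscale/= m1E /pushforward /f/=.
rewrite [X in (_ * lebesgue_measure X)%E](_ : _ =
    `[(b - d) / a, (b - c) / a[%classic); last first.
  have e1 (e u : R) : (e < b - a * u) <-> (u < (b - e) / a).
    by rewrite ltr_pdivlMr//; split; lra.
  have e2 (e u : R) : (b - a * u <= e) <-> ((b - e) / a <= u).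
    by rewrite ler_pdivrMr//; split; lra.
  apply/seteqP; split => u /=; rewrite !in_itv/= => /andP[h1 h2]; apply/andP; split.
  - exact: (e2 d u).1 h2.
  - exact: (e1 c u).1 h1.
  - exact: (e1 c u).2 h2.
  - exact: (e2 d u).2 h1.
rewrite !lebesgue_measure_itv/= !lte_fin ltr_pM2r ?invr_gt0// ltrD2l ltrN2.
case: ifPn => // _; last by rewrite mule0.
by rewrite -EFinM; congr EFin; field; rewrite gt_eqF.
Qed.

Definition affine (R : realType) n (b : 'rV[R]_n) (a : R) (x : 'rV[R]_n) :=
  b - a *: x.

Lemma measurable_affine (R : realType) n (b : 'rV[R]_n) (a : R) :
  measurable_fun setT (affine b a).
Proof.
apply/measurable_fun_rVP => i; rewrite /affine.
under eq_fun do rewrite !mxE.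
apply: measurable_funB => //; apply: measurable_funM => //.
exact: measurable_coord.
Qed.

(** Induction on the dimension: the map acts separately on the first coordinate
    and on the others, and product measures are determined by rectangles. *)
Lemma borel_lebesgue_affine (R : realType) n (b : 'rV[R]_n) (a : R)
    (X : set 'rV[R]_n) : 0 < a -> measurable X ->
  (borel_lebesgue (affine b a @^-1` X) =
   (a ^- n)%:E * borel_lebesgue X)%E.
Proof.
move=> a0; elim: n b X => [|n IH] b X mX.
  rewrite expr0 invr1 mul1e; congr (_ _); apply/seteqP.
  have E (x y : 'rV[R]_0) : x = y by apply/rowP; case.
  by split => x /= h; [rewrite (E x (affine b a x))|rewrite (E (affine b a x) x)].
pose T2 (p : measurableTypeR R * 'rV[R]_n) : measurableTypeR R * 'rV[R]_n :=
  (b ord0 ord0 - a * p.1, affine (\row_j b ord0 (lift ord0 j)) a p.2).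
have mT2 : measurable_fun setT T2.
  apply: measurable_fun_pair.
    by apply: measurable_funB => //; apply: measurable_funM.
  by apply: measurableT_comp => //; exact: measurable_affine.
have E : @cons_rV R n \o T2 = affine b a \o @cons_rV R n.
  apply/funext => -[u y]; apply/rowP => i /=; rewrite !mxE.
  by case: unliftP => [j ->|->]; rewrite ?mxE.
have mcX : measurable (@cons_rV R n @^-1` X).
  by rewrite -[X in measurable X]setTI; exact: measurable_cons_rV.
pose mm := (@lebesgue_measure R \x @borel_lebesgue R n)%E.
have [m1 m1E] := pushforward_measure mm mT2.
have a0' : 0 <= a ^+ n.+1 by exact/exprn_ge0/ltW.
suff H : (mm (@cons_rV R n @^-1` X) = (a ^+ n.+1)%:E * m1 (@cons_rV R n @^-1` X))%E.
  rewrite /= /pushforward -/mm H m1E /pushforward muleA -EFinM mulVf ?mul1e; last first.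
    by rewrite gt_eqF// exprn_gt0.
  by congr (mm _); apply/seteqP; split=> p; rewrite /= -[affine b a _]/((affine b a \o @cons_rV R n) p) -E.
have := @product_measure_unique _ _ _ _ _ (@lebesgue_measure R)
  (@borel_lebesgue R n) (mscale (NngNum a0') m1) _ _ mcX.
rewrite /mscale/= -/mm; apply => A B mA mB.
rewrite /mscale/= m1E /pushforward.
have -> : T2 @^-1` (A `*` B) = ((fun u => b ord0 ord0 - a * u) @^-1` A) `*`
    (affine (\row_j b ord0 (lift ord0 j)) a @^-1` B) by [].
have mA' : measurable ((fun u => b ord0 ord0 - a * u) @^-1` A :
    set (measurableTypeR R)).
  have := @measurable_funB _ _ R setT (cst (b ord0 ord0)) (fun u => a * u).
  rewrite -[X in measurable X]setTI; apply => //.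
  exact: measurable_funM.
have mB' : measurable (affine (\row_j b ord0 (lift ord0 j)) a @^-1` B).
  by rewrite -[X in measurable X]setTI; exact: measurable_affine.
transitivity ((a ^+ n.+1)%:E * (lebesgue_measure
    ((fun u => b ord0 ord0 - a * u)%R @^-1` A : set (measurableTypeR R)) *
  borel_lebesgue (affine (\row_j b ord0 (lift ord0 j)) a @^-1` B)))%E.
  by congr (_ * _)%E; exact: product_measure1E.
rewrite lebesgue_measure_affine// IH// (muleACA a^-1%:E) -(EFinM a^-1) (muleA (a ^+ n.+1)%:E).
by rewrite -EFinM -invfM -exprS divff ?mul1e// gt_eqF// exprn_gt0.
Qed.

Lemma measurable_leb (R : realType) n (A : set 'rV[R]_n) :
  measurable A -> measurable (A : set (lebesgue_rV R n)).
Proof. exact: caratheodory_measurable_mu_ext. Qed.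

Lemma measurable_fun_leb (R : realType) n d (T : measurableType d)
    (f : 'rV[R]_n -> T) :
  measurable_fun setT f -> measurable_fun [set: lebesgue_rV R n] f.
Proof.
move=> mf _ B mB; rewrite setTI; apply: measurable_leb.
by rewrite -[X in measurable X]setTI; exact: mf.
Qed.

(** Countable covers are transported by the affine map; the inverse map, which
    has the same form, gives the other inequality. *)
Lemma mu_ext_affine (R : realType) n (b : 'rV[R]_n) (a : R) (X : set 'rV[R]_n) :
  0 < a ->
  (mu_ext (@borel_lebesgue R n) (affine b a @^-1` X) =
   (a ^- n)%:E * mu_ext (@borel_lebesgue R n) X)%E.
Proof.
suff le b' a' (Y : set 'rV[R]_n) : 0 < a' ->
    (mu_ext (@borel_lebesgue R n) (affine b' a' @^-1` Y) <=
     (a' ^- n)%:E * mu_ext (@borel_lebesgue R n) Y)%E.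
  move=> a0; apply/eqP; rewrite eq_le le//=.
  have an0 : 0 < a ^+ n by exact: exprn_gt0.
  have := le (a^-1 *: b) a^-1 (affine b a @^-1` X).
  rewrite invr_gt0 exprVn invrK => /(_ a0).
  rewrite -comp_preimage (_ : affine b a \o _ = id) ?preimage_id; last first.
    apply/funext => x; apply/rowP => i; rewrite !mxE.
    by field; rewrite gt_eqF.
  by move=> h; rewrite muleC lee_pdivrMr// muleC.
move=> a0; have an0 : 0 < a' ^+ n by exact: exprn_gt0.
rewrite muleC -lee_pdivrMr ?invr_gt0// invrK.
apply: le_ereal_inf_tmp => _ [B [mB YB] <-].
rewrite -[a' ^+ n]invrK lee_pdivrMr ?invr_gt0// [leRHS]muleC.
rewrite -nneseriesZl; last by move=> i _; exact: measure_ge0.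
apply: ereal_inf_lbound; exists (fun i => affine b' a' @^-1` B i).
  split=> [i|x /= /YB [i _ Bi]]; last by exists i.
  by rewrite -[X in measurable X]setTI; apply: measurable_affine.
by apply: eq_eseriesr => i _; rewrite borel_lebesgue_affine.
Qed.

(** Lebesgue measurability is stronger than what Borel measurability of the map
    gives: Caratheodory's criterion is transported by the scaling of the outer
    measure. *)
Lemma measurable_affine_leb (R : realType) n (b : 'rV[R]_n) (a : R) :
  0 < a ->
  measurable_fun setT (affine b a : lebesgue_rV R n -> lebesgue_rV R n).
Proof.
move=> a0 _ X mX; rewrite setTI.
have {}mX : caratheodory_measurable (mu_ext (@borel_lebesgue R n)) X by [].
suff : caratheodory_measurable (mu_ext (@borel_lebesgue R n))
  (affine b a @^-1` X) by [].
move=> Y.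
have an0 : 0 < a ^+ n by exact: exprn_gt0.
have h : affine b a \o affine (a^-1 *: b) a^-1 = id.
  apply/funext => x; apply/rowP => i; rewrite !mxE.
  by field; rewrite gt_eqF.
have h' : affine (a^-1 *: b) a^-1 \o affine b a = id.
  apply/funext => x; apply/rowP => i; rewrite !mxE.
  by field; rewrite gt_eqF.
have hY : affine b a @^-1` (affine (a^-1 *: b) a^-1 @^-1` Y) = Y.
  by rewrite -comp_preimage h' preimage_id.
rewrite -{1}hY.
rewrite mu_ext_affine// (mX _) muleDr; last 2 first.
- by [].
- by apply: ge0_adde_def; rewrite inE; exact: mu_ext_ge0.
rewrite -!(mu_ext_affine b)// !preimage_setI.
by rewrite hY preimage_setC.
Qed.

Section integral_affine.
Context {R : realType} {n : nat}.
Local Notation leb := (@lebesgueRn R n).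
Variables (b : 'rV[R]_n) (a : R) (a0 : 0 < a).

Lemma lebesgueRn_affine (X : set 'rV[R]_n) :
  leb (affine b a @^-1` X) = ((a ^- n)%:E * leb X)%E.
Proof. exact: mu_ext_affine. Qed.

Lemma ge0_integral_affine (f : 'rV[R]_n -> \bar R) :
  measurable_fun [set: lebesgue_rV R n] f -> (forall x, 0 <= f x)%E ->
  (\int[leb]_x f (affine b a x) = (a ^- n)%:E * \int[leb]_x f x)%E.
Proof.
move=> mf f0; have mT := measurable_affine_leb b a0.
have [m1 m1E] := pushforward_measure leb mT.
rewrite -[LHS](@ge0_integral_pushforward _ _ _ _ _ _ mT leb setT f)//.
rewrite -[in LHS]/(pushforward leb _).
have an0 : 0 <= a ^- n by rewrite invr_ge0 exprn_ge0// ltW.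
rewrite -(@ge0_integral_mscale _ _ _ leb setT measurableT (NngNum an0))//.
apply: eq_measure_integral => A mA _.
by rewrite /= /mscale /pushforward lebesgueRn_affine.
Qed.

Lemma integral_affine (f : 'rV[R]_n -> \bar R) :
  measurable_fun [set: lebesgue_rV R n] f ->
  (\int[leb]_x f (affine b a x) = (a ^- n)%:E * \int[leb]_x f x)%E.
Proof.
move=> mf; rewrite integralE [in RHS]integralE.
rewrite (funepos_comp f (affine b a)) (funeneg_comp f (affine b a)).
rewrite (ge0_integral_affine (f := f^\+%E))//; last exact: measurable_funepos.
rewrite (ge0_integral_affine (f := f^\-%E))//; last exact: measurable_funeneg.
have an0 : 0 < a ^- n by rewrite invr_gt0 exprn_gt0.
set u := (\int[leb]_x _)%E; set v := (\int[leb]_x _)%E.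
case: u v => [u| |] [v| |]; rewrite /= ?gt0_muley ?gt0_muleNy ?lte_fin//=.
by rewrite -!EFinM -!EFinB mulrBr.
Qed.

End integral_affine.

(** * Euclidean norm *)

Section enorm.
Context {R : realType} {n : nat}.
Implicit Types x y z : 'rV[R]_n.

Lemma enorm_ge0 x : 0 <= enorm x.
Proof. exact: sqrtr_ge0. Qed.

Lemma enorm_sqr x : enorm x ^+ 2 = \sum_(i < n) x ord0 i ^+ 2.
Proof. by rewrite sqr_sqrtr// sumr_ge0// => i _; exact: sqr_ge0. Qed.

Lemma enormZ a x : enorm (a *: x) = `|a| * enorm x.
Proof.
apply/eqP; rewrite -(@eqrXn2 _ 2)// ?mulr_ge0 ?enorm_ge0//.
rewrite exprMn !enorm_sqr mulr_sumr; apply/eqP/eq_bigr => i _.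
by rewrite mxE exprMn real_normK// num_real.
Qed.

Lemma enormxx x : enorm (x - x) = 0.
Proof. by rewrite subrr -[0](scale0r 0) enormZ normr0 mul0r. Qed.

Lemma enormN x : enorm (- x) = enorm x.
Proof. by rewrite -scaleN1r enormZ normrN1 mul1r. Qed.

Lemma enormB x y : enorm (x - y) = enorm (y - x).
Proof. by rewrite -enormN opprB. Qed.

Lemma coord_le_enorm x i : `|x ord0 i| <= enorm x.
Proof.
rewrite -(@ler_pXn2r _ 2) ?nnegrE ?enorm_ge0// enorm_sqr real_normK ?num_real//.
by rewrite (bigD1 i)//= lerDl sumr_ge0// => j _; exact: sqr_ge0.
Qed.

Lemma enorm_le_coord x r : 0 <= r -> (forall i, `|x ord0 i| <= r) ->
  enorm x <= n%:R * r.
Proof.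
move=> r0 xr; rewrite -(@ler_pXn2r _ 2) ?nnegrE ?enorm_ge0 ?mulr_ge0//.
rewrite enorm_sqr (le_trans (y := \sum_(i < n) r ^+ 2))//.
  apply: ler_sum => i _; rewrite -real_normK ?num_real//.
  by rewrite ler_pXn2r// ?nnegrE.
rewrite sumr_const card_ord -[leLHS]mulr_natl exprMn; apply: (ler_wpM2r (sqr_ge0 r)).
rewrite -natrX ler_nat expnS expn1.
by case: (n) => // m; rewrite leq_pmulr.
Qed.

(** Through Lagrange's identity for the Cauchy-Schwarz inequality. *)
Lemma ler_enormD x y : enorm (x + y) <= enorm x + enorm y.
Proof.
rewrite -(@ler_pXn2r _ 2) ?nnegrE ?addr_ge0 ?enorm_ge0//.
rewrite sqrrD !enorm_sqr.
have -> : \sum_(i < n) (x + y) ord0 i ^+ 2 = \sum_(i < n) x ord0 i ^+ 2 +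
    (\sum_(i < n) x ord0 i * y ord0 i) *+ 2 + \sum_(i < n) y ord0 i ^+ 2.
  rewrite -sumrMnl -!big_split/=; apply: eq_bigr => i _.
  by rewrite mxE sqrrD.
rewrite lerD2r lerD2l lerMn2r/=.
set S := \sum_(i < n) _.
rewrite (le_trans (ler_norm S))// -(@ler_pXn2r _ 2) ?nnegrE ?mulr_ge0 ?enorm_ge0//.
rewrite real_normK ?num_real// exprMn !enorm_sqr -subr_ge0.
suff -> : (\sum_(i < n) x ord0 i ^+ 2) * (\sum_(i < n) y ord0 i ^+ 2) - S ^+ 2 =
  2^-1 * \sum_(i < n) \sum_(j < n)
    (x ord0 i * y ord0 j - x ord0 j * y ord0 i) ^+ 2.
  rewrite mulr_ge0// sumr_ge0// => i _; rewrite sumr_ge0// => j _.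
  exact: sqr_ge0.
have e i j : (x ord0 i * y ord0 j - x ord0 j * y ord0 i) ^+ 2 =
    x ord0 i ^+ 2 * y ord0 j ^+ 2 + x ord0 j ^+ 2 * y ord0 i ^+ 2
    - ((x ord0 i * y ord0 i) * (x ord0 j * y ord0 j)) *+ 2 by ring.
under [X in _ = _ * X]eq_bigr do under eq_bigr do rewrite e.
under [X in _ = _ * X]eq_bigr do rewrite sumrB big_split/= -mulr_sumr -mulr_suml sumrMnl -mulr_sumr.
rewrite sumrB big_split/= -mulr_suml -mulr_sumr sumrMnl -mulr_suml -/S.
by field.
Qed.

Lemma ler_enorm_dist x y z : enorm (x - z) <= enorm (x - y) + enorm (y - z).
Proof. by have := ler_enormD (x - y) (y - z); rewrite addrA subrK. Qed.

Lemma enorm_delta i : enorm (delta_mx ord0 i : 'rV[R]_n) = 1.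
Proof.
rewrite /enorm (bigD1 i)//= big1 => [|j ji]; rewrite mxE eqxx/= ?eqxx.
  by rewrite addr0 expr1n sqrtr1.
by rewrite (negbTE ji) expr0n.
Qed.

Lemma measurable_enorm : measurable_fun setT (@enorm R n).
Proof.
apply: (@measurableT_comp _ _ _ _ _ _ (@Num.sqrt R) _
  (fun x : 'rV[R]_n => \sum_(i < n) x ord0 i ^+ 2)); first (apply: continuous_measurable_fun; exact: sqrt_continuous).
apply: measurable_sum => i; apply: measurable_funX.
exact: measurable_coord.
Qed.

Lemma measurable_eball x (r : R) : measurable (eball x r).
Proof.
have mf : measurable_fun setT (fun y : 'rV[R]_n => enorm (y - x)).
  apply: measurableT_comp; first exact: measurable_enorm.
  apply/measurable_fun_rVP => i; under eq_fun do rewrite mxE.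
  by apply: measurable_funD => //; exact: measurable_coord.
have -> : eball x r = (fun y => enorm (y - x)) @^-1` `]-oo, r[%classic.
  by apply/seteqP; split => y /=; rewrite in_itv.
by rewrite -[X in measurable X]setTI; exact: mf.
Qed.

Lemma eball_leb x (r : R) : measurable (eball x r : set (lebesgue_rV R n)).
Proof. by apply: measurable_leb; exact: measurable_eball. Qed.

Lemma sub_eball x y (r s : R) : enorm (x - y) + r <= s -> eball x r `<=` eball y s.
Proof.
move=> h z; rewrite /eball/= => zr.
by apply: le_lt_trans (ler_enorm_dist z x y) _; lra.
Qed.

End enorm.

(** * Grids *)

(** Used for functions of the grid cell of a point. *)
Lemma measurable_fun_fibers d d' (T : measurableType d) (T' : measurableType d')
    (I : countType) (u : T -> I) (G : I -> T') :
  (forall i, measurable [set x | u x = i]) -> measurable_fun setT (G \o u).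
Proof.
move=> mu _ Y mY; rewrite setTI.
have -> : (G \o u) @^-1` Y =
    \bigcup_(i : I) (if `[<Y (G i)>] then [set x | u x = i] else set0).
  apply/seteqP; split => [x /= Yx|x [i _]]; first by exists (u x); rewrite ?asboolT.
  by case: asboolP => // Yi /= xi; rewrite xi.
apply: countable_bigcupT_measurable => [|i]; first exact: countableP.
by case: ifP.
Qed.

Section grid.
Context {R : realType} {n : nat}.
Local Notation leb := (@lebesgueRn R n).
Implicit Types (o x y : 'rV[R]_n) (l : R) (j : 'rV[int]_n).

(** The grid of origin [o] and side [l] consists of the half-open cubes indexed
    by integer vectors. *)
Definition idx o l x : 'rV[int]_n := \row_i Num.floor ((x ord0 i - o ord0 i) / l).
Definition corner o l j : 'rV[R]_n := \row_i (o ord0 i + l * (j ord0 i)%:~R).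
Definition cube o l j : set 'rV[R]_n := [set x | idx o l x = j].

Lemma cubeP o l j x : 0 < l -> cube o l j x <->
  forall i, corner o l j ord0 i <= x ord0 i < corner o l j ord0 i + l.
Proof.
move=> l0; have e i : (Num.floor ((x ord0 i - o ord0 i) / l) == j ord0 i) =
    (corner o l j ord0 i <= x ord0 i < corner o l j ord0 i + l).
  rewrite floor_eq mxE intrD ler_pdivlMr// ltr_pdivrMr// mulrDl mul1r.
  by rewrite lerBrDl ltrBlDl addrA (mulrC l).
split=> [xj i|h]; first by rewrite -e -xj mxE.
by apply/rowP => i; apply/eqP; rewrite mxE e.
Qed.

Lemma cube_box o l j : 0 < l -> cube o l j = [set x : 'rV[R]_n | forall i,
  `[corner o l j ord0 i, corner o l j ord0 i + l[%classic (x ord0 i)].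
Proof.
move=> l0; apply/seteqP; split=> x.
  by have [H _] := @cubeP o l j x l0; move/H => h i /=; rewrite in_itv; exact: h.
move=> h; have [_] := @cubeP o l j x l0; apply => i; have := h i; rewrite /= in_itv; exact.
Qed.

Lemma measurable_cube o l j : 0 < l -> measurable (cube o l j).
Proof. by move=> l0; rewrite cube_box//; exact: (@measurable_box R n (fun i => `[corner o l j ord0 i, corner o l j ord0 i + l[%classic)). Qed.

Lemma cube_leb o l j : 0 < l -> measurable (cube o l j : set (lebesgue_rV R n)).
Proof. by move=> l0; apply: measurable_leb; exact: measurable_cube. Qed.

Lemma lebesgueRn_cube o l j : 0 < l -> leb (cube o l j) = (l ^+ n)%:E.
Proof.
move=> l0; rewrite cube_box//.
rewrite (@lebesgueRn_box R n (fun i => `[corner o l j ord0 i, corner o l j ord0 i + l[%classic))//.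
under eq_bigr => i _.
  rewrite lebesgue_measure_itv/= lte_fin ltrDl l0 -EFinB addrAC subrr add0r.
  over.
by rewrite prodEFin prodr_const card_ord.
Qed.

Lemma cube_idx o l x : cube o l (idx o l x) x. Proof. by []. Qed.

Lemma cube_enorm o l j x : 0 < l -> cube o l j x ->
  enorm (x - corner o l j) <= n%:R * l.
Proof.
move=> l0; have [H _] := @cubeP o l j x l0; move/H => h; apply: enorm_le_coord; first exact: ltW.
by move=> i; rewrite !mxE; have := h i; rewrite !mxE => /andP[? ?]; rewrite ger0_norm; lra.
Qed.

Lemma measurable_fun_idx d (T : measurableType d) o l (G : 'rV[int]_n -> T) :
  0 < l -> measurable_fun setT (G \o idx o l).
Proof. by move=> l0; apply: measurable_fun_fibers => j; exact: measurable_cube. Qed.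

Lemma leb_eball_le x (r : R) : 0 < r -> (leb (eball x r) <= ((2 * r) ^+ n)%:E)%E.
Proof.
move=> r0.
have -> : ((2 * r) ^+ n)%:E = leb (cube (x - const_mx r) (2 * r) 0).
  by rewrite lebesgueRn_cube// mulr_gt0.
apply: le_measure; rewrite ?inE.
- exact: eball_leb.
- by apply: cube_leb; rewrite mulr_gt0.
move=> y xy; have r2 : 0 < 2 * r by rewrite mulr_gt0.
have [_] := @cubeP (x - const_mx r) (2 * r) 0 y r2; apply => i; rewrite !mxE mulr0 addr0.
have := le_lt_trans (coord_le_enorm (y - x) i) xy.
by rewrite !mxE ltr_norml => /andP[? ?]; lra.
Qed.

Lemma leb_eball_ge x (r : R) : 0 < r ->
  (((r / n.+1%:R) ^+ n)%:E <= leb (eball x r))%E.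
Proof.
move=> r0; have rn : 0 < r / n.+1%:R by rewrite divr_gt0.
rewrite -(lebesgueRn_cube x 0 rn); apply: le_measure; rewrite ?inE.
- exact: cube_leb.
- exact: eball_leb.
move=> y /(cube_enorm rn); rewrite /eball/=.
have -> : corner x (r / n.+1%:R) 0 = x.
  by apply/rowP => i; rewrite !mxE mulr0 addr0.
move=> h; apply: le_lt_trans h _.
by rewrite mulrCA gtr_pMr// ltr_pdivrMr// mul1r ltr_nat.
Qed.

Lemma leb_eball_fin x (r : R) : 0 < r -> leb (eball x r) \is a fin_num.
Proof.
by move=> r0; rewrite ge0_fin_numE// (le_lt_trans (leb_eball_le x r0))// ltry.
Qed.

Lemma leb_eball_gt0 x (r : R) : 0 < r -> (0 < leb (eball x r))%E.
Proof.
move=> r0; apply: lt_le_trans (leb_eball_ge x r0).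
by rewrite lte_fin exprn_gt0// divr_gt0.
Qed.

End grid.

(** * Test functions *)

(** A function continuous for the Euclidean norm is the limit of its values at
    the corners of finer and finer grids. *)
Lemma measurable_fun_epsdelta (R : realType) n (F : 'rV[R]_n -> R) :
  (forall x e, 0 < e -> exists2 d, 0 < d &
    forall y, enorm (y - x) < d -> `|F y - F x| < e) ->
  measurable_fun setT F.
Proof.
move=> Fc; pose l (k : nat) : R := k.+1%:R^-1.
have l0 k : 0 < l k by rewrite /l invr_gt0.
apply: (@measurable_fun_cvg _ _ _ _
  (fun k => (F \o corner 0 (l k)) \o idx 0 (l k))) => [k|x _].
  exact: measurable_fun_idx.
apply/cvgrPdist_lt => e e0; have [d d0 dF] := Fc x e e0.
have : (n%:R * k.+1%:R^-1 : R) @[k --> \oo] --> (n%:R * 0 : R).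
  by apply: cvgZr; exact: cvg_harmonic.
rewrite mulr0 => /cvgrPdist_lt/(_ d d0).
apply: filterS => k /=; rewrite sub0r normrN ger0_norm; last first.
  by rewrite mulr_ge0// invr_ge0.
move=> kd; rewrite distrC; apply: dF; rewrite enormB.
by apply: le_lt_trans kd; exact: (@cube_enorm _ _ 0 (l k) (idx 0 (l k) x)).
Qed.

Lemma integralZ_gt0 d (T : measurableType d) (R : realType)
    (mu : {measure set T -> \bar R}) (c : R) (f : T -> \bar R) :
  0 < c -> measurable_fun setT f ->
  (\int[mu]_x (c%:E * f x) = c%:E * \int[mu]_x f x)%E.
Proof.
move=> c0 mf; have c0' : 0 <= c by exact: ltW.
rewrite integralE [in RHS]integralE.
have -> : (fun x => c%:E * f x)^\+%E = (fun x => c%:E * f^\+ x)%E.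
  by apply/funext => x; rewrite !funeposE maxe_pMr ?mule0.
have -> : (fun x => c%:E * f x)^\-%E = (fun x => c%:E * f^\- x)%E.
  by apply/funext => x; rewrite !funenegE -muleN maxe_pMr ?mule0.
rewrite !ge0_integralZl_EFin//; last 2 first.
- exact: measurable_funeneg.
- exact: measurable_funepos.
set u := (\int[mu]_x _)%E; set v := (\int[mu]_x _)%E.
case: u v => [u| |] [v| |]; rewrite /= ?gt0_muley ?gt0_muleNy ?lte_fin//=.
by rewrite -!EFinM -!EFinB mulrBr.
Qed.

(** The functions [z |-> phi_t (y - z)] for [phi] in [Calpha], described
    intrinsically (see [Aalpha_testfun]). *)
Definition testfun (R : realType) n (alpha : R) (y : 'rV[R]_n) (t : R) :
    set ('rV[R]_n -> R) :=
  [set psi | [/\ forall z, psi z != 0 -> enorm (z - y) <= t,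
    (\int[@lebesgueRn R n]_z (psi z)%:E = 0)%E &
    forall z z', `|psi z - psi z'| <= t ^- n * (enorm (z - z') / t) `^ alpha]].

Section testfun.
Context {R : realType} {n : nat}.
Local Notation leb := (@lebesgueRn R n).
Variables (alpha : R).
Hypotheses (n_gt0 : (0 < n)%N) (alpha_gt0 : 0 < alpha) (alpha_le1 : alpha <= 1).
Implicit Types (x y z : 'rV[R]_n) (s t : R) (f psi : 'rV[R]_n -> R).

Lemma measurable_hoelder (K : R) psi : 0 <= K ->
  (forall z z', `|psi z - psi z'| <= K * enorm (z - z') `^ alpha) ->
  measurable_fun setT psi.
Proof.
move=> K0 h; apply: measurable_fun_epsdelta => x e e0.
have K1 : 0 < K + 1 by rewrite ltr_wpDl.
exists ((e / (K + 1)) `^ alpha^-1); first by rewrite powR_gt0// divr_gt0.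
move=> y yx; apply: le_lt_trans (h y x) _.
have : enorm (y - x) `^ alpha < e / (K + 1).
  have -> : e / (K + 1) = ((e / (K + 1)) `^ alpha^-1) `^ alpha.
    by rewrite -powRrM mulVf ?powRr1 ?gt_eqF// ltW// divr_gt0.
  by apply: gt0_ltr_powR => //; rewrite ?inE ?nnegrE ?in_itv/= ?enorm_ge0 ?powR_ge0.
rewrite ltr_pdivlMr// => h'; apply: le_lt_trans h'.
by rewrite mulrC ler_wpM2l ?powR_ge0// lerDl.
Qed.

Lemma testfun_measurable y t psi : 0 < t -> testfun alpha y t psi ->
  measurable_fun [set: lebesgue_rV R n] psi.
Proof.
move=> t0 [_ _ h]; apply: measurable_fun_leb.
apply: (@measurable_hoelder (t ^- n * t^-1 `^ alpha)).
  by rewrite mulr_ge0 ?powR_ge0// invr_ge0 exprn_ge0// ltW.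
move=> z z'; apply: le_trans (h z z') _.
by rewrite powRM ?enorm_ge0 ?invr_ge0 ?(ltW t0)// mulrAC mulrA.
Qed.

Lemma Aalpha_testfun f y t : 0 < t ->
  Aalpha alpha f y t = ereal_sup
    [set (`| \int[leb]_z (psi z * f z)%:E |)%E | psi in testfun alpha y t].
Proof.
move=> t0; have tn0 : 0 < t ^+ n by rewrite exprn_gt0.
have tn0' : 0 < t ^- n by rewrite invr_gt0.
rewrite /Aalpha; congr ereal_sup; apply/seteqP; split => _ [phi [h1 h2 h3] <-].
- exists (fun z => dilate phi t (y - z)) => //; split => [z||z z'].
  + rewrite /dilate mulf_eq0 negb_or => /andP[_ /h1].
    by rewrite enormZ gtr0_norm ?invr_gt0// ler_pdivrMl// mulr1 enormB.
  + have mphi : measurable_fun [set: lebesgue_rV R n] phi.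
      apply: measurable_fun_leb; apply: (@measurable_hoelder 1) => // z z'.
      by rewrite mul1r.
    have := @integral_affine R n (t^-1 *: y) t^-1 _
      (fun u => (t ^- n * phi u)%:E).
    rewrite invr_gt0 => /(_ t0).
    have -> : (fun x => (t ^- n * phi (affine (t^-1 *: y) t^-1 x))%:E) =
              (fun x => (dilate phi t (y - x))%:E).
      by apply/funext => x; rewrite /dilate /affine scalerBr.
    move=> ->; last by apply/measurable_EFinP; exact: measurable_funM.
    under eq_integral do rewrite EFinM.
    by rewrite integralZ_gt0 ?h2 ?mule0//; exact/measurable_EFinP.
  + rewrite /dilate -mulrBr normrM (gtr0_norm tn0') ler_wpM2l ?(ltW tn0')//.
    apply: le_trans (h3 _ _) _.
    rewrite -scalerBr enormZ gtr0_norm ?invr_gt0// mulrC.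
    by rewrite opprB addrC addrA subrK enormB.
- have mphi := @testfun_measurable y t phi t0 (And3 h1 h2 h3).
  exists (fun u => t ^+ n * phi (y - t *: u)); last first.
    congr (`| _ |)%E; apply: eq_integral => z _; congr EFin.
    rewrite /dilate mulrA mulVf ?gt_eqF// mul1r scalerA divff ?gt_eqF// scale1r.
    by rewrite opprB addrC subrK.
  split => [z||z z'].
  + rewrite mulf_eq0 negb_or => /andP[_ /h1].
    rewrite addrC addrA addNr add0r enormN enormZ gtr0_norm//.
    by rewrite -[leRHS]mulr1 ler_pM2l.
  + have := @integral_affine R n y t t0 (fun u => (t ^+ n * phi u)%:E).
    rewrite /affine => ->; last by apply/measurable_EFinP; exact: measurable_funM.
    under eq_integral do rewrite EFinM.
    by rewrite integralZ_gt0 ?h2 ?mule0//; exact/measurable_EFinP.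
  + rewrite -mulrBr normrM (gtr0_norm tn0).
    apply: le_trans (ler_wpM2l (ltW tn0) (h3 _ _)) _.
    rewrite mulrA divff ?gt_eqF// mul1r.
    rewrite (_ : y - t *: z - (y - t *: z') = t *: (z' - z)); last first.
      by apply/rowP => i; rewrite !mxE; ring.
    by rewrite enormZ gtr0_norm// mulrAC divff ?gt_eqF// mul1r enormB.
Qed.

Lemma testfun0 y t : 0 < t -> testfun alpha y t (cst 0).
Proof.
move=> t0; split => [z|| z z'] /=; first by rewrite eqxx.
  by rewrite integral0.
by rewrite subrr normr0 mulr_ge0 ?powR_ge0// invr_ge0 exprn_ge0// ltW.
Qed.

(** Compare with a point at distance [3 t], where the function vanishes. *)
Lemma testfun_le y t psi z : 0 < t -> testfun alpha y t psi ->
  `|psi z| <= 3 * t ^- n.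
Proof.
move=> t0 [h1 _ h3].
have tn0' : 0 < t ^- n by rewrite invr_gt0 exprn_gt0.
have [->|z0] := eqVneq (psi z) 0.
  by rewrite normr0 mulr_ge0// ltW.
have zy := h1 _ z0.
pose z' := z + (3 * t) *: delta_mx ord0 (Ordinal n_gt0).
have zz' : enorm (z - z') = 3 * t.
  rewrite /z' opprD addrA subrr add0r enormN enormZ enorm_delta mulr1.
  by rewrite gtr0_norm// mulr_gt0.
have -> : psi z = psi z - psi z'.
  have [->|/h1 z'0] := eqVneq (psi z') 0; first by rewrite subr0.
  have := ler_enorm_dist z y z'; rewrite zz' (enormB y); lra.
apply: le_trans (h3 _ _) _; rewrite zz' mulrC ler_wpM2r ?(ltW tn0')//.
by rewrite mulfK ?gt_eqF// -[leRHS]powRr1// ler_powR// ler1n.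
Qed.

Lemma testfun_supp y t psi z : 0 < t -> testfun alpha y t psi ->
  ~ eball y (2 * t) z -> psi z = 0.
Proof.
move=> t0 [h1 _ _] zy; apply/eqP; apply: contra_notT zy => /h1.
by rewrite /eball/=; lra.
Qed.

Lemma testfun_integrable y t psi f : 0 < t -> testfun alpha y t psi ->
  leb.-integrable (eball y (2 * t)) (EFin \o f) ->
  leb.-integrable setT (fun z => (psi z * f z)%:E).
Proof.
move=> t0 hpsi intf.
have mE : measurable (eball y (2 * t) : set (lebesgue_rV R n)) by exact: eball_leb.
have -> : (fun z => (psi z * f z)%:E) =
    ((fun z => (psi z * f z)%:E) \_ (eball y (2 * t)))%E.
  apply/funext => z; rewrite patchE; case: ifPn => //.
  rewrite notin_setE => /(testfun_supp t0 hpsi) ->.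
  by rewrite mul0r.
apply/(integrable_mkcond _ mE).
have := @integrableMr _ _ _ leb _ mE psi (EFin \o f); apply => //.
  exact: measurable_funTS (testfun_measurable t0 hpsi).
exists (3 * t ^- n); split; first exact: num_real.
by move=> M HM z _; apply: le_trans (testfun_le z t0 hpsi) (ltW HM).
Qed.

End testfun.

(** * The supremum over test functions *)

Section Aalpha.
Context {R : realType} {n : nat}.
Local Notation leb := (@lebesgueRn R n).
Variables (alpha : R).
Hypotheses (n_gt0 : (0 < n)%N) (alpha_gt0 : 0 < alpha) (alpha_le1 : alpha <= 1).
Implicit Types (x y z : 'rV[R]_n) (s t : R) (f psi : 'rV[R]_n -> R).
Local Notation A := (Aalpha alpha).

Lemma testfun_mul_measurable y t psi f : 0 < t -> testfun alpha y t psi ->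
  measurable_fun [set: lebesgue_rV R n] f ->
  measurable_fun [set: lebesgue_rV R n] (fun z => (psi z * f z)%:E).
Proof.
move=> t0 hpsi mf; apply/measurable_EFinP; apply: measurable_funM => //.
exact: (testfun_measurable alpha_gt0 t0 hpsi).
Qed.

Lemma Aalpha_ge0 f y t : 0 < t -> (0 <= A f y t)%E.
Proof.
move=> t0; rewrite Aalpha_testfun//; apply: le_ereal_sup_tmp.
by eexists; first by exists (cst 0) => //; exact: testfun0.
Qed.

Lemma testfun_le_Aalpha f y t psi : 0 < t -> testfun alpha y t psi ->
  (`|\int[leb]_z (psi z * f z)%:E| <= A f y t)%E.
Proof.
by move=> t0 hpsi; rewrite Aalpha_testfun//; apply: ereal_sup_ubound; exists psi.
Qed.

Lemma Aalpha_leP f y t M : 0 < t ->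
  (forall psi, testfun alpha y t psi -> `|\int[leb]_z (psi z * f z)%:E| <= M)%E ->
  (A f y t <= M)%E.
Proof.
by move=> t0 h; rewrite Aalpha_testfun//; apply: ge_ereal_sup => _ [psi /h ? <-].
Qed.

(** [Aweight t * A y t] increases along cones. *)
Definition Aweight t := t ^+ n * t `^ alpha.

Lemma Aweight_gt0 t : 0 < t -> 0 < Aweight t.
Proof. by move=> t0; rewrite mulr_gt0 ?exprn_gt0 ?powR_gt0. Qed.

(** The factor is what the change of radius costs in the Hoelder condition. *)
Lemma testfun_widen x y s t psi : 0 < t -> enorm (y - x) <= s - t ->
  testfun alpha y t psi ->
  testfun alpha x s (fun z => Aweight t / Aweight s * psi z).
Proof.
move=> t0 xys hpsi; have [h1 h2 h3] := hpsi.
have ts : t <= s by have := le_trans (enorm_ge0 (y - x)) xys; rewrite subr_ge0.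
have s0 : 0 < s by exact: lt_le_trans ts.
have c0 : 0 < Aweight t / Aweight s by rewrite divr_gt0// Aweight_gt0.
split=> [z||z z'].
- rewrite mulf_eq0 gt_eqF//= => /h1 zy.
  by have := ler_enorm_dist z y x; lra.
- under eq_integral do rewrite EFinM.
  rewrite integralZ_gt0 ?h2 ?mule0//.
  by apply/measurable_EFinP; exact: (testfun_measurable alpha_gt0 t0 hpsi).
- rewrite -mulrBr normrM gtr0_norm//.
  apply: le_trans (ler_wpM2l (ltW c0) (h3 z z')) _.
  rewrite !powRM ?enorm_ge0 ?invr_ge0 ?(ltW t0) ?(ltW s0)//.
  rewrite /Aweight.
  have -> : t^-1 `^ alpha = (t `^ alpha)^-1.
    by rewrite -powR_inv1 ?(ltW t0)// -powRrM mulN1r powRN.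
  have -> : s^-1 `^ alpha = (s `^ alpha)^-1.
    by rewrite -powR_inv1 ?(ltW s0)// -powRrM mulN1r powRN.
  rewrite le_eqVlt; apply/orP; left; apply/eqP; field.
  by rewrite !gt_eqF ?exprn_gt0 ?powR_gt0.
Qed.

Lemma Aalpha_mono f x y s t : measurable_fun [set: lebesgue_rV R n] f ->
  0 < t -> enorm (y - x) <= s - t ->
  ((Aweight t)%:E * A f y t <= (Aweight s)%:E * A f x s)%E.
Proof.
move=> mf t0 xys.
have ts : t <= s by have := le_trans (enorm_ge0 (y - x)) xys; rewrite subr_ge0.
have s0 : 0 < s by exact: lt_le_trans ts.
have wt0 := Aweight_gt0 t0; have ws0 := Aweight_gt0 s0.
have c0 : 0 < Aweight t / Aweight s by rewrite divr_gt0.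
suff H : (A f y t <= (Aweight t)^-1%:E * ((Aweight s)%:E * A f x s))%E.
  by rewrite -lee_pdivlMl.
apply: Aalpha_leP => // psi hpsi; rewrite lee_pdivlMl//.
have := testfun_le_Aalpha f s0 (testfun_widen t0 xys hpsi).
under eq_integral do rewrite -mulrA EFinM.
rewrite (integralZ_gt0 _ c0 (testfun_mul_measurable t0 hpsi mf)).
rewrite abseM gee0_abs ?lee_fin ?(ltW c0)// mulrC EFinM -muleA.
by rewrite lee_pdivrMl.
Qed.

Lemma Aalpha_le f y t : measurable_fun [set: lebesgue_rV R n] f -> 0 < t ->
  (A f y t <= (3 * t ^- n)%:E * \int[leb]_(z in eball y (2 * t)) (`|f z|)%:E)%E.
Proof.
move=> mf t0; apply: Aalpha_leP => // psi hpsi.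
have mE : measurable (eball y (2 * t) : set (lebesgue_rV R n)) by exact: eball_leb.
have mpf := testfun_mul_measurable t0 hpsi mf.
have tn0 : 0 <= 3 * t ^- n by rewrite mulr_ge0// invr_ge0 exprn_ge0// ltW.
have mnf : measurable_fun (eball y (2 * t) : set (lebesgue_rV R n))
    (fun z => (`|f z|)%:E).
  by apply/measurable_EFinP; apply: measurableT_comp => //; exact: measurable_funTS.
apply: le_trans (le_abse_integral _ measurableT mpf) _.
rewrite -ge0_integralZl_EFin//.
rewrite [X in (X <= _)%E](_ : _ =
    \int[leb]_(z in eball y (2 * t)) `|(psi z * f z)%:E|)%E; last first.
  rewrite [RHS]integral_mkcond; apply: eq_integral => z _.
  rewrite patchE; case: ifPn => //; rewrite notin_setE => zy.
  by rewrite (testfun_supp t0 hpsi zy) mul0r abse0.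
apply: (ge0_le_integral _ mE).
- by move=> z _; exact: abse_ge0.
- by apply: measurable_funTS; apply: measurableT_comp; first exact: abse_measurable.
- exact: measurable_funeM.
- move=> z _; rewrite abse_EFin normrM -EFinM lee_fin ler_wpM2r//.
  exact: (testfun_le n_gt0 _ _ _ hpsi).
Qed.

Lemma Aalpha_local f g y t : 0 < t ->
  (forall z, eball y (2 * t) z -> f z = g z) -> A f y t = A g y t.
Proof.
move=> t0 fg; rewrite !Aalpha_testfun//; congr ereal_sup.
apply/eq_imagel => psi hpsi; congr (`| _ |)%E; apply: eq_integral => z _.
have [/fg ->//|/(testfun_supp t0 hpsi) ->] := pselect (eball y (2 * t) z).
by rewrite !mul0r.
Qed.

Lemma Aalpha_eq0 f y t : 0 < t ->
  (forall z, eball y (2 * t) z -> f z = 0) -> A f y t = 0%E.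
Proof.
move=> t0 f0; apply/eqP; rewrite eq_le Aalpha_ge0// andbT.
rewrite (Aalpha_local (g := cst 0) t0 f0); apply: Aalpha_leP => // psi _.
by under eq_integral do rewrite mulr0; rewrite integral0 abse0.
Qed.

Lemma AalphaD f g y t : 0 < t ->
  leb.-integrable (eball y (2 * t)) (EFin \o f) ->
  leb.-integrable (eball y (2 * t)) (EFin \o g) ->
  (A (f \+ g)%R y t <= A f y t + A g y t)%E.
Proof.
move=> t0 intf intg; apply: Aalpha_leP => // psi hpsi.
rewrite (_ : (\int[leb]_z _)%E = \int[leb]_z (psi z * f z)%:E +
    \int[leb]_z (psi z * g z)%:E)%E; last first.
  rewrite -integralD//; try exact: (@testfun_integrable _ _ alpha n_gt0 alpha_gt0 alpha_le1 y t).
  by apply: eq_integral => z _; rewrite /= mulrDr EFinD.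
apply: le_trans (lee_abs_add _ _) _.
by apply: leeD; exact: testfun_le_Aalpha.
Qed.

(** Since [b] has mean zero, the test function may be replaced by its difference
    with its value at [c], which is small on the support of [b]. *)
Lemma Aalpha_cancel b y t c (l : R) : 0 < t -> 0 < l ->
  leb.-integrable setT (EFin \o b) -> (\int[leb]_z (b z)%:E = 0)%E ->
  (forall z, b z != 0 -> enorm (z - c) <= l) ->
  (A b y t <= (t ^- n * (l / t) `^ alpha)%:E * \int[leb]_z (`|b z|)%:E)%E.
Proof.
move=> t0 l0 intb b0 bl; apply: Aalpha_leP => // psi hpsi.
have tn0 : 0 <= t ^- n by rewrite invr_ge0 exprn_ge0// ltW.
have intpb : leb.-integrable setT (fun z => (psi z * b z)%:E).
  apply: (testfun_integrable n_gt0 alpha_gt0 alpha_le1 t0 hpsi).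
  by apply: integrableS intb => //; exact: eball_leb.
have -> : (\int[leb]_z (psi z * b z)%:E = \int[leb]_z ((psi z - psi c) * b z)%:E)%E.
  under [RHS]eq_integral do rewrite mulrBl EFinB.
  rewrite integralB//; last first.
    by apply: eq_integrable (integrableZl measurableT (psi c) intb).
  under [in X in (_ - X)%E]eq_integral do rewrite EFinM.
  by rewrite integralZl// b0 mule0 sube0.
have mb : measurable_fun [set: lebesgue_rV R n] b.
  by apply/measurable_EFinP; exact: measurable_int intb.
have mpb : measurable_fun [set: lebesgue_rV R n]
    (fun z => ((psi z - psi c) * b z)%:E).
  apply/measurable_EFinP; apply: measurable_funM; last exact: mb.
  apply: measurable_funB; last exact: measurable_cst.
  exact: (testfun_measurable alpha_gt0 t0 hpsi).
apply: le_trans (le_abse_integral _ measurableT mpb) _.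
have mab : measurable_fun [set: lebesgue_rV R n] (fun z => `|b z|%:E).
  by apply/measurable_EFinP; apply: measurableT_comp; last exact: mb.
have k0 : 0 <= t ^- n * (l / t) `^ alpha by rewrite mulr_ge0// powR_ge0.
rewrite -(ge0_integralZl_EFin _ measurableT _ mab k0); last first.
  by move=> z _; rewrite lee_fin.
apply: (ge0_le_integral _ measurableT).
- by move=> z _; exact: abse_ge0.
- by apply: measurableT_comp; first exact: abse_measurable.
- exact: measurable_funeM.
move=> z _; rewrite abse_EFin normrM -EFinM lee_fin.
have [->|/bl zc] := eqVneq (b z) 0; first by rewrite normr0 !mulr0.
apply: ler_wpM2r => //; have [_ _ h3] := hpsi.
apply: le_trans (h3 z c) _; apply: ler_wpM2l => //.
apply: ge0_ler_powR => //; first exact: ltW.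
- by rewrite nnegrE divr_ge0 ?enorm_ge0// ltW.
- by rewrite nnegrE divr_ge0// ltW.
by rewrite ler_pM2r// invr_gt0.
Qed.

Lemma testfun_integrableT y t psi : 0 < t -> testfun alpha y t psi ->
  leb.-integrable setT (EFin \o psi).
Proof.
move=> t0 hpsi; have mE : measurable (eball y (2 * t) : set (lebesgue_rV R n)).
  exact: eball_leb.
have H := @testfun_integrable _ _ alpha n_gt0 alpha_gt0 alpha_le1 y t psi
  (cst 1) t0 hpsi.
rewrite (_ : EFin \o psi = fun z => (psi z * cst 1 z)%:E); last first.
  by apply/funext => z; rewrite mulr1.
apply: H; apply: measurable_bounded_integrable => //.
- rewrite (le_lt_trans (leb_eball_le y _)) ?ltry// mulr_gt0//.
- exists 1; split; first exact: num_real.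
  by move=> M M1 z _; rewrite /= normr1 ltW.
Qed.

(** Almost orthogonality: the wider test function is nearly constant on the
    support of the narrower one, whose integral vanishes. *)
Lemma testfun_orthogonal y t psi y' t' psi' : 0 < t' -> 0 < t ->
  testfun alpha y t psi -> testfun alpha y' t' psi' ->
  (`|\int[leb]_z (psi z * psi' z)%:E| <=
   (3 * 4 ^+ n * (t ^- n * (t' / t) `^ alpha))%:E)%E.
Proof.
move=> t'0 t0 hpsi hpsi'; have [h1 h2 _] := hpsi'.
apply: le_trans (testfun_le_Aalpha _ t0 hpsi) _.
have := Aalpha_cancel y t0 t'0 (testfun_integrableT t'0 hpsi') h2 h1.
move=> /le_trans; apply.
have tn0 : 0 <= t ^- n by rewrite invr_ge0 exprn_ge0// ltW.
have t'n0 : 0 <= 3 * t' ^- n by rewrite mulr_ge0// invr_ge0 exprn_ge0// ltW.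
rewrite [in leRHS]mulrC [in leRHS]EFinM; apply: lee_wpmul2l.
  by rewrite lee_fin mulr_ge0// powR_ge0.
have mE : measurable (eball y' (2 * t') : set (lebesgue_rV R n)).
  exact: eball_leb.
rewrite (_ : (\int[leb]_z _)%E =
    \int[leb]_(z in eball y' (2 * t')) (`|psi' z|)%:E)%E; last first.
  rewrite [RHS]integral_mkcond; apply: eq_integral => z _.
  rewrite patchE; case: ifPn => //; rewrite notin_setE => zy.
  by rewrite (testfun_supp t'0 hpsi' zy) normr0.
apply: (@le_trans _ _ (\int[leb]_(z in eball y' (2 * t')) (3 * t' ^- n)%:E)%E).
  apply: ge0_le_integral => //.
    apply/measurable_EFinP; apply: measurableT_comp => //.
    exact: measurable_funTS (testfun_measurable alpha_gt0 t'0 hpsi').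
  by move=> z _; rewrite lee_fin (testfun_le n_gt0 _ _ _ hpsi').
rewrite integral_cst//.
have t'2 : 0 < 2 * t' by rewrite mulr_gt0.
apply: le_trans (lee_wpmul2l _ (leb_eball_le y' t'2)) _; first by rewrite lee_fin.
rewrite -EFinM lee_fin -mulrA ler_wpM2l// mulrA -natrM exprMn.
by rewrite mulrCA mulVf ?mulr1// gt_eqF// exprn_gt0.
Qed.

Lemma testfun_disjoint y t psi y' t' psi' z : testfun alpha y t psi ->
  testfun alpha y' t' psi' -> t + t' < enorm (y - y') -> psi z * psi' z = 0.
Proof.
move=> [h1 _ _] [h2 _ _] yy'.
have [->|/h1 zy] := eqVneq (psi z) 0; first by rewrite mul0r.
have [->|/h2 zy'] := eqVneq (psi' z) 0; first by rewrite mulr0.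
by have := ler_enorm_dist y z y'; rewrite (enormB y z); lra.
Qed.

End Aalpha.

(** * Almost orthogonal families *)

Section Rintegral_sum.
Context d (T : measurableType d) (R : realType).
Variable mu : {measure set T -> \bar R}.

Lemma integrable_lin (I : Type) (s : seq I) (u : I -> R) (g : I -> T -> R) :
  (forall i, mu.-integrable setT (fun x => (g i x)%:E)) ->
  mu.-integrable setT (fun x => (\sum_(i <- s) u i * g i x)%:E).
Proof.
move=> ig; apply: (eq_integrable measurableT
    (fun x => (\sum_(i <- s) (u i)%:E * (g i x)%:E)%E)).
  by move=> x _; rewrite -sumEFin; apply: eq_bigr => i _; rewrite EFinM.
by apply: integrable_sum => // i _; apply: integrableZl.
Qed.

Lemma Rintegral_lin (I : Type) (s : seq I) (u : I -> R) (g : I -> T -> R) :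
  (forall i, mu.-integrable setT (fun x => (g i x)%:E)) ->
  \int[mu]_x (\sum_(i <- s) u i * g i x) = \sum_(i <- s) u i * \int[mu]_x g i x.
Proof.
move=> ig; rewrite /Rintegral.
have ->: (\int[mu]_x (\sum_(i <- s) u i * g i x)%:E =
    \int[mu]_x \sum_(i <- s) ((u i)%:E * (g i x)%:E))%E.
  by apply: eq_integral => x _; rewrite -sumEFin; apply: eq_bigr => i _; rewrite EFinM.
rewrite integral_sum//; last by move=> i; apply: integrableZl.
under eq_bigr => i _ do rewrite integralZl// -(@fineK _ (\int[mu]_x _)%E) ?integrable_fin_num// -EFinM.
by rewrite sumEFin.
Qed.

(** If the Gram matrix passes Schur's test then Bessel's inequality holds up to
    a constant: expand the integral of the square of
    [f - C^-1 * \sum_i q_i <psi_i, f> psi_i]. *)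
Lemma bessel_schur (I : eqType) (s : seq I) (q : I -> R) (psi : I -> T -> R)
    (f : T -> R) (C : R) :
  0 < C -> (forall i, 0 <= q i) ->
  mu.-integrable setT (fun x => (f x ^+ 2)%:E) ->
  (forall i, mu.-integrable setT (fun x => (psi i x * f x)%:E)) ->
  (forall i j, mu.-integrable setT (fun x => (psi i x * psi j x)%:E)) ->
  (forall i, i \in s ->
    \sum_(j <- s) q j * `|\int[mu]_x (psi i x * psi j x)| <= C) ->
  \sum_(i <- s) q i * (\int[mu]_x (psi i x * f x)) ^+ 2 <=
    C * \int[mu]_x (f x ^+ 2).
Proof.
move=> C0 q0 if2 ipf ipp schur.
pose a i := \int[mu]_x (psi i x * f x).
pose k i j := \int[mu]_x (psi i x * psi j x).
have kC i j : k i j = k j i.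
  by apply: eq_Rintegral => x _; rewrite mulrC.
set S := \sum_(i <- s) _.
pose u i := q i * a i.
pose Z := \sum_(i <- s) \sum_(j <- s) (u i * u j) * k i j.
have ZC : Z <= C * S.
  apply: (@le_trans _ _ (\sum_(i <- s) \sum_(j <- s)
     (q i * q j * `|k i j| * (a i ^+ 2 / 2) + q i * q j * `|k i j| * (a j ^+ 2 / 2)))).
    apply: ler_sum => i _; apply: ler_sum => j _.
    rewrite -mulrDr /u.
    have -> : q i * a i * (q j * a j) * k i j = q i * q j * (a i * a j * k i j) by ring.
    rewrite -[leRHS]mulrA; apply: ler_wpM2l; first by rewrite mulr_ge0.
    apply: le_trans (ler_norm _) _; rewrite normrM mulrC.
    apply: ler_wpM2l => //; rewrite normrM.
    rewrite -(real_normK (num_real (a i))) -(real_normK (num_real (a j))).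
    have := sqr_ge0 (`|a i| - `|a j|); nra.
  under eq_bigr do rewrite big_split/=.
  rewrite big_split/=.
  rewrite [X in _ + X]exchange_big/=.
  have E i : \sum_(j <- s) q j * q i * `|k j i| * (a i ^+ 2 / 2) =
    \sum_(j <- s) q i * q j * `|k i j| * (a i ^+ 2 / 2).
    by apply: eq_bigr => j _; rewrite kC (mulrC (q j)).
  under [X in _ + X]eq_bigr do rewrite E.
  rewrite -big_split/= mulr_sumr big_seq [leRHS]big_seq; apply: ler_sum => i si.
  have := schur i si; rewrite -/(k i _) => H.
  have -> : \sum_(j <- s) q i * q j * `|k i j| * (a i ^+ 2 / 2) =
      q i * a i ^+ 2 / 2 * \sum_(j <- s) q j * `|k i j|.
    by rewrite mulr_sumr; apply: eq_bigr => j _; ring.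
  rewrite -mulrDl -splitr mulrC; apply: ler_wpM2r => //.
  by rewrite mulr_ge0// sqr_ge0.
pose F x := f x ^+ 2 + (\sum_(i <- s) (- 2 * C^-1 * u i) * (psi i x * f x) +
  \sum_(p <- [seq (i, j) | i <- s, j <- s])
    (C^-1 ^+ 2 * (u p.1 * u p.2)) * (psi p.1 x * psi p.2 x)).
have FE x : F x = (f x - C^-1 * \sum_(i <- s) u i * psi i x) ^+ 2.
  rewrite /F sqrrB addrA; congr (_ + _ + _).
    rewrite !mulr_sumr -sumrMnl -sumrN.
    by apply: eq_bigr => i _; ring.
  rewrite exprMn big_allpairs_dep/= (expr2 (\sum_(i <- s) _)) mulr_suml mulr_sumr.
  apply: eq_bigr => i _; rewrite !mulr_sumr; apply: eq_bigr => j _ /=.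
  by ring.
have F0 : 0 <= \int[mu]_x F x.
  by apply: Rintegral_ge0 => x _; rewrite FE sqr_ge0.
have i1 := integrable_lin s (fun i => - 2 * C^-1 * u i) ipf.
have i2 := @integrable_lin _ [seq (i, j) | i <- s, j <- s]
  (fun p => C^-1 ^+ 2 * (u p.1 * u p.2)) (fun p x => psi p.1 x * psi p.2 x)
  (fun p => ipp p.1 p.2).
have i3 := integrableD measurableT i1 i2.
have E1 : \int[mu]_x F x = \int[mu]_x (f x ^+ 2) +
  (\sum_(i <- s) (- 2 * C^-1 * u i) * a i +
   \sum_(p <- [seq (i, j) | i <- s, j <- s])
    (C^-1 ^+ 2 * (u p.1 * u p.2)) * k p.1 p.2).
  rewrite /F RintegralD//; congr (_ + _).
  rewrite RintegralD// Rintegral_lin//; congr (_ + _).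
  by rewrite Rintegral_lin// => p; exact: ipp.
move: F0; rewrite E1 big_allpairs_dep/=.
have -> : \sum_(i <- s) - 2 * C^-1 * u i * a i = - 2 * C^-1 * S.
  by rewrite mulr_sumr; apply: eq_bigr => i _; rewrite /u -/(a i); ring.
have -> : \sum_(i <- s) \sum_(j <- s) C^-1 ^+ 2 * (u i * u j) * k i j = C^-1 ^+ 2 * Z.
  rewrite mulr_sumr; apply: eq_bigr => i _; rewrite mulr_sumr.
  by apply: eq_bigr => j _; ring.
move=> H.
have H2 : C^-1 ^+ 2 * Z <= C^-1 * S.
  rewrite expr2 -mulrA; apply: ler_wpM2l; first by rewrite invr_ge0 ltW.
  by rewrite ler_pdivrMl.
rewrite -ler_pdivrMl//.
have : - 2 * C^-1 * S = - (C^-1 * S) * 2 by ring.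
by lra.
Qed.

End Rintegral_sum.

(** * Test functions attached to dyadic cubes *)

Lemma powR_half_lt1 (R : realType) (a : R) : 0 < a -> 2^-1 `^ a < 1.
Proof.
move=> a0; have e : 1 `^ a = 1 :> R by rewrite powR1.
rewrite -[ltRHS]e; apply: gt0_ltr_powR => //; rewrite ?nnegrE//.
by rewrite invf_lt1// ltr1n.
Qed.

Section L2.
Context {R : realType} {n : nat}.
Local Notation leb := (@lebesgueRn R n).
Variables (alpha : R).
Hypotheses (n_gt0 : (0 < n)%N) (alpha_gt0 : 0 < alpha) (alpha_le1 : alpha <= 1).
Implicit Types (o x y z : 'rV[R]_n) (s t : R) (f psi : 'rV[R]_n -> R).
Local Notation A := (Aalpha alpha).

Definition side (h : R) (m : nat) : R := h * 2 ^+ m.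
Definition radius (d : nat) (h : R) m : R := d.+1%:R * side h m.

Lemma side_gt0 h m : 0 < h -> 0 < side h m.
Proof. by move=> h0; rewrite mulr_gt0// exprn_gt0. Qed.

Lemma radius_gt0 h m : 0 < h -> 0 < radius n h m.
Proof. by move=> h0; rewrite mulr_gt0// side_gt0. Qed.

Lemma le_side h m m' : 0 < h -> (m <= m')%N -> side h m <= side h m'.
Proof. by move=> h0 mm'; rewrite ler_pM2l// ler_weXn2l// ler1n. Qed.

Lemma cube_sub_eball o (l : R) (j : 'rV[int]_n) : 0 < l ->
  cube o l j `<=` eball (corner o l j) (n.+1%:R * l).
Proof.
move=> l0 x /(cube_enorm l0) h; rewrite /eball/=; apply: le_lt_trans h _.
by rewrite ltr_pM2r// ltr_nat.
Qed.

(** Distinct cubes of a grid are disjoint. *)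
Lemma sum_cubes_le (mu : {measure set (lebesgue_rV R n) -> \bar R}) o (l : R)
    (s : seq 'rV[int]_n) (E : set (lebesgue_rV R n)) : 0 < l ->
  uniq s -> measurable E -> (forall j, j \in s -> cube o l j `<=` E) ->
  (\sum_(j <- s) mu (cube o l j) <= mu E)%E.
Proof.
move=> l0; elim: s E => [|j s IH] E /=; first by rewrite big_nil.
move=> /andP[js us] mE sE; rewrite big_cons.
have mj : measurable (cube o l j : set (lebesgue_rV R n)) by exact: cube_leb.
have jE : cube o l j `<=` E by apply: sE; rewrite mem_head.
have -> : mu E = (mu (cube o l j) + mu (E `\` cube o l j))%E.
  rewrite (measureDI mu mE mj) setIC (setIidl _)// addeC.
  by [].
apply: leeD => //; apply: IH => //; first exact: measurableD.
move=> j' j's x xj'; split; first by apply: sE xj'; rewrite inE j's orbT.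
by move=> xj; move: js; rewrite -(xj : _ = j) (xj' : _ = j') j's.
Qed.

Lemma count_cubes_le o y (l rho : R) (s : seq 'rV[int]_n) : 0 < l -> 0 < rho ->
  uniq s -> (forall j, j \in s -> cube o l j `<=` eball y rho) ->
  \sum_(j <- s) l ^+ n <= (2 * rho) ^+ n.
Proof.
move=> l0 rho0 us sE; rewrite -lee_fin -sumEFin.
have := sum_cubes_le leb l0 us (eball_leb y rho) sE.
have -> : (\sum_(j <- s) leb (cube o l j) = \sum_(j <- s) (l ^+ n)%:E)%E.
  by apply: eq_bigr => j _; exact: lebesgueRn_cube.
by move=> /le_trans; apply; exact: leb_eball_le.
Qed.

Let q : R := 2^-1 `^ alpha.

Let q_gt0 : 0 < q. Proof. by rewrite powR_gt0// invr_gt0. Qed.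

Let q_lt1 : q < 1. Proof. exact: powR_half_lt1. Qed.

Lemma powR_ratio h m m' : 0 < h -> (m' <= m)%N ->
  (radius n h m' / radius n h m) `^ alpha = q ^+ (m - m').
Proof.
move=> h0 mm'; have -> : radius n h m' / radius n h m = 2^-1 ^+ (m - m').
  have e : 2 ^+ m = 2 ^+ m' * 2 ^+ (m - m') :> R by rewrite -exprD subnKC.
  rewrite /radius /side e exprVn; field.
  by rewrite !expf_neq0 ?gt_eqF//= pnatr_eq0.
transitivity ((2^-1 `^ (m - m')%:R) `^ alpha).
  by rewrite powR_mulrn ?invr_ge0.
by rewrite -powRrM mulrC powRrM powR_mulrn ?powR_ge0.
Qed.

Lemma geo_sum_le (r : R) N : 0 < r < 1 -> \sum_(i < N) r ^+ i <= (1 - r)^-1.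
Proof.
move=> /andP[r0 r1]; rewrite -[leRHS]mul1r ler_pdivlMr ?subr_gt0// mulrC.
have := subrX1 r N; have := exprn_ge0 N (ltW r0).
set S := \sum_(i < N) _; nra.
Qed.

(** The truncated differences add up to the distance of [m] and [i]. *)
Lemma geo_dist_sum_le (r : R) m N : 0 < r < 1 ->
  \sum_(i < N) r ^+ (m - i + (i - m)) <= 2 * (1 - r)^-1.
Proof.
move=> r01; have /andP[r0 r1] := r01.
have S0 : 0 <= (1 - r)^-1 by rewrite invr_ge0 subr_ge0 ltW.
have : \sum_(i < N) r ^+ (m - i + (i - m)) <=
    \sum_(i < m) r ^+ i + (1 - r)^-1.
  elim: m N => [|m IH] N.
    rewrite big_ord0 add0r; apply: le_trans (geo_sum_le N r01).
    by apply: ler_sum => i _; rewrite sub0n subn0.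
  case: N => [|N].
    rewrite big_ord0 addr_ge0// sumr_ge0// => i _; exact/exprn_ge0/ltW.
  rewrite big_ord_recl/= subn0 sub0n addn0 big_ord_recr/= addrAC [leLHS]addrC.
  apply: lerD.
    apply: le_trans (IH N); apply: ler_sum => i _.
    by rewrite /bump/= add1n !subSS.
  by rewrite exprS ler_piMl ?exprn_ge0 ?ltW.
by have := geo_sum_le m r01; lra.
Qed.

Let y_ o h (i : nat * 'rV[int]_n) := corner o (side h i.1) i.2.

(** Hypothesis of Schur's test for one test function per cube.  The pairing with
    the test functions of scale [j] decays like the power [alpha] of the ratio of
    the scales, and the cubes of that scale which are close enough to interact
    have total volume at most a constant times that of the larger ball. *)
Lemma testfun_schur : exists2 C, 0 < C & forall o h, 0 < h ->
  forall (psi : nat * 'rV[int]_n -> 'rV[R]_n -> R),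
  (forall i, testfun alpha (corner o (side h i.1) i.2) (radius n h i.1) (psi i)) ->
  forall s : seq (nat * 'rV[int]_n), uniq s -> forall i, i \in s ->
  \sum_(j <- s) side h j.1 ^+ n * `|\int[leb]_x (psi i x * psi j x)| <= C.
Proof.
pose D : R := 3 * 4 ^+ n * 8 ^+ n.
have D0 : 0 < D by rewrite !mulr_gt0 ?exprn_gt0.
have q01 : 0 < q < 1 by rewrite q_gt0.
have [q0 q1] := andP q01.
have S0 : 0 < (1 - q)^-1 by rewrite invr_gt0 subr_gt0.
exists (D * (2 * (1 - q)^-1)); first by rewrite !mulr_gt0.
move=> o h h0 psi hpsi s us i si.
pose M j := Num.max (radius n h i.1) (radius n h j).
have M0 j : 0 < M j by rewrite lt_max !radius_gt0.
pose dq j := q ^+ (i.1 - j + (j - i.1)).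
have dq0 j : 0 <= dq j by rewrite exprn_ge0// ltW.
have kle j : `|\int[leb]_x (psi i x * psi j x)| <=
    (if enorm (y_ o h i - y_ o h j) <= 2 * M j.1 then 3 * 4 ^+ n * (M j.1 ^- n * dq j.1) else 0).
  case: ifPn => [_|]; last first.
    rewrite -ltNge => yij.
    have -> : \int[leb]_x (psi i x * psi j x) = \int[leb]_x (0:R).
      apply: eq_Rintegral => x _.
      apply: (testfun_disjoint x (hpsi i) (hpsi j)); apply: le_lt_trans yij.
      by rewrite mulr2n mulrDl mul1r; apply: lerD; rewrite le_max lexx ?orbT.
    by rewrite /Rintegral integral0 /= normr0.
  have intE : leb.-integrable setT (fun x => (psi i x * psi j x)%:E).
    have := @testfun_integrable _ _ alpha n_gt0 alpha_gt0 alpha_le1 _ _ _ (psi j)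
     (radius_gt0 i.1 h0) (hpsi i); apply.
    have := testfun_integrableT n_gt0 alpha_gt0 alpha_le1 (radius_gt0 j.1 h0) (hpsi j).
    by apply: integrableS => //; exact: eball_leb.
  rewrite -lee_fin EFin_normr_Rintegral//.
  have [ij|ji] := leqP j.1 i.1.
    have := testfun_orthogonal n_gt0 alpha_gt0 alpha_le1 (radius_gt0 j.1 h0)
      (radius_gt0 i.1 h0) (hpsi i) (hpsi j).
    rewrite powR_ratio// /dq (eqP ij) addn0 /M max_l//.
    by rewrite ler_pM2l// le_side.
  have ij := ltnW ji.
  have := testfun_orthogonal n_gt0 alpha_gt0 alpha_le1 (radius_gt0 i.1 h0)
      (radius_gt0 j.1 h0) (hpsi j) (hpsi i).
  rewrite powR_ratio// /dq (eqP ij) add0n /M max_r//; last first.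
    by rewrite ler_pM2l// le_side.
  by under [X in (`|X|)%E]eq_integral do rewrite mulrC.
pose N := (\max_(j <- s) j.1).+1.
have sN j : j \in s -> (j.1 < N)%N.
  by move=> js; rewrite ltnS; apply: (@leq_bigmax_seq _ s xpredT fst).
have -> : \sum_(j <- s) side h j.1 ^+ n * `|\int[leb]_x (psi i x * psi j x)| =
  \sum_(m < N) \sum_(j <- s | j.1 == m)
    side h j.1 ^+ n * `|\int[leb]_x (psi i x * psi j x)|.
  rewrite (exchange_big_dep xpredT)//= big_seq [RHS]big_seq.
  apply: eq_bigr => j js; by rewrite (big_pred1 (Ordinal (sN j js))).
apply: (@le_trans _ _ (\sum_(m < N) D * dq m)); last first.
  by rewrite -mulr_sumr ler_pM2l//; exact: geo_dist_sum_le.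
apply: ler_sum => m _.
have Mn0 : 0 < M m ^+ n by rewrite exprn_gt0.
pose near (j : nat * 'rV[int]_n) :=
  (j.1 == m :> nat) && (enorm (y_ o h i - y_ o h j) <= 2 * M m).
pose J := [seq j.2 | j <- seq.filter near s].
apply: (@le_trans _ _ (\sum_(j <- J) side h m ^+ n * (3 * 4 ^+ n * (M m ^- n * dq m)))).
  rewrite /J big_map big_filter big_mkcondr/=.
  apply: ler_sum => j /eqP jm; have := kle j; rewrite jm.
  case: ifPn => _ H; first by apply: ler_wpM2l; rewrite ?exprn_ge0// ltW// side_gt0.
  have -> : `|\int[leb]_x (psi i x * psi j x)| = 0.
    by apply/eqP; rewrite eq_le H normr_ge0.
  by rewrite mulr0.
rewrite -mulr_suml.
have cnt : \sum_(j <- J) side h m ^+ n <= (2 * (4 * M m)) ^+ n.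
  apply: (@count_cubes_le o (y_ o h i)); rewrite ?side_gt0 ?mulr_gt0//.
    rewrite map_inj_in_uniq ?filter_uniq// => -[a1 a2] [b1 b2].
    rewrite !mem_filter/near/= => /andP[/andP[/eqP -> _] _] /andP[/andP[/eqP -> _] _].
    by move=> ->.
  move=> j /mapP[[m' j']]; rewrite mem_filter/near/= => /andP[/andP[/eqP -> ij] _] ->.
  move=> x /cube_sub_eball => /(_ (side_gt0 m h0)); apply: sub_eball.
  have : radius n h m <= M m by rewrite le_max lexx orbT.
  move: ij; rewrite /radius -/(side h m) (enormB (y_ o h i)) /y_/=.
  by have := M0 m; lra.
have H0 : 0 <= 3 * 4 ^+ n * (M m ^- n * dq m).
  by rewrite !mulr_ge0// invr_ge0 ltW.
apply: le_trans (ler_wpM2r H0 cnt) _.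
rewrite mulrA -natrM exprMn le_eqVlt; apply/orP; left; apply/eqP.
by rewrite /D; field; rewrite gt_eqF.
Qed.

End L2.

(** * The square function estimate with weights *)

Lemma ae_imp d (T : measurableType d) (R : realType)
    (mu : {measure set T -> \bar R}) (P Q : T -> Prop) :
  (forall x, P x -> Q x) -> {ae mu, forall x, P x} -> {ae mu, forall x, Q x}.
Proof. by move=> PQ; apply: filterS. Qed.

Section L2_weighted.
Context {R : realType} {n : nat}.
Local Notation leb := (@lebesgueRn R n).
Variables (alpha : R).
Hypotheses (n_gt0 : (0 < n)%N) (alpha_gt0 : 0 < alpha) (alpha_le1 : alpha <= 1).
Implicit Types (o x y z : 'rV[R]_n) (s t : R) (f psi : 'rV[R]_n -> R).
Local Notation A := (Aalpha alpha).

Lemma Aalpha_fin f y t : measurable_fun [set: lebesgue_rV R n] f -> 0 < t ->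
  leb.-integrable (eball y (2 * t)) (EFin \o f) -> A f y t \is a fin_num.
Proof.
move=> mf t0 intf; rewrite ge0_fin_numE; last exact: Aalpha_ge0.
apply: (le_lt_trans (Aalpha_le n_gt0 alpha_gt0 alpha_le1 _ mf t0)).
have /integrableP[_ foo] := intf.
by rewrite lte_mul_pinfty// lee_fin mulr_ge0// invr_ge0 exprn_ge0// ltW.
Qed.

(** The contribution to the square of the [L^2] norm of the square function of
    the cube of index [j.2] and side [side h j.1]. *)
Definition energy o h f (j : nat * 'rV[int]_n) : \bar R :=
  ((side h j.1 ^+ n)%:E * A f (corner o (side h j.1) j.2) (radius n h j.1) ^+ 2)%E.

Lemma sqre_ge0 (x : \bar R) : (0 <= x ^+ 2)%E.
Proof. by case: x => [r| |]//=; rewrite lee_fin sqr_ge0. Qed.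

Lemma energy_ge0 o h f j : 0 < h -> (0 <= energy o h f j)%E.
Proof. by move=> h0; rewrite mule_ge0 ?sqre_ge0// lee_fin exprn_ge0// ltW// side_gt0. Qed.

(** Pick for each cube a test function that realises half of the supremum; these
    are almost orthogonal. *)
Lemma energy_le : exists2 C : R, 0 < C & forall o h, 0 < h ->
  forall f, leb.-integrable setT (EFin \o f) ->
  leb.-integrable setT (fun x => (f x ^+ 2)%:E) ->
  forall s : seq (nat * 'rV[int]_n), uniq s ->
  (\sum_(j <- s) energy o h f j <= C%:E * \int[leb]_x (f x ^+ 2)%:E)%E.
Proof.
have [C C0 HC] := testfun_schur n_gt0 alpha_gt0 alpha_le1.
exists (4 * C); first by rewrite mulr_gt0.
move=> o h h0 f intf intf2 s us.
have mf : measurable_fun [set: lebesgue_rV R n] f.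
  by apply/measurable_EFinP; exact: measurable_int intf.
pose a (j : nat * 'rV[int]_n) := A f (corner o (side h j.1) j.2) (radius n h j.1).
have intfb y t : leb.-integrable (eball y t) (EFin \o f).
  by apply: integrableS intf => //; exact: eball_leb.
have afin j : a j \is a fin_num.
  by apply: Aalpha_fin => //; exact: radius_gt0.
have a0 j : (0 <= a j)%E by apply: Aalpha_ge0 => //; exact: radius_gt0.
have : forall j, exists psi,
    testfun alpha (corner o (side h j.1) j.2) (radius n h j.1) psi /\
    fine (a j) <= 2 * `|\int[leb]_x (psi x * f x)|.
  move=> j; have r0 : 0 < radius n h j.1 by exact: radius_gt0.
  have [aj0|aj0] := eqVneq (fine (a j)) 0.
    by exists (cst 0); split; [exact: testfun0|rewrite aj0 mulr_ge0].
  have aj1 : 0 < fine (a j) by rewrite lt_neqAle eq_sym aj0 fine_ge0.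
  have : ((fine (a j) / 2)%:E < a j)%E.
    by rewrite -[in ltRHS](fineK (afin j)) lte_fin; lra.
  rewrite {2}/a Aalpha_testfun// => /ereal_sup_gt[_ [psi hpsi <-]] H.
  exists psi; split => //.
  have ipf := testfun_integrable n_gt0 alpha_gt0 alpha_le1 r0 hpsi (intfb _ _).
  by move: H; rewrite -EFin_normr_Rintegral// lte_fin; lra.
move=> /choice[psi hpsi].
have HS := @bessel_schur _ _ _ leb _ s (fun j => side h j.1 ^+ n) psi f C C0.
have : \sum_(j <- s) side h j.1 ^+ n * (\int[leb]_x (psi j x * f x)) ^+ 2 <=
    C * \int[leb]_x (f x ^+ 2).
  apply: HS => //.
  - by move=> j; rewrite exprn_ge0// ltW// side_gt0.
  - move=> j; have r0 : 0 < radius n h j.1 by exact: radius_gt0.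
    exact: (testfun_integrable n_gt0 alpha_gt0 alpha_le1 r0 (hpsi j).1 (intfb _ _)).
  - move=> i j; have ri : 0 < radius n h i.1 by exact: radius_gt0.
    have rj : 0 < radius n h j.1 by exact: radius_gt0.
    apply: (testfun_integrable n_gt0 alpha_gt0 alpha_le1 ri (hpsi i).1).
    have := testfun_integrableT n_gt0 alpha_gt0 alpha_le1 rj (hpsi j).1.
    by apply: integrableS => //; exact: eball_leb.
  - by move=> i si; apply: (HC o h h0 psi (fun j => (hpsi j).1) s us i si).
move=> H.
have -> : (\sum_(j <- s) energy o h f j =
    (\sum_(j <- s) side h j.1 ^+ n * fine (a j) ^+ 2)%:E)%E.
  rewrite -sumEFin; apply: eq_bigr => j _; rewrite /energy -/(a j).
  by rewrite -[in LHS](fineK (afin j)).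
have -> : (\int[leb]_x (f x ^+ 2)%:E = (\int[leb]_x (f x ^+ 2))%:E)%E.
  by rewrite /Rintegral fineK// integrable_fin_num.
rewrite -EFinM lee_fin -mulrA.
apply: le_trans (ler_wpM2l _ H) => //.
rewrite mulr_sumr; apply: ler_sum => j _.
rewrite [leRHS]mulrCA; apply: ler_wpM2l; first by rewrite exprn_ge0// ltW// side_gt0.
have [_ aj] := hpsi j.
rewrite -(real_normK (num_real (Rintegral _ _ _))).
have := fine_ge0 (a0 j); move: aj; set u := `|_|; set v := fine _; nra.
Qed.

Lemma energy_local o h f g j : 0 < h ->
  (forall x, eball (corner o (side h j.1) j.2) (2 * radius n h j.1) x -> f x = g x) ->
  energy o h f j = energy o h g j.
Proof.
move=> h0 fg; rewrite /energy; congr (_ * _ ^+ 2)%E.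
by apply: Aalpha_local => //; exact: radius_gt0.
Qed.

Lemma seq_min (I : eqType) (s : seq I) (mu : I -> R) : s != [::] ->
  exists2 i, i \in s & forall j, j \in s -> mu i <= mu j.
Proof.
elim: s => // i s IH _; have [->|s0] := eqVneq s [::].
  by exists i; rewrite ?mem_head// => j; rewrite inE => /eqP ->.
have [k ks kmin] := IH s0; have [ik|ki] := leP (mu i) (mu k).
  exists i; rewrite ?mem_head// => j; rewrite inE => /predU1P[->//|/kmin].
  exact: le_trans.
exists k; rewrite ?inE ?ks ?orbT// => j; rewrite inE => /predU1P[->|/kmin//].
exact: ltW.
Qed.

(** Weights that are bounded below on the balls of the family can be peeled off
    level by level: on the union of the balls the least of the lower bounds is
    a constant, so that the unweighted estimate applies to [f] cut off to that
    union, and the rest of the weight serves a family with one ball less. *)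
Lemma energy_weighted (C : R) o h f : 0 < h -> 0 < C ->
  (forall g, leb.-integrable setT (EFin \o g) ->
    leb.-integrable setT (fun x => (g x ^+ 2)%:E) ->
    forall s : seq (nat * 'rV[int]_n), uniq s ->
    (\sum_(j <- s) energy o h g j <= C%:E * \int[leb]_x (g x ^+ 2)%:E)%E) ->
  leb.-integrable setT (EFin \o f) ->
  leb.-integrable setT (fun x => (f x ^+ 2)%:E) ->
  forall (s : seq (nat * 'rV[int]_n)) (mu : nat * 'rV[int]_n -> R) (w : 'rV[R]_n -> R),
  uniq s ->
  measurable_fun [set: lebesgue_rV R n] w -> (forall x, 0 <= w x) ->
  (forall j, 0 <= mu j) ->
  {ae leb, forall x, forall j, j \in s ->
    eball (corner o (side h j.1) j.2) (2 * radius n h j.1) x -> mu j <= w x} ->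
  (\sum_(j <- s) (mu j)%:E * energy o h f j <=
    C%:E * \int[leb]_x (f x ^+ 2 * w x)%:E)%E.
Proof.
move=> h0 C0 HC intf intf2 s.
have mf : measurable_fun [set: lebesgue_rV R n] f.
  by apply/measurable_EFinP; exact: measurable_int intf.
have mf2 : measurable_fun [set: lebesgue_rV R n] (fun x => f x ^+ 2).
  exact: measurable_funX.
move: {2}(size s) (erefl (size s)) => k; elim: k s => [|k IH] s.
  move/size0nil => -> mu w _ mw w0 _ _; rewrite big_nil; apply: mule_ge0.
    by rewrite lee_fin ltW.
  by apply: integral_ge0 => x _; rewrite lee_fin mulr_ge0// sqr_ge0.
move=> sk mu w us mw w0 mu0 muw.
have [|i0 i0s i0min] := @seq_min _ s mu; first by rewrite -size_eq0 sk.
pose B (j : nat * 'rV[int]_n) : set (lebesgue_rV R n) :=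
  eball (corner o (side h j.1) j.2) (2 * radius n h j.1).
pose E : set (lebesgue_rV R n) := \big[setU/set0]_(j <- s) B j.
have mE : measurable E by apply: bigsetU_measurable => j _; exact: eball_leb.
have BE j : j \in s -> B j `<=` E by move=> js x Bx; rewrite /E -bigcup_seq; exists j.
pose g x := f x * \1_E x.
pose w' x := Num.max (w x - mu i0) 0.
have mg : measurable_fun [set: lebesgue_rV R n] g.
  by apply: measurable_funM; [exact: mf|exact: measurable_indic].
have mw' : measurable_fun [set: lebesgue_rV R n] w'.
  apply: measurable_maxr; last exact: measurable_cst.
  by apply: measurable_funB; [exact: mw|exact: measurable_cst].
have gE j : j \in s -> energy o h f j = energy o h g j.
  move=> js; apply: energy_local => // x /(BE _ js) Ex.
  by rewrite /g indicE mem_set// mulr1.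
have gf x : `|g x| <= `|f x|.
  by rewrite /g indicE; case: (_ \in _); rewrite ?mulr1// mulr0 normr0.
have intg : leb.-integrable setT (EFin \o g).
  apply: (le_integrable measurableT _ _ intf); first exact/measurable_EFinP.
  by move=> x _; rewrite lee_fin.
have intg2 : leb.-integrable setT (fun x => (g x ^+ 2)%:E).
  apply: (le_integrable measurableT _ _ intf2).
    by apply/measurable_EFinP; exact: measurable_funX.
  by move=> x _; rewrite lee_fin !normrX; apply: lerXn2r => //; rewrite nnegrE.
have -> : (\sum_(j <- s) (mu j)%:E * energy o h f j =
  (mu i0)%:E * \sum_(j <- s) energy o h g j +
  \sum_(j <- rem i0 s) (mu j - mu i0)%:E * energy o h f j)%E.
  rewrite ge0_sume_distrr; last by move=> j _; exact: energy_ge0.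
  have -> : (\sum_(j <- rem i0 s) (mu j - mu i0)%:E * energy o h f j =
      \sum_(j <- s) (mu j - mu i0)%:E * energy o h f j)%E.
    by rewrite [RHS](perm_big _ (perm_to_rem i0s))/= big_cons subrr mul0e add0e.
  rewrite -big_split/= big_seq [RHS]big_seq; apply: eq_bigr => j js.
  rewrite -gE// -ge0_muleDl ?lee_fin ?subr_ge0 ?i0min//.
  by rewrite -EFinD addrC subrK.
have mu1 j : 0 <= Num.max (mu j - mu i0) 0 by rewrite le_max lexx orbT.
have := IH (rem i0 s) _ (fun j => Num.max (mu j - mu i0) 0) w' (rem_uniq _ us) mw'.
rewrite size_rem// sk => /(_ erefl).
have w'0 x : 0 <= w' x by rewrite le_max lexx orbT.
move=> /(_ w'0 mu1) H.
have {}H : (\sum_(j <- rem i0 s) (mu j - mu i0)%:E * energy o h f j <=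
    C%:E * \int[leb]_x (f x ^+ 2 * w' x)%:E)%E.
  apply: le_trans (H _); last first.
    move: muw; apply: ae_imp => x H' j jr Bj.
    have js := mem_rem jr.
    rewrite /w' ge_max le_max lerB ?H'//= le_max lexx orbT.
    by [].
  rewrite big_seq [leRHS]big_seq; apply: lee_sum => j jr.
  apply: lee_wpmul2r; first exact: energy_ge0.
  by rewrite lee_fin le_max lexx.
apply: le_trans (leeD (lee_wpmul2l _ (HC g intg intg2 s us)) H) _.
  by rewrite lee_fin.
have mi1 : measurable_fun [set: lebesgue_rV R n] (fun x => (g x ^+ 2)%:E).
  by apply/measurable_EFinP; exact: measurable_funX.
have mi2 : measurable_fun [set: lebesgue_rV R n] (fun x => (f x ^+ 2 * w' x)%:E).
  by apply/measurable_EFinP; apply: measurable_funM; [exact: mf2|exact: mw'].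
have g0 x : [set: lebesgue_rV R n] x -> (0 <= (g x ^+ 2)%:E)%E by rewrite lee_fin sqr_ge0.
have f0 x : [set: lebesgue_rV R n] x -> (0 <= (f x ^+ 2 * w' x)%:E)%E.
  by rewrite lee_fin mulr_ge0// sqr_ge0.
rewrite muleCA -ge0_muleDr; last 2 first.
- by rewrite mule_ge0// ?lee_fin//; exact: integral_ge0.
- exact: integral_ge0.
apply: lee_wpmul2l; first by rewrite lee_fin ltW.
rewrite -(ge0_integralZl_EFin leb measurableT g0 mi1 (mu0 i0)).
have mi1' := measurable_funeM (mu i0)%:E mi1.
have g0' x : [set: lebesgue_rV R n] x -> (0 <= (mu i0)%:E * (g x ^+ 2)%:E)%E.
  by move=> ?; rewrite mule_ge0// ?g0// lee_fin.
rewrite -(ge0_integralD leb measurableT g0' mi1' f0 mi2).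
apply: (ae_ge0_le_integral measurableT).
- by move=> x _; rewrite adde_ge0 ?g0' ?f0.
- by apply: emeasurable_funD; [exact: mi1'|exact: mi2].
- by move=> x _; rewrite lee_fin mulr_ge0// sqr_ge0.
- by apply/measurable_EFinP; apply: measurable_funM; [exact: mf2|exact: mw].
move: muw; apply: ae_imp => x H' _.
rewrite -EFinM -EFinD lee_fin /g indicE.
have [xE|xE] := boolP (x \in E).
  have wx : mu i0 <= w x.
    move: xE; rewrite inE /E -bigcup_seq => -[j js Bjx].
    exact: le_trans (i0min j js) (H' j js Bjx).
  rewrite mulr1 mulrC -mulrDr /w' max_l ?subr_ge0//.
  by rewrite addrC subrK.
rewrite mulr0 expr0n/= mulr0 add0r; apply: ler_wpM2l; first exact: sqr_ge0.
by rewrite /w' ge_max w0 andbT gerBl.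
Qed.

End L2_weighted.

(** * Muckenhoupt weights *)

Lemma ae_all d (T : measurableType d) (R : realType)
    (mu : {measure set T -> \bar R}) (P : T -> Prop) :
  (forall x, P x) -> {ae mu, forall x, P x}.
Proof. by move=> PT; exact: aeW. Qed.

Section A1weights.
Context {R : realType} {n : nat}.
Local Notation leb := (@lebesgueRn R n).
Variable (w : 'rV[R]_n -> R).
Hypotheses (weight_w : weight w).
Implicit Types (x y z : 'rV[R]_n) (r : R) (F : 'rV[R]_n -> \bar R).

Lemma eball_balls x r : 0 < r -> balls (eball x r).
Proof. by move=> r0; exists x, r. Qed.

Lemma weight_ge0 x : 0 <= w x. Proof. by case: weight_w. Qed.

Lemma bigcup_eball x : \bigcup_(k : nat) eball x k.+1%:R = [set: 'rV[R]_n].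
Proof.
apply/seteqP; split=> // y _; exists (Num.trunc (enorm (y - x))) => //.
exact: truncnS_gt.
Qed.

Lemma locally_integrable_measurable (f : 'rV[R]_n -> R) :
  locally_integrable_rV f -> measurable_fun [set: lebesgue_rV R n] f.
Proof.
move=> lf; apply/measurable_EFinP.
have -> : [set: lebesgue_rV R n] = \bigcup_(k : nat) eball 0 k.+1%:R.
  by rewrite bigcup_eball.
apply/measurable_fun_bigcup => k; first exact: eball_leb.
by have := lf (eball 0 k.+1%:R); move/(_ (eball_balls _ _))/measurable_int; apply.
Qed.

Lemma weight_measurable : measurable_fun [set: lebesgue_rV R n] w.
Proof. by apply: locally_integrable_measurable; case: weight_w. Qed.

(** The real number behind [wmeas] on balls, where it is finite. *)
Definition vol x r : R := fine (wmeas w (eball x r)).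

Lemma vol_ge0 x r : 0 <= vol x r.
Proof. by apply/fine_ge0/integral_ge0 => z _; rewrite lee_fin weight_ge0. Qed.

Lemma wmeas_eball x r : 0 < r -> wmeas w (eball x r) = (vol x r)%:E.
Proof.
move=> r0; rewrite fineK//; have [_ lw] := weight_w.
by apply: integrable_fin_num; [exact: eball_leb|exact: lw (eball_balls x r0)].
Qed.

(** The pointwise form in which the [A_1] condition is used. *)
Definition A1_bound (K : R) := forall x r, 0 < r ->
  {ae leb, forall z, eball x r z -> vol x r <= K * r ^+ n * w z}.

(** The essential infimum is a supremum of lower bounds; the factor [2] makes
    room for one of them. *)
Lemma A1_ae : A1 w -> exists2 K : R, 0 < K & A1_bound K.
Proof.
move=> [C HC]; exists (2 * `|C| * 2 ^+ n + 1).
  by rewrite ltr_wpDl// !mulr_ge0// exprn_ge0.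
move=> x r r0.
set K := 2 * _ * _ + 1.
have K0 : 0 <= K * r ^+ n.
  by rewrite mulr_ge0 ?exprn_ge0 ?(ltW r0)// addr_ge0// !mulr_ge0// exprn_ge0.
have /predU1P[v0|v0] : (vol x r == 0) || (0 < vol x r).
  by rewrite -le0r vol_ge0.
  by apply: ae_all => z _; rewrite v0 mulr_ge0// weight_ge0.
have := HC _ (eball_balls x r0); rewrite -/(wmeas w _) wmeas_eball//.
have Lfin := leb_eball_fin x r0.
have L0 := leb_eball_gt0 x r0.
have LE : leb (eball x r) = (fine (leb (eball x r)))%:E by rewrite fineK.
set L := fine (leb (eball x r)) in LE.
have L0' : 0 < L by rewrite -lte_fin -LE.
have L1 : L <= (2 * r) ^+ n by rewrite -lee_fin -LE; exact: leb_eball_le.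
rewrite LE inver gt_eqF// -EFinM.
set e := ess_inf_on _ _ => He.
have e0 : (0 <= e)%E.
  apply: ereal_sup_ubound => /=; by apply: ae_all => z _; rewrite lee_fin weight_ge0.
have a0 : 0 < L^-1 * vol x r by rewrite mulr_gt0// invr_gt0.
have C0 : 0 < C.
  rewrite ltNge; apply/negP => C0; have := lt_le_trans (_ : (0 < (L^-1 * vol x r)%:E)%E) He.
  rewrite lte_fin => /(_ a0); apply/negP; rewrite -leNgt.
  by apply: mule_le0_ge0; rewrite ?lee_fin.
have : ((L^-1 * vol x r / (2 * C))%:E < e)%E.
  apply: (@lt_le_trans _ _ (L^-1 * vol x r / C)%:E).
    rewrite lte_fin ltr_pM2l// ltf_pV2 ?posrE ?mulr_gt0//.
    by rewrite -[ltLHS]mul1r ltr_pM2r// ltr1n.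
  by rewrite EFinM lee_pdivrMr// muleC.
move=> /ereal_sup_gt[a /= Sa La].
move: Sa; apply: ae_imp => z Hz Bz.
have := lt_le_trans La (Hz Bz); rewrite lte_fin.
rewrite ltr_pdivrMr ?mulr_gt0// ltr_pdivrMl// => /ltW/le_trans; apply.
rewrite mulrA mulrAC; apply: ler_wpM2r; first exact: weight_ge0.
apply: (@le_trans _ _ ((2 * r) ^+ n * (2 * C))).
  by apply: ler_wpM2r => //; rewrite mulr_ge0// ltW.
rewrite exprMn /K gtr0_norm//.
have : 0 <= r ^+ n by rewrite exprn_ge0// ltW.
by set u := r ^+ n; set v := 2 ^+ n; nra.
Qed.

Variable (K : R).
Hypotheses (K_gt0 : 0 < K) (HK : A1_bound K).

(** Integrate the pointwise lower bound of [w] against [F]. *)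
Lemma A1_integral x r (E : set 'rV[R]_n) F : 0 < r ->
  measurable (E : set (lebesgue_rV R n)) -> E `<=` eball x r ->
  measurable_fun (E : set (lebesgue_rV R n)) F -> (forall z, 0 <= F z)%E ->
  ((vol x r)%:E * \int[leb]_(z in E) F z <=
    (K * r ^+ n)%:E * \int[leb]_(z in E) (F z * (w z)%:E))%E.
Proof.
move=> r0 mE Er mF F0.
have K0 : 0 <= K * r ^+ n by rewrite mulr_ge0 ?exprn_ge0 ?ltW.
have mw : measurable_fun (E : set (lebesgue_rV R n)) (EFin \o w).
  by apply: measurable_funTS; apply/measurable_EFinP; exact: weight_measurable.
have mFw : measurable_fun (E : set (lebesgue_rV R n)) (fun z => F z * (w z)%:E)%E.
  by apply: emeasurable_funM; [exact: mF|exact: mw].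
have F0' z : (E : set (lebesgue_rV R n)) z -> (0 <= F z)%E by move=> _.
have Fw0 z : (E : set (lebesgue_rV R n)) z -> (0 <= F z * (w z)%:E)%E.
  by move=> _; rewrite mule_ge0// lee_fin weight_ge0.
rewrite -(ge0_integralZl_EFin leb mE F0' mF (vol_ge0 x r)).
rewrite -(ge0_integralZl_EFin leb mE Fw0 mFw K0).
apply: (ae_ge0_le_integral mE).
- by move=> z Ez; rewrite mule_ge0 ?F0'// lee_fin vol_ge0.
- exact: measurable_funeM.
- by move=> z Ez; rewrite mule_ge0 ?Fw0// lee_fin.
- exact: measurable_funeM.
move: (HK x r0); apply: ae_imp => z Hz /Er /Hz H.
rewrite muleC [leRHS]muleCA; apply: lee_wpmul2l => //.
Qed.

Lemma le_vol x y r s : 0 < r -> 0 < s -> eball x r `<=` eball y s ->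
  vol x r <= vol y s.
Proof.
move=> r0 s0 rs; rewrite -lee_fin -!wmeas_eball//.
apply: ge0_subset_integral => //; try exact: eball_leb.
  by apply: measurable_funTS; apply/measurable_EFinP; exact: weight_measurable.
by move=> z _; rewrite lee_fin weight_ge0.
Qed.

(** [A1_integral] with [F = 1]. *)
Lemma vol_doubling x y r s : 0 < r -> 0 < s -> eball y s `<=` eball x r ->
  vol x r <= K * (n.+1%:R * (r / s)) ^+ n * vol y s.
Proof.
move=> r0 s0 sr.
have := @A1_integral x r (eball y s) (cst 1%E) r0 (eball_leb y s) sr
  (measurable_cst _).
have c0 z : (0 <= cst 1 z :> \bar R)%E by rewrite /= lee01.
move=> /(_ c0).
rewrite integral_cst ?mul1e; last exact: eball_leb.
have -> : (\int[leb]_(z in eball y s) (cst 1 z * (w z)%:E) =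
    (vol y s)%:E)%E.
  by rewrite -wmeas_eball//; apply: eq_integral => z _; rewrite mul1e.
move=> H; have := leb_eball_ge y s0.
move=> /(lee_wpmul2l (_ : (0 <= (vol x r)%:E)%E)).
rewrite lee_fin => /(_ (vol_ge0 x r))/le_trans/(_ H).
rewrite -!EFinM lee_fin => H2.
have sn0 : 0 < (s / n.+1%:R) ^+ n by rewrite exprn_gt0// divr_gt0.
rewrite -(ler_pM2r sn0); apply: le_trans H2 _.
rewrite le_eqVlt; apply/orP; left; apply/eqP.
rewrite !exprMn !exprVn; field.
by rewrite !gt_eqF ?exprn_gt0.
Qed.

End A1weights.

(** * Dyadic cubes *)

Section dyadic.
Context {R : realType} {n : nat}.
Implicit Types (o x : 'rV[R]_n) (h l : R) (j k : 'rV[int]_n).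

Definition children j : seq 'rV[int]_n :=
  [seq \row_i (2 * j ord0 i + (e i : nat)%:Z) | e : {ffun 'I_n -> bool}].

Definition parent k : 'rV[int]_n := \row_i (k ord0 i %/ 2)%Z.

Lemma children_uniq j : uniq (children j).
Proof.
rewrite /children map_inj_uniq ?enum_uniq// => e e' /rowP ee'.
apply/ffunP => i; have := ee' i; rewrite !mxE => /addrI.
by case: (e i); case: (e' i).
Qed.

Lemma mem_children j k : (k \in children j) = (parent k == j).
Proof.
apply/idP/eqP => [/mapP[e _ ->]|<-].
  apply/rowP => i; rewrite !mxE mulrC divzMDl//.
  by case: (e i); rewrite /= addr0.
apply/mapP; exists [ffun i => (k ord0 i %% 2)%Z == 1]; first by rewrite mem_enum.
apply/rowP => i; rewrite !mxE ffunE -[k 0 i]/(k ord0 i).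
have := divz_eq (k ord0 i) 2; have := modz_ge0 (k ord0 i) (isT : 2 != 0 :> int).
have := @ltz_pmod (k ord0 i) 2 isT.
by move: (k ord0 i %/ 2)%Z (k ord0 i %% 2)%Z => a b; case: eqP => /=; lia.
Qed.

Lemma idx_parent o l x : 0 < l -> idx o (2 * l) x = parent (idx o l x).
Proof.
move=> l0; apply/rowP => i; rewrite !mxE; apply: floor_def.
set u := x ord0 i - o ord0 i.
have -> : u / (2 * l) = (u / l) / 2 by field; rewrite gt_eqF.
have := floor_itv (u / l); set m := Num.floor _; set v := u / l.
have [d [-> [e1 e2]]] : exists d : int, (m %/ 2)%Z = d /\ 2 * d <= m /\ m + 1 <= 2 * d + 2.
  by exists (m %/ 2)%Z; lia.
have : ((2 * d)%:~R <= m%:~R :> R) by rewrite ler_int.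
have : ((m + 1)%:~R <= (2 * d + 2)%:~R :> R) by rewrite ler_int.
rewrite !intrD !intrM => H1 H2 /andP[H3 H4].
by rewrite ler_pdivlMr// ltr_pdivrMr//; apply/andP; split; lra.
Qed.

Lemma sideS h m : side h m.+1 = 2 * side h m.
Proof. by rewrite /side exprS mulrCA. Qed.

(** Calderon-Zygmund selection below the cube of index [j] and scale [m]: descend
    to the children, stop at the first cubes that are [big], and in any case at
    scale [0]. *)
Fixpoint cz (big : nat -> 'rV[int]_n -> bool) (m : nat) j :
    seq (nat * 'rV[int]_n) :=
  if m is m'.+1 then
    flatten [seq (if big m' c then [:: (m', c)] else cz big m' c) | c <- children j]
  else [:: (0%N, j)].

Lemma indic_cube o l j x : (\1_(cube o l j) x : R) = (idx o l x == j)%:R.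
Proof.
rewrite indicE; congr (_%:R); congr nat_of_bool; apply/idP/eqP.
  by rewrite inE.
by move=> h; rewrite inE.
Qed.

(** That the selected cubes partition the initial one, in the form in which it is
    summed against functions. *)
Lemma cz_indic big o h m j x : 0 < h ->
  \sum_(p <- cz big m j) \1_(cube o (side h p.1) p.2) x =
  \1_(cube o (side h m) j) x :> R.
Proof.
move=> h0; elim: m j => [|m IH] j /=; first by rewrite big_seq1.
rewrite big_flatten big_map/=.
have E c : \sum_(p <- (if big m c then [:: (m, c)] else cz big m c))
    \1_(cube o (side h p.1) p.2) x = \1_(cube o (side h m) c) x :> R.
  by case: ifP => _; rewrite ?big_seq1.
under eq_bigr do rewrite E indic_cube.
rewrite indic_cube sideS idx_parent ?side_gt0//.
set k := idx o (side h m) x.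
rewrite -mem_children; have := children_uniq j.
elim: (children j) => [|c s IHs]; first by rewrite big_nil.
move=> /andP[cs us]; rewrite big_cons IHs// inE.
by have [->|] := eqVneq k c; rewrite ?add0r// (negbTE cs) addr0.
Qed.

Lemma cz_stop big m j p : p \in cz big m j -> p.1 = 0%N \/ big p.1 p.2.
Proof.
elim: m j => [|m IH] j /=; first by rewrite inE => /eqP ->; left.
move=> /flattenP[s /mapP[c cj ->]]; case: ifP => [bc|_ /IH//].
by rewrite inE => /eqP ->; right.
Qed.

(** The parent of a selected cube was not selected, which bounds its mass; a
    cube reached at scale [0] without being big satisfies a better bound. *)
Lemma cz_bound (nu : nat -> 'rV[int]_n -> R) (sigma : R) h m j p :
  0 < h -> 0 < sigma ->
  (forall m j k, k \in children j -> nu m k <= nu m.+1 j) ->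
  nu m j <= sigma * side h m ^+ n ->
  p \in cz (fun m j => sigma * side h m ^+ n < nu m j) m j ->
  nu p.1 p.2 <= 2 ^+ n * sigma * side h p.1 ^+ n.
Proof.
move=> h0 s0 mono; elim: m j => [|m IH] j /= nuj.
  rewrite inE => /eqP -> /=; apply: le_trans nuj _.
  rewrite -mulrA; apply: ler_peMl; last by rewrite exprn_ege1// ler1n.
  by rewrite mulr_ge0 ?exprn_ge0// ltW// side_gt0.
move=> /flattenP[s /mapP[c cj ->]]; case: ifP => [_|/negbT]; last first.
  by rewrite -leNgt; exact: IH.
rewrite inE => /eqP -> /=; apply: le_trans (mono _ _ _ cj) _.
by apply: le_trans nuj _; rewrite sideS exprMn mulrCA mulrA.
Qed.

End dyadic.

(** * The discrete square function *)

Lemma ae_seq d (T : measurableType d) (R : realType)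
    (mu : {measure set T -> \bar R}) (I : eqType) (s : seq I) (P : I -> T -> Prop) :
  (forall i, i \in s -> {ae mu, forall x, P i x}) ->
  {ae mu, forall x, forall i, i \in s -> P i x}.
Proof.
elim: s => [_|i s IH H]; first exact: aeW.
have Hi := H i (mem_head _ _).
have Hs : {ae mu, forall x, forall j, j \in s -> P j x}.
  by apply: IH => j js; apply: H; rewrite inE js orbT.
move: Hi Hs; apply: filterS2 => x Pi Ps j; rewrite inE => /predU1P[->//|].
exact: Ps.
Qed.

Section Gsq.
Context {R : realType} {n : nat}.
Local Notation leb := (@lebesgueRn R n).
Variables (alpha : R).
Hypotheses (n_gt0 : (0 < n)%N) (alpha_gt0 : 0 < alpha) (alpha_le1 : alpha <= 1).
Implicit Types (o x y z : 'rV[R]_n) (f : 'rV[R]_n -> R).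

(** The radius [radius n h m] is large enough for the ball around the corner to
    contain the cube and leave room for the balls of radius at most [side h m]
    centred in it. *)
Definition cellA o h f m x : \bar R :=
  Aalpha alpha f (corner o (side h m) (idx o (side h m) x)) (radius n h m).

Definition Gsq o h f N x : \bar R := (\sum_(m < N) cellA o h f m x ^+ 2)%E.

Lemma cellA_ge0 o h f m x : 0 < h -> (0 <= cellA o h f m x)%E.
Proof. by move=> h0; apply: Aalpha_ge0 => //; exact: radius_gt0. Qed.

Lemma Gsq_ge0 o h f N x : (0 <= Gsq o h f N x)%E.
Proof. by apply: sume_ge0 => m _; exact: sqre_ge0. Qed.

Lemma cellA_sqr_measurable o h f m : 0 < h ->
  measurable_fun [set: lebesgue_rV R n] (fun x => cellA o h f m x ^+ 2)%E.
Proof.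
move=> h0; apply: measurable_fun_leb.
have := @measurable_fun_idx R n _ _ o (side h m) (fun j =>
  (Aalpha alpha f (corner o (side h m) j) (radius n h m) ^+ 2)%E) (side_gt0 m h0).
exact.
Qed.

Lemma Gsq_measurable o h f N : 0 < h ->
  measurable_fun [set: lebesgue_rV R n] (Gsq o h f N).
Proof.
by move=> h0; apply: emeasurable_sum => m; exact: cellA_sqr_measurable.
Qed.

(** The grid, enumerated so that countable additivity applies. *)
Definition numbered_cube o (l : R) (k : nat) : set (lebesgue_rV R n) :=
  if @pickle_inv 'rV[int]_n k is Some j then cube o l j else set0.

Lemma numbered_cube_leb o (l : R) k : 0 < l -> measurable (numbered_cube o l k).
Proof.
move=> l0; rewrite /numbered_cube; case: pickle_inv => [j|].
  exact: cube_leb.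
exact: measurable0.
Qed.

Lemma bigcup_numbered_cube o (l : R) :
  \bigcup_k numbered_cube o l k = [set: lebesgue_rV R n].
Proof.
apply/seteqP; split=> // x _; exists (pickle (idx o l x)) => //.
by rewrite /numbered_cube pickleK_inv.
Qed.

Lemma trivIset_numbered_cube o (l : R) : trivIset setT (numbered_cube o l).
Proof.
move=> k k' _ _ [x []]; rewrite /numbered_cube.
case E : pickle_inv => [j|//]; case E' : pickle_inv => [j'|//].
move=> xj xj'; have jj' : j = j' by rewrite -(xj : _ = j) (xj' : _ = j').
have := @pickle_invK 'rV[int]_n k; rewrite E /= => <-.
by have := @pickle_invK 'rV[int]_n k'; rewrite E' /= => <-; rewrite jj'.
Qed.

Variable (w : 'rV[R]_n -> R).
Hypotheses (weight_w : weight w).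
Variable (K : R).
Hypotheses (K_gt0 : 0 < K) (HK : A1_bound w K).

(** On each cube the integral of the weight is at most a constant times the
    volume of the cube times the lower bound of the weight provided by [A_1] on
    the associated ball, so that [energy_weighted] applies. *)
Lemma Gsq_weighted : exists2 C : R, 0 < C & forall o h, 0 < h ->
  forall f, leb.-integrable setT (EFin \o f) ->
  leb.-integrable setT (fun x => (f x ^+ 2)%:E) ->
  forall N, (\int[leb]_x ((w x)%:E * Gsq o h f N x) <=
    C%:E * \int[leb]_x (f x ^+ 2 * w x)%:E)%E.
Proof.
have [C C0 HC] := energy_le n_gt0 alpha_gt0 alpha_le1.
pose D : R := K * (2 * n.+1%:R) ^+ n.
have D0 : 0 < D by rewrite mulr_gt0// exprn_gt0// mulr_gt0.
exists (D * C); first by rewrite mulr_gt0.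
move=> o h h0 f intf intf2 N.
pose y (j : nat * 'rV[int]_n) := corner o (side h j.1) j.2.
have r0 m : 0 < 2 * radius n h m by rewrite mulr_gt0// radius_gt0.
pose mu (j : nat * 'rV[int]_n) :=
  vol w (y j) (2 * radius n h j.1) / (K * (2 * radius n h j.1) ^+ n).
have Kr0 m : 0 < K * (2 * radius n h m) ^+ n by rewrite mulr_gt0// exprn_gt0.
have mu0 j : 0 <= mu j by rewrite divr_ge0 ?vol_ge0// ltW.
have mw : measurable_fun [set: lebesgue_rV R n] (EFin \o w).
  by apply/measurable_EFinP; exact: weight_measurable.
have mwA m : measurable_fun [set: lebesgue_rV R n]
    (fun x => (w x)%:E * cellA o h f m x ^+ 2)%E.
  by apply: emeasurable_funM; [exact: mw|exact: cellA_sqr_measurable].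
have wA0 m x : (0 <= (w x)%:E * cellA o h f m x ^+ 2)%E.
  by rewrite mule_ge0 ?sqre_ge0// lee_fin weight_ge0.
pose t m k := (\int[leb]_(x in numbered_cube o (side h m) k)
  ((w x)%:E * cellA o h f m x ^+ 2))%E.
have t0 m k : (0 <= t m k)%E by apply: integral_ge0 => x _; exact: wA0.
have -> : (\int[leb]_x ((w x)%:E * Gsq o h f N x) =
    \sum_(m < N) \sum_(0 <= k <oo) t m k)%E.
  have E x : ((w x)%:E * Gsq o h f N x =
      \sum_(m < N) (w x)%:E * cellA o h f m x ^+ 2)%E.
    by rewrite /Gsq ge0_sume_distrr// => i _; exact: sqre_ge0.
  under eq_integral do rewrite E.
  rewrite (ge0_integral_sum leb measurableT (fun m : 'I_N => mwA m)); last first.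
    by move=> m x _; exact: wA0.
  apply: eq_bigr => m _; rewrite -(bigcup_numbered_cube o (side h m)).
  apply: ge0_integral_bigcup.
  - by move=> k; apply: numbered_cube_leb; exact: side_gt0.
  - exact: measurable_funTS.
  - by move=> x _; exact: wA0.
  - exact: trivIset_numbered_cube.
(* It suffices to bound the sums over finitely many cubes of each scale. *)
rewrite -nneseries_sum; last by move=> *; exact: t0.
apply: lime_le; first by apply: is_cvg_nneseries => k _ _; exact: sume_ge0.
apply: nearW => N'.
pose u m k : \bar R := oapp (fun j => (mu (m, j))%:E * energy alpha o h f (m, j))%E 0%E
  (@pickle_inv 'rV[int]_n k).
have tu m k : (t m k <= D%:E * u m k)%E.
  rewrite /t /u /numbered_cube; case: pickle_inv => [j|] /=; last first.
    by rewrite integral_set0 mule0.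
  have mj : measurable (cube o (side h m) j : set (lebesgue_rV R n)).
    by apply: cube_leb; exact: side_gt0.
  set a := (Aalpha alpha f (y (m, j)) (radius n h m) ^+ 2)%E.
  have -> : (\int[leb]_(x in cube o (side h m) j) ((w x)%:E * cellA o h f m x ^+ 2) =
      a * \int[leb]_(x in cube o (side h m) j) (w x)%:E)%E.
    have mwj : measurable_fun (cube o (side h m) j : set (lebesgue_rV R n))
      (EFin \o w) by exact: measurable_funTS mw.
    have w0j x : (cube o (side h m) j : set (lebesgue_rV R n)) x ->
      (0 <= (EFin \o w) x)%E by move=> _; rewrite lee_fin weight_ge0.
    rewrite -(ge0_integralZl leb mj mwj w0j (sqre_ge0 _ : (0 <= a)%E)).
    apply: eq_integral => x; rewrite inE => xj.
    by rewrite muleC /cellA (xj : _ = j).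
  have W : (\int[leb]_(x in cube o (side h m) j) (w x)%:E <=
      (vol w (y (m, j)) (2 * radius n h m))%:E)%E.
    rewrite -(wmeas_eball weight_w _ (r0 m)).
    apply: (ge0_subset_integral leb mj (eball_leb _ _)).
    - exact: measurable_funTS mw.
    - by move=> x _; rewrite lee_fin weight_ge0.
    - move=> x /(cube_sub_eball (side_gt0 m h0)); apply: sub_eball.
      by rewrite enormxx add0r /radius;
         have := radius_gt0 (n:=n) m h0; rewrite /radius; lra.
  apply: le_trans (lee_wpmul2l (sqre_ge0 _) W) _.
  rewrite /energy -/(y (m, j)) /= -/a.
  rewrite [in leRHS]muleA [in leRHS]muleA -!EFinM muleC.
  apply: lee_wpmul2r; first exact: sqre_ge0.
  rewrite lee_fin /mu /D/= le_eqVlt; apply/orP; left; apply/eqP.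
  rewrite /radius !exprMn; field.
  by rewrite !gt_eqF ?exprn_gt0// side_gt0.
apply: (@le_trans _ _ (D%:E * \sum_(k < N') \sum_(m < N) u m k)%E).
  rewrite ge0_sume_distrr; last first.
    move=> k _; apply: sume_ge0 => m _; rewrite /u; case: pickle_inv => //= j.
    by rewrite mule_ge0 ?energy_ge0// lee_fin.
  rewrite big_mkord; apply: lee_sum => k _.
  rewrite ge0_sume_distrr; last first.
    move=> m _; rewrite /u; case: pickle_inv => //= j.
    by rewrite mule_ge0 ?energy_ge0// lee_fin.
  by apply: lee_sum => m _; exact: tu.
rewrite (EFinM D C) -muleA; apply: lee_wpmul2l; first by rewrite lee_fin ltW.
pose s : seq (nat * 'rV[int]_n) := [seq (m, j) | m <- index_iota 0 N,
  j <- pmap (@pickle_inv 'rV[int]_n) (index_iota 0 N')].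
have us : uniq s.
  apply: allpairs_uniq; [exact: iota_uniq| |by move=> [? ?] [? ?]].
  by apply: (pmap_uniq (@pickle_invK _)); exact: iota_uniq.
have -> : (\sum_(k < N') \sum_(m < N) u m k =
    \sum_(j <- s) (mu j)%:E * energy alpha o h f j)%E.
  rewrite exchange_big/= /s big_allpairs_dep/= big_mkord.
  by apply: eq_bigr => m _; rewrite big_pmap/= big_mkord.
apply: (energy_weighted alpha_gt0 h0 C0 (HC o h h0) intf intf2 us).
- exact: weight_measurable.
- exact: weight_ge0.
- exact: mu0.
- apply: ae_seq => j _; have := HK (y j) (r0 j.1); apply: ae_imp => x H Bx.
  by rewrite /mu ler_pdivrMr// [leRHS]mulrC; exact: H.
Qed.

End Gsq.

(** * The weak type inequality for the discrete square function *)

Section CZ.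
Context {R : realType} {n : nat}.
Local Notation leb := (@lebesgueRn R n).
Variables (alpha : R).
Hypotheses (n_gt0 : (0 < n)%N) (alpha_gt0 : 0 < alpha) (alpha_le1 : alpha <= 1).
Variables (o : 'rV[R]_n) (h : R) (M : nat) (f : 'rV[R]_n -> R) (sigma : R).
Hypotheses (h0 : 0 < h) (s0 : 0 < sigma).
Hypothesis intf : leb.-integrable setT (EFin \o f).
Hypothesis suppf : forall x, f x != 0 -> cube o (side h M) 0 x.

Let mass m j := \int[leb]_(x in cube o (side h m) j) `|f x|.
Hypothesis massf : mass M 0 <= sigma * side h M ^+ n.

Let heavy m j := sigma * side h m ^+ n < mass m j.
(** The selected cubes.  In the decomposition [f = g + \sum_(p <- P) b p] the good
    part [g] is the average of [f] on each of them, and [b p] is supported by the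
    cube [Q p]. *)
Let P := cz heavy M 0.
Let Q (p : nat * 'rV[int]_n) : set (lebesgue_rV R n) := cube o (side h p.1) p.2.
Let y (p : nat * 'rV[int]_n) := corner o (side h p.1) p.2.
Let r (p : nat * 'rV[int]_n) := radius n h p.1.
Let avg (p : nat * 'rV[int]_n) := (\int[leb]_(x in Q p) f x) / side h p.1 ^+ n.
Let g (x : 'rV[R]_n) := \sum_(p <- P) avg p * \1_(Q p) x.
Let b (p : nat * 'rV[int]_n) (x : 'rV[R]_n) := (f x - avg p) * \1_(Q p) x.

Let sd0 (p : nat * 'rV[int]_n) : 0 < side h p.1 ^+ n. Proof. by rewrite exprn_gt0// side_gt0. Qed.
Let r0 p : 0 < r p. Proof. exact: radius_gt0. Qed.
Let lebQ p : leb (Q p) = (side h p.1 ^+ n)%:E.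
Proof. by apply: lebesgueRn_cube; exact: side_gt0. Qed.

Let mQ p : measurable (Q p). Proof. by apply: cube_leb; exact: side_gt0. Qed.

Let mf : measurable_fun [set: lebesgue_rV R n] f.
Proof. by apply/measurable_EFinP; exact: measurable_int intf. Qed.

Let intfQ p : leb.-integrable (Q p) (EFin \o f).
Proof. by apply: integrableS intf => //; exact: mQ. Qed.

Let intnQ p : leb.-integrable (Q p) (EFin \o (fun x => `|f x|)).
Proof. exact: integrable_norm (intfQ p). Qed.

Lemma mass_child m j k : k \in children j -> mass m k <= mass m.+1 j.
Proof.
rewrite mem_children => /eqP kj.
rewrite -lee_fin /mass /Rintegral !fineK; last 2 first.
- exact: (integrable_fin_num (mQ (m.+1, j)) (intnQ (m.+1, j))).
- exact: (integrable_fin_num (mQ (m, k)) (intnQ (m, k))).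
apply: (ge0_subset_integral leb (mQ (m, k)) (mQ (m.+1, j))).
- exact: measurable_int (intnQ (m.+1, j)).
- by move=> x _; rewrite lee_fin.
- by move=> x xk; rewrite /Q /cube /= sideS idx_parent ?side_gt0// (xk : _ = k).
Qed.

Lemma mass_ge0 m j : 0 <= mass m j.
Proof. by apply: Rintegral_ge0 => x _. Qed.

Lemma mass_le p : p \in P -> mass p.1 p.2 <= 2 ^+ n * sigma * side h p.1 ^+ n.
Proof. by apply: cz_bound => //; exact: mass_child. Qed.

Lemma heavy_or_atom p : p \in P -> p.1 = 0%N \/ heavy p.1 p.2.
Proof. exact: cz_stop. Qed.

Lemma sum_indic_cz x : \sum_(p <- P) \1_(Q p) x = \1_(cube o (side h M) 0) x :> R.
Proof. exact: cz_indic. Qed.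

Lemma normr_avg_le p : `|avg p| <= mass p.1 p.2 / side h p.1 ^+ n.
Proof.
rewrite /avg normrM normfV (gtr0_norm (sd0 p)) ler_pM2r ?invr_gt0//.
exact: (le_normr_Rintegral (mQ p) (intfQ p)).
Qed.

Lemma good_bad_decomposition x : f x = g x + \sum_(p <- P) b p x.
Proof.
rewrite -big_split/=.
have -> : \sum_(p <- P) (avg p * \1_(Q p) x + b p x) = f x * \sum_(p <- P) \1_(Q p) x.
  by rewrite mulr_sumr; apply: eq_bigr => p _; rewrite /b mulrBl addrC subrK.
rewrite sum_indic_cz indicE; have [->|/suppf xT] := eqVneq (f x) 0; first by rewrite mul0r.
by rewrite mem_set// mulr1.
Qed.

Lemma cube_indic_integrable p : leb.-integrable setT (fun x => (\1_(Q p) x)%:E).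
Proof.
apply/integrableP; split; first by apply/measurable_EFinP; exact: measurable_indic.
under eq_integral do rewrite gee0_abs ?lee_fin//.
rewrite integral_indic// setIT.
by move: (ltry (side h p.1 ^+ n)); rewrite -(lebQ p).
Qed.

Lemma good_integrable : leb.-integrable setT (EFin \o g).
Proof. exact: (integrable_lin P avg cube_indic_integrable). Qed.

Lemma normr_good_le_sum x : `|g x| <= \sum_(p <- P) `|avg p| * \1_(Q p) x.
Proof.
apply: le_trans (ler_norm_sum _ _ _) _; apply: ler_sum => p _.
by rewrite normrM (@ger0_norm _ (\1_ _ _)).
Qed.

Lemma normr_good_le x : `|g x| <= 2 ^+ n * sigma.
Proof.
apply: le_trans (normr_good_le_sum x) _.
apply: (@le_trans _ _ (\sum_(p <- P) (2 ^+ n * sigma) * \1_(Q p) x)).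
  rewrite big_seq [leRHS]big_seq; apply: ler_sum => p pP.
  apply: ler_wpM2r => //; apply: le_trans (normr_avg_le p) _.
  by rewrite ler_pdivrMr//; exact: mass_le.
rewrite -mulr_sumr sum_indic_cz indicE; case: (_ \in _); rewrite ?mulr1// mulr0.
by rewrite mulr_ge0 ?exprn_ge0// ltW.
Qed.

Lemma good_measurable : measurable_fun [set: lebesgue_rV R n] g.
Proof. by apply/measurable_EFinP; exact: measurable_int good_integrable. Qed.

Lemma good_sqr_integrable : leb.-integrable setT (fun x => (g x ^+ 2)%:E).
Proof.
apply: (le_integrable measurableT _ _ (integrableZl measurableT (2 ^+ n * sigma) good_integrable)).
  by apply/measurable_EFinP; apply: measurable_funX; exact: good_measurable.
move=> x _; rewrite -EFinM lee_fin normrX expr2 normrM.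
apply: ler_wpM2r => //; apply: le_trans (normr_good_le x) _; exact: ler_norm.
Qed.

Lemma bad_integrable p : leb.-integrable setT (EFin \o b p).
Proof.
have i1 := integrableZl measurableT (avg p) (cube_indic_integrable p).
have i2 : leb.-integrable setT (fun x => (f x * \1_(Q p) x)%:E).
  apply: (le_integrable measurableT _ _ intf).
    by apply/measurable_EFinP; apply: measurable_funM; [exact: mf|exact: measurable_indic].
  move=> x _; rewrite lee_fin indicE.
  by case: (_ \in _); rewrite ?mulr1// mulr0 normr0.
apply: eq_integrable (integrableB measurableT i2 i1) => //.
by move=> x _; rewrite /b /= mulrBl EFinB.
Qed.

Lemma integral_indicM p (F : 'rV[R]_n -> R) :
  (\int[leb]_x (F x * \1_(Q p) x)%:E = \int[leb]_(x in Q p) (F x)%:E)%E.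
Proof.
rewrite [RHS]integral_mkcond; apply: eq_integral => x _.
by rewrite patchE indicE; case: (_ \in _); rewrite ?mulr1 ?mulr0.
Qed.

Lemma integral_bad p : (\int[leb]_x (b p x)%:E = 0)%E.
Proof.
have ic : leb.-integrable (Q p) (EFin \o cst (avg p)).
  apply: measurable_bounded_integrable => //.
    by move: (ltry (side h p.1 ^+ n)); rewrite -(lebQ p).
  exists `|avg p|; split; first exact: num_real.
  by move=> N HN x _; exact: ltW.
rewrite /b integral_indicM.
have -> : (\int[leb]_(x in Q p) (f x - avg p)%:E =
    (\int[leb]_(x in Q p) (f x - cst (avg p) x))%:E)%E.
  rewrite /Rintegral fineK//; apply: integrable_fin_num => //.
  by have := integrableB (mQ p) (intfQ p) ic.
rewrite RintegralB// Rintegral_cst//.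
have -> : fine (leb (Q p)) = side h p.1 ^+ n.
  by rewrite lebQ.
by rewrite /avg mulfVK ?subrr// gt_eqF.
Qed.

Lemma bad_norm_le p : (\int[leb]_x (`|b p x|)%:E <= (2 * mass p.1 p.2)%:E)%E.
Proof.
have -> : (\int[leb]_x (`|b p x|)%:E = \int[leb]_(x in Q p) (`|f x - avg p|)%:E)%E.
  rewrite -integral_indicM; apply: eq_integral => x _; rewrite /b normrM.
  by rewrite (@ger0_norm _ (\1_ _ _)).
have m1 : measurable_fun (Q p) (fun x => `|f x|%:E).
  exact: measurable_int (intnQ p).
have m2 : measurable_fun (Q p) (fun x => `|f x - avg p|%:E).
  apply/measurable_EFinP; apply: measurableT_comp; first by [].
  by apply: measurable_funB; [exact: measurable_funTS mf|exact: measurable_cst].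
apply: (@le_trans _ _ (\int[leb]_(x in Q p) (`|f x|%:E + `|avg p|%:E))%E).
  apply: (ge0_le_integral leb (mQ p)).
  - by move=> x _; rewrite lee_fin.
  - exact: m2.
  - by apply: emeasurable_funD; [exact: m1|exact: measurable_cst].
  - by move=> x _; rewrite -EFinD lee_fin ler_normB.
rewrite (ge0_integralD leb (mQ p) _ m1); last 3 first.
- by move=> x _; rewrite lee_fin.
- by move=> x _; rewrite lee_fin.
- exact: measurable_cst.
rewrite integral_cst//.
have E1 : (\int[leb]_(x in Q p) (`|f x|)%:E = (mass p.1 p.2)%:E)%E.
  by rewrite /mass /Rintegral fineK//; exact: (integrable_fin_num (mQ p) (intnQ p)).
apply: (@le_trans _ _ ((mass p.1 p.2)%:E + `|avg p|%:E * (side h p.1 ^+ n)%:E)%E).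
  by rewrite E1 -(lebQ p).
rewrite -EFinD lee_fin mulrDl mul1r lerD2l.
by rewrite -ler_pdivlMr//; exact: normr_avg_le.
Qed.

Lemma bad_support p z : b p z != 0 -> enorm (z - y p) <= r p.
Proof.
rewrite /b mulf_eq0 negb_or indicE => /andP[_]; case: (boolP (z \in Q p)) => [|_].
  rewrite inE => /(cube_sub_eball (side_gt0 p.1 h0)); rewrite /eball/= => /ltW ? _.
  by [].
by rewrite eqxx.
Qed.

Let q : R := 2^-1 `^ alpha.

(** What the mean zero function [b p] contributes at scale [m]: nothing below the
    scale of its cube, and a geometrically decaying amount above it, on a ball of
    radius comparable to the scale. *)
Definition bad_majorant m p x : R :=
  if (p.1 <= m)%N then
    radius n h m ^- n * q ^+ (m - p.1) * (2 * mass p.1 p.2) *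
    \1_(eball (y p) (4 * radius n h m)) x
  else 0.

(** Below the scale of [p] the estimate holds outside the dilated ball only; when
    [p] is an atom of scale [0] there is no such scale. *)
Lemma cellA_bad m p x : p.1 = 0%N \/ ~ eball (y p) (4 * r p) x ->
  (cellA alpha o h (b p) m x <= (bad_majorant m p x)%:E)%E.
Proof.
move=> px; rewrite /cellA.
set c := corner _ _ _; have t0 : 0 < radius n h m by exact: radius_gt0.
have xc : enorm (x - c) < radius n h m.
  by have := cube_sub_eball (side_gt0 m h0) (cube_idx o (side h m) x).
have away : ~ eball (y p) (4 * Num.max (r p) (radius n h m)) x ->
    (Aalpha alpha (b p) c (radius n h m) <= 0)%E.
  move=> xy; rewrite Aalpha_eq0// => z; rewrite /eball/= => zc.
  apply/eqP; apply: contra_notT xy => /bad_support zy; rewrite /eball/=.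
  have := ler_enorm_dist x c (y p); have := ler_enorm_dist c z (y p).
  rewrite (enormB c z).
  have : r p <= Num.max (r p) (radius n h m) by rewrite le_max lexx.
  have : radius n h m <= Num.max (r p) (radius n h m) by rewrite le_max lexx orbT.
  by lra.
rewrite /bad_majorant; case: ifPn => [pm|]; last first.
  rewrite -ltnNge => mp; have rm : radius n h m <= r p.
    by rewrite ler_pM2l// le_side// ltnW.
  apply: away; rewrite max_l//; case: px => // p1; by rewrite p1 in mp.
have rm : r p <= radius n h m by rewrite ler_pM2l// le_side.
rewrite indicE; have [_|xy] := boolP (x \in _); last first.
  rewrite mulr0; apply: away; rewrite max_r// => H.
  by move: xy; rewrite mem_set.
rewrite mulr1.
apply: (le_trans (@Aalpha_cancel _ _ alpha n_gt0 alpha_gt0 alpha_le1 (b p) c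
  (radius n h m) (y p) (r p) t0 (r0 p) (bad_integrable p) (integral_bad p) (@bad_support p))).
rewrite powR_ratio// [in leRHS]EFinM.
by apply: lee_wpmul2l; [rewrite lee_fin mulr_ge0 ?exprn_ge0 ?powR_ge0// invr_ge0 exprn_ge0// ltW|exact: bad_norm_le].
Qed.

Lemma bad_majorant_ge0 m p x : 0 <= bad_majorant m p x.
Proof.
rewrite /bad_majorant; case: ifP => // _; rewrite !mulr_ge0//.
- by rewrite invr_ge0 exprn_ge0// ltW// radius_gt0.
- by rewrite exprn_ge0// powR_ge0.
- exact: mass_ge0.
Qed.

Lemma Aalpha_sum_bad (s : seq (nat * 'rV[int]_n)) c t : 0 < t ->
  (Aalpha alpha (fun x => \sum_(p <- s) b p x)%R c t <=
   \sum_(p <- s) Aalpha alpha (b p) c t)%E.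
Proof.
move=> t0; have is' (s' : seq (nat * 'rV[int]_n)) :
    leb.-integrable setT (EFin \o (fun x => \sum_(p <- s') b p x)).
  have := integrable_lin s' (fun=> 1) bad_integrable.
  by apply: eq_integrable => // x _ /=; under eq_bigr do rewrite mul1r.
elim: s => [|p s IH].
  by rewrite big_nil Aalpha_eq0// => z _; rewrite big_nil.
rewrite big_cons; apply: le_trans (leeD2l _ IH).
have -> : (fun x => \sum_(p <- p :: s) b p x) =
    (b p \+ (fun x => \sum_(p <- s) b p x))%R.
  by apply/funext => x; rewrite big_cons.
apply: AalphaD => //.
- by apply: integrableS (bad_integrable p) => //; exact: eball_leb.
- by apply: integrableS (is' s) => //; exact: eball_leb.
Qed.

Lemma sum_sqr_le (N : nat) (d : nat -> R) : (forall m, 0 <= d m) ->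
  \sum_(m < N) d m ^+ 2 <= (\sum_(m < N) d m) ^+ 2.
Proof.
move=> d0; elim: N => [|N IH]; first by rewrite !big_ord0 expr0n.
rewrite !big_ord_recr/= sqrrD; have : 0 <= \sum_(i < N) d i by exact: sumr_ge0.
by have := d0 N; nra.
Qed.

Lemma cellA_fin F m x : leb.-integrable setT (EFin \o F) ->
  cellA alpha o h F m x \is a fin_num.
Proof.
move=> iF; apply: Aalpha_fin => //.
- by apply/measurable_EFinP; exact: measurable_int iF.
- exact: radius_gt0.
- by apply: integrableS iF => //; exact: eball_leb.
Qed.

Lemma Gsq_EFin F N x : leb.-integrable setT (EFin \o F) ->
  Gsq alpha o h F N x = (\sum_(m < N) fine (cellA alpha o h F m x) ^+ 2)%:E.
Proof.
move=> iF; rewrite -sumEFin; apply: eq_bigr => m _.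
by rewrite -[in LHS](fineK (cellA_fin m x iF)).
Qed.

(** Chebyshev's inequality in pointwise form: where the square function exceeds
    [2 * sigma], one of three majorants is at least [1] (the good part, the
    dilated heavy cubes, the bad part away from them).  For the last one an
    [l^1] sum over the scales replaces the [l^2] sum. *)
Lemma large_Gsq_le N x : (((2 * sigma) ^+ 2)%:E < Gsq alpha o h f N x)%E ->
  1 <= sigma ^- 2 * fine (Gsq alpha o h g N x)
     + \sum_(p <- P | heavy p.1 p.2) \1_(eball (y p) (4 * r p)) x
     + sigma^-1 * \sum_(m < N) \sum_(p <- P) bad_majorant m p x.
Proof.
move=> Gf.
have S1 : 0 <= sigma ^- 2 * fine (Gsq alpha o h g N x).
  by rewrite mulr_ge0 ?fine_ge0 ?Gsq_ge0// invr_ge0 exprn_ge0// ltW.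
have S2 : 0 <= \sum_(p <- P | heavy p.1 p.2) (\1_(eball (y p) (4 * r p)) x : R).
  by apply: sumr_ge0.
have D0 m : 0 <= \sum_(p <- P) bad_majorant m p x.
  by apply: sumr_ge0 => p _; exact: bad_majorant_ge0.
have S3 : 0 <= sigma^-1 * \sum_(m < N) \sum_(p <- P) bad_majorant m p x.
  by rewrite mulr_ge0 ?invr_ge0 ?(ltW s0)// sumr_ge0.
have [[p [pP [bp xp]]]|H] := pselect (exists p, p \in P /\ heavy p.1 p.2 /\
    eball (y p) (4 * r p) x).
  have : 1 <= \sum_(p <- P | heavy p.1 p.2) (\1_(eball (y p) (4 * r p)) x : R).
    rewrite (big_rem p pP)/= bp indicE mem_set// lerDl.
    by apply: sumr_ge0.
  by move: S1 S2 S3; lra.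
have cA m : fine (cellA alpha o h f m x) <=
    fine (cellA alpha o h g m x) + \sum_(p <- P) bad_majorant m p x.
  rewrite -lee_fin EFinD (fineK (cellA_fin m x intf)) (fineK (cellA_fin m x good_integrable)).
  have t0 : 0 < radius n h m by exact: radius_gt0.
  have E : f = (g \+ (fun x => \sum_(p <- P) b p x))%R.
    by apply/funext => z; exact: good_bad_decomposition.
  rewrite {1}/cellA {1}E.
  apply: (le_trans (AalphaD n_gt0 alpha_gt0 alpha_le1 t0 _ _)).
  - by apply: integrableS good_integrable => //; exact: eball_leb.
  - have := integrable_lin P (fun=> 1) bad_integrable => ib.
    have : leb.-integrable setT (EFin \o (fun x => \sum_(p <- P) b p x)).
      by apply: eq_integrable ib => // z _ /=; under eq_bigr do rewrite mul1r.
    by apply: integrableS => //; exact: eball_leb.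
  apply: leeD2l; apply: (le_trans (Aalpha_sum_bad _ _ t0)).
  rewrite -sumEFin big_seq [leRHS]big_seq; apply: lee_sum => p pP.
  apply: cellA_bad; have [->|bp] := heavy_or_atom pP; first by left.
  by right => xp; apply: H; exists p.
have a0 m : 0 <= fine (cellA alpha o h f m x) by rewrite fine_ge0// cellA_ge0.
have c0 m : 0 <= fine (cellA alpha o h g m x) by rewrite fine_ge0// cellA_ge0.
have dd := sum_sqr_le N D0.
set D := \sum_(m < N) \sum_(p <- P) _ in dd S3 *.
have D0' : 0 <= D by exact: sumr_ge0.
move: Gf; rewrite (Gsq_EFin N x intf) lte_fin => Gf.
rewrite (Gsq_EFin N x good_integrable)/= in S1 *.
set Gg := \sum_(m < N) fine (cellA alpha o h g m x) ^+ 2 in S1 *.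
have : \sum_(m < N) fine (cellA alpha o h f m x) ^+ 2 <= 2 * Gg + 2 * D ^+ 2.
  apply: (@le_trans _ _ (2 * Gg +
      2 * \sum_(m < N) (\sum_(p <- P) bad_majorant m p x) ^+ 2)); last first.
    by rewrite lerD2l ler_pM2l.
  rewrite /Gg !mulr_sumr -big_split/=; apply: ler_sum => m _.
  have := cA m; have := a0 m; have := c0 m; have := D0 m.
  set u := fine (cellA alpha o h f m x); set v := fine (cellA alpha o h g m x).
  set z := \sum_(p <- P) _ => z0 v0 u0 uvz.
  have : u ^+ 2 <= (v + z) ^+ 2 by rewrite ler_pXn2r ?nnegrE ?addr_ge0.
  by have := sqr_ge0 (v - z); nra.
move=> H2; rewrite leNgt; apply/negP => H3.
have s2 : 0 < sigma ^+ 2 by rewrite exprn_gt0.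
have : sigma ^- 2 * Gg < 1 by move: S2 S3 H3; lra.
have : sigma^-1 * D < 1 by move: S1 S2 H3; lra.
rewrite !ltr_pdivrMl// !mulr1 => Ds Gs.
have : D ^+ 2 < sigma ^+ 2 by rewrite ltr_pXn2r// nnegrE// ltW.
by move: Gf; rewrite exprMn; lra.
Qed.

(** ** Integration against the weight *)

Variable (w : 'rV[R]_n -> R).
Hypotheses (weight_w : weight w).
Variable (K : R).
Hypotheses (K_gt0 : 0 < K) (HK : A1_bound w K).

Let mw : measurable_fun [set: lebesgue_rV R n] (EFin \o w).
Proof. by apply/measurable_EFinP; exact: weight_measurable. Qed.

Let J p := (\int[leb]_(x in Q p) (`|f x|%:E * (w x)%:E))%E.

Let J_ge0 p : (0 <= J p)%E.
Proof. by apply: integral_ge0 => x _; rewrite mule_ge0 ?lee_fin ?(weight_ge0 weight_w). Qed.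

Let m_fw : measurable_fun [set: lebesgue_rV R n] (fun x => `|f x|%:E * (w x)%:E)%E.
Proof.
apply: emeasurable_funM; last exact: mw.
by apply/measurable_EFinP; apply: measurableT_comp; first by [].
Qed.

Lemma Q_sub_eball p rho : r p <= rho -> Q p `<=` eball (y p) rho.
Proof.
move=> rrho; apply: subset_trans (cube_sub_eball (side_gt0 p.1 h0)) _.
by apply: sub_eball; rewrite enormxx add0r.
Qed.

Lemma vol_mass_le p rho : r p <= rho ->
  ((vol w (y p) rho * mass p.1 p.2)%:E <= (K * rho ^+ n)%:E * J p)%E.
Proof.
move=> rrho; have rho0 : 0 < rho by exact: lt_le_trans rrho.
have m1 : measurable_fun (Q p) (fun x => `|f x|%:E).
  exact: measurable_int (intnQ p).
have F0 z : (0 <= `|f z|%:E)%E by rewrite lee_fin.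
have := A1_integral weight_w K_gt0 HK rho0 (mQ p) (Q_sub_eball rrho) m1 F0.
have -> : (\int[leb]_(x in Q p) (`|f x|)%:E = (mass p.1 p.2)%:E)%E.
  by rewrite /mass /Rintegral fineK//; exact: (integrable_fin_num (mQ p) (intnQ p)).
by rewrite -EFinM.
Qed.

Lemma sum_weighted_mass : (\sum_(p <- P) J p = \int[leb]_x (`|f x|%:E * (w x)%:E))%E.
Proof.
pose F p x : \bar R := (`|f x|%:E * (w x)%:E * (\1_(Q p) x)%:E)%E.
have mF p : measurable_fun [set: lebesgue_rV R n] (F p).
  apply: emeasurable_funM; first exact: m_fw.
  by apply/measurable_EFinP; exact: measurable_indic.
have F0 p x : [set: lebesgue_rV R n] x -> (0 <= F p x)%E.
  by move=> _; rewrite /F mule_ge0 ?mule_ge0 ?lee_fin ?(weight_ge0 weight_w).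
transitivity (\int[leb]_x (\sum_(p <- P) F p x))%E.
  rewrite (ge0_integral_sum leb measurableT mF F0); apply: eq_bigr => p _.
  rewrite /J [LHS]integral_mkcond; apply: eq_integral => x _.
  by rewrite patchE /F indicE; case: (_ \in _); rewrite ?mule1 ?mule0.
apply: eq_integral => x _; rewrite /F.
transitivity (`|f x|%:E * (w x)%:E * (\sum_(p <- P) \1_(Q p) x)%:E)%E.
  by rewrite -EFinM -EFinM mulr_sumr -sumEFin; apply: eq_bigr => p _; rewrite !EFinM.
rewrite sum_indic_cz indicE; have [->|/suppf xT] := eqVneq (f x) 0.
  by rewrite normr0 !mul0e.
by rewrite mem_set// mule1.
Qed.

Lemma integral_w_eball c rho : 0 < rho ->
  (\int[leb]_x ((w x)%:E * (\1_(eball c rho) x)%:E) = (vol w c rho)%:E)%E.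
Proof.
move=> rho0; rewrite -wmeas_eball// /wmeas [RHS]integral_mkcond.
apply: eq_integral => x _; rewrite patchE indicE.
by case: (_ \in _); rewrite ?mule1 ?mule0.
Qed.

(** [g^2] is at most a constant times [sigma * |g|], and [A_1] on a ball around
    each cube bounds the average of [f] times the weight by the integral of [f]
    against it. *)
Lemma good_sqr_weighted : (\int[leb]_x (g x ^+ 2 * w x)%:E <=
  (sigma * (2 ^+ n * K * n.+1%:R ^+ n))%:E * \int[leb]_x (`|f x|%:E * (w x)%:E))%E.
Proof.
pose F p x : \bar R := (`|avg p|%:E * ((w x)%:E * (\1_(eball (y p) (r p)) x)%:E))%E.
have m1 p : measurable_fun [set: lebesgue_rV R n]
   (fun x => ((w x)%:E * (\1_(eball (y p) (r p)) x)%:E)%E).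
  apply: emeasurable_funM; first exact: mw.
  by apply/measurable_EFinP; apply: measurable_indic; exact: eball_leb.
have mF p : measurable_fun [set: lebesgue_rV R n] (F p).
  by apply: measurable_funeM; exact: m1.
have F0 p x : [set: lebesgue_rV R n] x -> (0 <= F p x)%E.
  by move=> _; rewrite /F mule_ge0 ?mule_ge0 ?lee_fin ?(weight_ge0 weight_w).
have c0 : 0 <= 2 ^+ n * sigma by rewrite mulr_ge0 ?exprn_ge0// ltW.
apply: (@le_trans _ _ (\int[leb]_x ((2 ^+ n * sigma)%:E * \sum_(p <- P) F p x))%E).
  apply: (ge0_le_integral leb measurableT).
  - by move=> x _; rewrite lee_fin mulr_ge0 ?sqr_ge0// weight_ge0.
  - apply/measurable_EFinP; apply: measurable_funM; last exact: weight_measurable.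
    by apply: measurable_funX; exact: good_measurable.
  - by apply: measurable_funeM; apply: emeasurable_sum => p; exact: mF.
  - move=> x _; rewrite /F.
    have -> : (\sum_(p <- P) `|avg p|%:E * ((w x)%:E * (\1_(eball (y p) (r p)) x)%:E) =
       (\sum_(p <- P) `|avg p| * (w x * \1_(eball (y p) (r p)) x))%:E)%E.
      by rewrite -sumEFin.
    rewrite -EFinM lee_fin.
    apply: (@le_trans _ _ (2 ^+ n * sigma * ((\sum_(p <- P) `|avg p| * \1_(Q p) x) * w x))).
      rewrite mulrA; apply: ler_wpM2r; first exact: weight_ge0.
      rewrite -(real_normK (num_real (g x))) expr2.
      by apply: ler_pM => //; [exact: normr_good_le|exact: normr_good_le_sum].
    apply: ler_wpM2l => //; rewrite mulr_suml; apply: ler_sum => p _.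
    rewrite mulrAC -mulrA; apply: ler_wpM2l => //.
    apply: ler_wpM2l; first exact: weight_ge0.
    rewrite !indicE; have [xQ|//] := boolP (x \in Q p).
    by rewrite (mem_set (Q_sub_eball (lexx (r p)) (set_mem xQ))).
have sF0 x : [set: lebesgue_rV R n] x -> (0 <= \sum_(p <- P) F p x)%E.
  by move=> xT; apply: sume_ge0 => p _; exact: F0.
have msF : measurable_fun [set: lebesgue_rV R n] (fun x => \sum_(p <- P) F p x)%E.
  by apply: emeasurable_sum => p; exact: mF.
rewrite (ge0_integralZl_EFin leb measurableT sF0 msF c0).
rewrite (ge0_integral_sum leb measurableT mF F0) -sum_weighted_mass.
rewrite (_ : sigma * (2 ^+ n * K * n.+1%:R ^+ n) =
  (2 ^+ n * sigma) * (K * n.+1%:R ^+ n)); last by ring.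
rewrite [in leRHS]EFinM -[leRHS]muleA; apply: lee_wpmul2l; first by rewrite lee_fin.
rewrite ge0_sume_distrr; last by move=> p _; exact: J_ge0.
apply: lee_sum => p _.
have i0 x : [set: lebesgue_rV R n] x ->
    (0 <= (w x)%:E * (\1_(eball (y p) (r p)) x)%:E)%E.
  by move=> _; rewrite mule_ge0 ?lee_fin ?(weight_ge0 weight_w).
rewrite /F (ge0_integralZl_EFin leb measurableT i0 (m1 p) (normr_ge0 _)).
rewrite integral_w_eball// -EFinM.
have sn0 := sd0 p.
apply: (@le_trans _ _ (((side h p.1 ^+ n)^-1)%:E * (vol w (y p) (r p) * mass p.1 p.2)%:E)%E).
  rewrite -EFinM lee_fin mulrC [leRHS]mulrCA; apply: ler_wpM2l; first exact: vol_ge0.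
  by rewrite mulrC; exact: normr_avg_le.
rewrite lee_pdivrMl//; apply: le_trans (vol_mass_le (lexx _)) _.
rewrite muleA -EFinM; apply: lee_wpmul2r; first exact: J_ge0.
rewrite lee_fin /r /radius exprMn le_eqVlt; apply/orP; left; apply/eqP; ring.
Qed.

(** A heavy cube has volume at most [1 / sigma] times the mass of [f] on it. *)
Lemma bad_set_weighted p : heavy p.1 p.2 ->
  ((vol w (y p) (4 * r p))%:E <=
    (sigma^-1 * (K * (4 * n.+1%:R) ^+ n))%:E * J p)%E.
Proof.
move=> bp; have sn0 := sd0 p.
have rr : r p <= 4 * r p by apply: ler_peMl; [exact: ltW|rewrite ler1n].
have c0 : 0 < sigma * side h p.1 ^+ n by rewrite mulr_gt0.
have H : ((vol w (y p) (4 * r p) * (sigma * side h p.1 ^+ n))%:E <=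
    (K * (4 * r p) ^+ n)%:E * J p)%E.
  apply: le_trans (vol_mass_le rr); rewrite lee_fin.
  by apply: ler_wpM2l; [exact: vol_ge0|exact: ltW].
rewrite EFinM in H; move: H; rewrite -lee_pdivlMr// => /le_trans; apply.
rewrite muleAC -EFinM; apply: lee_wpmul2r; first exact: J_ge0.
rewrite lee_fin /r /radius !exprMn le_eqVlt; apply/orP; left; apply/eqP.
by field; rewrite !gt_eqF ?exprn_gt0.
Qed.

(** [A_1] is used on the ball of radius [4 * radius n h m], whose volume cancels
    the normalisation of the test functions of scale [m]. *)
Lemma bad_majorant_weighted m p :
  (\int[leb]_x ((w x)%:E * (bad_majorant m p x)%:E) <=
    (2 * K * 4 ^+ n * q ^+ (p.1 - m + (m - p.1)))%:E * J p)%E.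
Proof.
have q0 : 0 <= q by exact: powR_ge0.
rewrite /bad_majorant; case: (leqP p.1 m) => pm; last first.
  under eq_integral do rewrite mule0.
  rewrite integral0 mule_ge0 ?J_ge0// lee_fin !mulr_ge0 ?exprn_ge0//.
  exact: ltW.
have t0 : 0 < radius n h m by exact: radius_gt0.
have t40 : 0 < 4 * radius n h m by rewrite mulr_gt0.
have rm : r p <= 4 * radius n h m.
  apply: (@le_trans _ _ (radius n h m)); first by rewrite ler_pM2l// le_side.
  by apply: ler_peMl; [exact: ltW|rewrite ler1n].
set c := radius n h m ^- n * _.
have c0 : 0 <= c.
  by rewrite mulr_ge0 ?exprn_ge0// invr_ge0 exprn_ge0// ltW.
have cn0 : 0 <= c * (2 * mass p.1 p.2).
  by apply: mulr_ge0 => //; apply: mulr_ge0 => //; exact: mass_ge0.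
have E x : ((w x)%:E * (c * (2 * mass p.1 p.2) *
    \1_(eball (y p) (4 * radius n h m)) x)%:E = (c * (2 * mass p.1 p.2))%:E *
    ((w x)%:E * (\1_(eball (y p) (4 * radius n h m)) x)%:E))%E.
  by rewrite -!EFinM mulrCA.
under eq_integral do rewrite E.
have m1 : measurable_fun [set: lebesgue_rV R n]
   (fun x => ((w x)%:E * (\1_(eball (y p) (4 * radius n h m)) x)%:E)%E).
  apply: emeasurable_funM; first exact: mw.
  by apply/measurable_EFinP; apply: measurable_indic; exact: eball_leb.
have i0 x : [set: lebesgue_rV R n] x ->
    (0 <= (w x)%:E * (\1_(eball (y p) (4 * radius n h m)) x)%:E)%E.
  by move=> _; rewrite mule_ge0 ?lee_fin ?(weight_ge0 weight_w).
rewrite (ge0_integralZl_EFin leb measurableT i0 m1 cn0) integral_w_eball// -EFinM.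
have -> : c * (2 * mass p.1 p.2) * vol w (y p) (4 * radius n h m) =
  c * 2 * (vol w (y p) (4 * radius n h m) * mass p.1 p.2) by ring.
rewrite EFinM; apply: le_trans (lee_wpmul2l _ (vol_mass_le rm)) _.
  by rewrite lee_fin mulr_ge0.
rewrite muleA -EFinM; apply: lee_wpmul2r; first exact: J_ge0.
rewrite lee_fin (eqP pm) add0n /c [(4 * _) ^+ n]exprMn le_eqVlt; apply/orP; left; apply/eqP.
by field; rewrite gt_eqF ?exprn_gt0.
Qed.

Let q_lt1 : q < 1. Proof. exact: powR_half_lt1. Qed.

Lemma bad_part_weighted N :
  (\sum_(m < N) \sum_(p <- P) \int[leb]_x ((w x)%:E * (bad_majorant m p x)%:E) <=
   (2 * K * 4 ^+ n * (2 * (1 - q)^-1))%:E * \int[leb]_x (`|f x|%:E * (w x)%:E))%E.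
Proof.
have q01 : 0 < q < 1 by rewrite q_lt1 powR_gt0// invr_gt0.
have c0 : 0 <= 2 * K * 4 ^+ n.
  by apply: mulr_ge0; [apply: mulr_ge0 => //; exact: ltW|exact: exprn_ge0].
rewrite exchange_big/= -sum_weighted_mass ge0_sume_distrr; last by move=> p _; exact: J_ge0.
apply: lee_sum => p _.
apply: (@le_trans _ _ (\sum_(m < N)
    (2 * K * 4 ^+ n * q ^+ (p.1 - m + (m - p.1)))%:E * J p)%E).
  by apply: lee_sum => m _; exact: bad_majorant_weighted.
rewrite -ge0_sume_distrl; last first.
  by move=> m _; rewrite lee_fin; apply: mulr_ge0 => //; rewrite exprn_ge0// powR_ge0.
apply: lee_wpmul2r; first exact: J_ge0.
rewrite sumEFin lee_fin -mulr_sumr; apply: ler_wpM2l => //.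
exact: geo_dist_sum_le.
Qed.

Lemma weak_type_CZ (C1 : R) N : 0 <= C1 ->
  (\int[leb]_x ((w x)%:E * Gsq alpha o h g N x) <=
     C1%:E * \int[leb]_x (g x ^+ 2 * w x)%:E)%E ->
  (\int[leb]_x ((w x)%:E *
      (\1_[set z | (((2 * sigma) ^+ 2)%:E < Gsq alpha o h f N z)%E] x)%:E) <=
   (sigma^-1 * (C1 * (2 ^+ n * K * n.+1%:R ^+ n) + K * (4 * n.+1%:R) ^+ n +
      2 * K * 4 ^+ n * (2 * (1 - q)^-1)))%:E *
   \int[leb]_x (`|f x|%:E * (w x)%:E))%E.
Proof.
move=> C10 HC1.
set F := (\int[leb]_x (`|f x|%:E * (w x)%:E))%E.
have F0 : (0 <= F)%E.
  by apply: integral_ge0 => x _; rewrite mule_ge0 ?lee_fin ?(weight_ge0 weight_w).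
pose S : set (lebesgue_rV R n) :=
  [set z | (((2 * sigma) ^+ 2)%:E < Gsq alpha o h f N z)%E].
have mS : measurable S.
  have := emeasurable_fun_o_infty measurableT
    (Gsq_measurable alpha o f N h0) ((2 * sigma) ^+ 2)%:E.
  by rewrite setTI.
have si0 : 0 <= sigma^-1 by rewrite invr_ge0 ltW.
have s20 : 0 <= sigma ^- 2 by rewrite invr_ge0 exprn_ge0// ltW.
pose A1 x := ((w x)%:E * Gsq alpha o h g N x)%E.
pose A2 p x := ((w x)%:E * (\1_(eball (y p) (4 * r p)) x)%:E)%E.
pose A3 m p x := ((w x)%:E * (bad_majorant m p x)%:E)%E.
have mA1 : measurable_fun [set: lebesgue_rV R n] A1.
  by apply: emeasurable_funM; [exact: mw|exact: Gsq_measurable].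
have mA2 p : measurable_fun [set: lebesgue_rV R n] (A2 p).
  apply: emeasurable_funM; first exact: mw.
  by apply/measurable_EFinP; apply: measurable_indic; exact: eball_leb.
have mA3 m p : measurable_fun [set: lebesgue_rV R n] (A3 m p).
  apply: emeasurable_funM; first exact: mw.
  apply/measurable_EFinP; rewrite /bad_majorant; case: (p.1 <= m)%N.
    by apply: measurable_funM; [exact: measurable_cst|apply: measurable_indic; exact: eball_leb].
  exact: measurable_cst.
have A10 x : (0 <= A1 x)%E.
  by rewrite mule_ge0 ?lee_fin ?(weight_ge0 weight_w)// Gsq_ge0.
have A20 p x : (0 <= A2 p x)%E.
  by rewrite mule_ge0 ?lee_fin ?(weight_ge0 weight_w).
have A30 m p x : (0 <= A3 m p x)%E.
  by rewrite mule_ge0 ?lee_fin ?(weight_ge0 weight_w)// bad_majorant_ge0.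
pose B1 x := ((sigma ^- 2)%:E * A1 x)%E.
pose B2 x := (\sum_(p <- [seq p <- P | heavy p.1 p.2]) A2 p x)%E.
pose B3 x := (sigma^-1%:E * \sum_(i <- [seq (m, p) | m <- index_iota 0 N, p <- P]) A3 i.1 i.2 x)%E.
have mB1 : measurable_fun [set: lebesgue_rV R n] B1 by apply: measurable_funeM.
have mB2 : measurable_fun [set: lebesgue_rV R n] B2.
  by apply: emeasurable_sum => p; exact: mA2.
have mB3' : measurable_fun [set: lebesgue_rV R n] (fun x =>
    \sum_(i <- [seq (m, p) | m <- index_iota 0 N, p <- P]) A3 i.1 i.2 x)%E.
  by apply: emeasurable_sum => i; exact: mA3.
have mB3 : measurable_fun [set: lebesgue_rV R n] B3 by apply: measurable_funeM.
have B10 x : [set: lebesgue_rV R n] x -> (0 <= B1 x)%E.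
  by move=> _; rewrite mule_ge0.
have B20 x : [set: lebesgue_rV R n] x -> (0 <= B2 x)%E.
  by move=> _; apply: sume_ge0.
have B30' x : [set: lebesgue_rV R n] x ->
    (0 <= \sum_(i <- [seq (m, p) | m <- index_iota 0 N, p <- P]) A3 i.1 i.2 x)%E.
  by move=> _; apply: sume_ge0 => i _; exact: A30.
have B30 x : [set: lebesgue_rV R n] x -> (0 <= B3 x)%E.
  by move=> xT; rewrite mule_ge0// B30'.
have mB12 : measurable_fun [set: lebesgue_rV R n] (fun x => B1 x + B2 x)%E.
  exact: (emeasurable_funD mB1 mB2).
apply: (@le_trans _ _ (\int[leb]_x ((B1 x + B2 x) + B3 x))%E).
  apply: (ge0_le_integral leb measurableT).
  - by move=> x _; rewrite mule_ge0 ?lee_fin ?(weight_ge0 weight_w).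
  - apply: emeasurable_funM; first exact: mw.
    by apply/measurable_EFinP; exact: measurable_indic.
  - exact: (emeasurable_funD mB12 mB3).
  - move=> x xT; rewrite indicE; have [|_] := boolP (x \in _); last first.
      by rewrite mule0; rewrite !adde_ge0 ?B10 ?B20 ?B30.
    rewrite inE => /large_Gsq_le H.
    have -> : (B1 x + B2 x + B3 x = (w x *
      (sigma ^- 2 * fine (Gsq alpha o h g N x)
     + \sum_(p <- P | heavy p.1 p.2) \1_(eball (y p) (4 * r p)) x
     + sigma^-1 * \sum_(m < N) \sum_(p <- P) bad_majorant m p x))%:E)%E.
      rewrite !mulrDr !EFinD; congr (_ + _ + _)%E.
      - rewrite /B1 /A1 (Gsq_EFin N x good_integrable)/= -!EFinM; congr EFin; ring.
      - by rewrite /B2 big_filter mulr_sumr -sumEFin; apply: eq_bigr => p _.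
      - rewrite /B3 big_allpairs_dep/= big_mkord mulrCA EFinM; congr (_ * _)%E.
        rewrite mulr_sumr -sumEFin; apply: eq_bigr => m _.
        by rewrite mulr_sumr -sumEFin; apply: eq_bigr => p _.
    rewrite -EFinM lee_fin; apply: ler_wpM2l => //.
    exact: weight_ge0.
have B120 x : [set: lebesgue_rV R n] x -> (0 <= B1 x + B2 x)%E.
  by move=> xT; rewrite adde_ge0 ?B10 ?B20.
rewrite (ge0_integralD leb measurableT B120 mB12 B30 mB3).
rewrite (ge0_integralD leb measurableT B10 mB1 B20 mB2).
have A10' x : [set: lebesgue_rV R n] x -> (0 <= A1 x)%E by [].
rewrite mulrDr mulrDr EFinD EFinD ge0_muleDl; last 2 first.
- by rewrite -EFinD lee_fin addr_ge0// !mulr_ge0 ?exprn_ge0// ltW.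
- have q1 : 0 <= (1 - q)^-1 by rewrite invr_ge0 subr_ge0 ltW.
  by rewrite lee_fin !mulr_ge0 ?exprn_ge0// ltW.
rewrite ge0_muleDl; last 2 first.
- by rewrite lee_fin !mulr_ge0 ?exprn_ge0 ?(ltW K_gt0).
- by rewrite lee_fin !mulr_ge0 ?exprn_ge0 ?(ltW K_gt0).
apply: leeD; first apply: leeD.
- rewrite /B1 (ge0_integralZl_EFin leb measurableT A10' mA1 s20).
  apply: le_trans (lee_wpmul2l _ HC1) _; first by rewrite lee_fin.
  apply: le_trans (lee_wpmul2l _ (lee_wpmul2l _ good_sqr_weighted)) _; rewrite ?lee_fin//.
  rewrite !muleA -!EFinM; apply: lee_wpmul2r => //.
  rewrite lee_fin le_eqVlt; apply/orP; left; apply/eqP; field.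
  by rewrite gt_eqF.
- rewrite /B2 (ge0_integral_sum leb measurableT mA2); last by move=> p x _; exact: A20.
  rewrite big_filter /F -sum_weighted_mass ge0_sume_distrr; last by move=> p _; exact: J_ge0.
  rewrite big_mkcond/=; apply: lee_sum => p _; case: ifPn => [bp|_]; last first.
    by rewrite mule_ge0 ?J_ge0// lee_fin !mulr_ge0 ?exprn_ge0// ltW.
  rewrite /A2 integral_w_eball ?mulr_gt0//; exact: bad_set_weighted.
- rewrite /B3 (ge0_integralZl_EFin leb measurableT B30' mB3' si0).
  rewrite (ge0_integral_sum leb measurableT (fun i => mA3 i.1 i.2)); last first.
    by move=> i x _; exact: A30.
  rewrite [in leRHS]EFinM -muleA; apply: lee_wpmul2l; first by rewrite lee_fin.
  rewrite big_allpairs_dep/= big_mkord; exact: bad_part_weighted.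
Qed.

End CZ.

(** * Measurability of the square function *)

Section measurability.
Context {R : realType} {n : nat}.
Local Notation leb := (@lebesgueRn R n).
Variables (alpha : R).
Hypotheses (n_gt0 : (0 < n)%N) (alpha_gt0 : 0 < alpha) (alpha_le1 : alpha <= 1).
Variable f : 'rV[R]_n -> R.
Hypothesis mf : measurable_fun [set: lebesgue_rV R n] f.
Implicit Types (x y : 'rV[R]_n) (t s : R).
Local Notation A := (Aalpha alpha f).

(** Nondecreasing along cones, in contrast to [A] itself. *)
Definition coneA x t : \bar R := ((@Aweight R n alpha t)%:E * A x t)%E.

Lemma coneA_ge0 x t : 0 < t -> (0 <= coneA x t)%E.
Proof.
move=> t0; rewrite mule_ge0 ?Aalpha_ge0// lee_fin ltW//.
exact: Aweight_gt0.
Qed.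

Lemma coneA_mono x y s t : 0 < t -> enorm (y - x) <= s - t ->
  (coneA y t <= coneA x s)%E.
Proof. by move=> t0 xy; exact: Aalpha_mono. Qed.

Lemma coneA_nd x s t : 0 < s -> s <= t -> (coneA x s <= coneA x t)%E.
Proof.
move=> s0 st; apply: coneA_mono => //.
by rewrite enormxx subr_ge0.
Qed.

Let l (k : nat) : R := k.+1%:R^-1.
Let l0 k : 0 < l k. Proof. by rewrite /l invr_gt0. Qed.

Let tgrid k t := (Num.floor (t / l k))%:~R * l k - n.+1%:R * l k.

(** Evaluate [coneA] at the corner of the cell of [x] in the grid of side [l k],
    at a height lowered so much that the new point lies in the cone below
    [(x, t)]; the value is [0] if no positive height is left. *)
Definition gridA k (p : lebesgue_rV R n * measurableTypeR R) : \bar R :=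
  if 0 < tgrid k p.2 then
    coneA (corner 0 (l k) (idx 0 (l k) p.1)) (tgrid k p.2)
  else 0%E.

Let tgrid_bnd k t : t - (n.+1%:R + 1) * l k < tgrid k t <= t - n.+1%:R * l k.
Proof.
have := floor_itv (t / l k); rewrite /tgrid intrD ler_pdivlMr// ltr_pdivrMr//.
by move=> /andP[h1 h2]; apply/andP; split; lra.
Qed.

Lemma gridA_le k x s t : 0 < s -> t - l k <= s -> (gridA k (x, t) <= coneA x s)%E.
Proof.
move=> s0 ts; rewrite /gridA/=; case: ifPn => [g0|_]; last exact: coneA_ge0.
apply: coneA_mono => //.
have := cube_enorm (l0 k) (cube_idx 0 (l k) x); rewrite enormB => h.
apply: le_trans h _; have /andP[_ h2] := tgrid_bnd k t.
have : (n.+1%:R : R) = n%:R + 1 by rewrite natr1.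
by move: (l0 k) h2 => /ltW; nra.
Qed.

Lemma gridA_ge x s t : 0 < s < t -> exists k, (coneA x s <= gridA k (x, t))%E.
Proof.
move=> /andP[s0 st].
pose k := Num.trunc ((2 * n.+1%:R + 1) / (t - s)).
have ts : 0 < t - s by rewrite subr_gt0.
have lk : (2 * n.+1%:R + 1) * l k < t - s.
  rewrite /l ltr_pdivrMr// [ltRHS]mulrC -ltr_pdivrMr//.
  exact: truncnS_gt.
exists k; have /andP[h1 h2] := tgrid_bnd k t.
have n1 : (n.+1%:R : R) = n%:R + 1 by rewrite natr1.
have lk0 := l0 k.
have nn : 0 <= n%:R * l k by rewrite mulr_ge0// ltW.
have h3 : n%:R * l k <= tgrid k t - s.
  by move: lk h1; rewrite n1; nra.
rewrite /gridA/= ifT; last by lra.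
apply: coneA_mono => //; apply: le_trans h3.
exact: (cube_enorm (l0 k) (cube_idx 0 (l k) x)).
Qed.

Lemma gridA_measurable k : measurable_fun setT (gridA k).
Proof.
pose u (p : lebesgue_rV R n * measurableTypeR R) : 'rV[int]_n * int :=
  (idx 0 (l k) p.1, Num.floor (p.2 / l k)).
pose G (i : 'rV[int]_n * int) : \bar R :=
  if 0 < i.2%:~R * l k - n.+1%:R * l k then
    coneA (corner 0 (l k) i.1) (i.2%:~R * l k - n.+1%:R * l k)
  else 0%E.
have := @measurable_fun_fibers _ _ (lebesgue_rV R n * measurableTypeR R)%type
  (\bar R) _ u G; apply => -[j i].
have -> : [set p | u p = (j, i)] = cube 0 (l k) j `*`
    [set t : measurableTypeR R | Num.floor (t / l k) = i].
  apply/seteqP; split => [[x t] [<- <-]//|[x t] /= [xj ti]].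
  by rewrite /u/= ti (xj : _ = j).
apply: measurableX; first exact: cube_leb.
have -> : [set t : measurableTypeR R | Num.floor (t / l k) = i] =
    `[i%:~R * l k, (i + 1)%:~R * l k[%classic.
  apply/seteqP; split => t /=; rewrite in_itv/=.
    by move=> ti; have := floor_itv (t / l k); rewrite ti ler_pdivlMr// ltr_pdivrMr.
  by move=> ti; apply: floor_def; rewrite ler_pdivlMr// ltr_pdivrMr.
exact: measurable_itv.
Qed.

(** For fixed [x] this is the left limit of [coneA x], as [gridA_le] and
    [leftA_ge] show. *)
Definition leftA p : \bar R := ereal_sup [set gridA k p | k in [set: nat]].

Lemma leftA_measurable : measurable_fun setT leftA.
Proof.
have := @measurable_fun_esups _ _ _ setT gridA gridA_measurable 0.
rewrite (_ : (fun _ => _) = leftA)//.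
apply/funext => p; rewrite /esups /leftA; congr ereal_sup.
by apply/seteqP; split => z [k ? <-]; exists k.
Qed.

Lemma leftA_le x t : 0 < t -> (leftA (x, t) <= coneA x t)%E.
Proof.
move=> t0; apply: ge_ereal_sup => _ [k _ <-]; apply: gridA_le => //.
by have := l0 k; lra.
Qed.

Lemma leftA_ge x s t : 0 < s < t -> (coneA x s <= leftA (x, t))%E.
Proof.
move=> st; have [k hk] := gridA_ge x st; apply: le_trans hk _.
by apply: ereal_sup_ubound; exists k.
Qed.

Lemma leftA_ge0 p : (0 <= leftA p)%E.
Proof.
apply: (@le_trans _ _ (gridA 0 p)).
  by rewrite /gridA; case: ifPn => // ?; exact: coneA_ge0.
by apply: ereal_sup_ubound; exists 0%N.
Qed.

(** Each jump of the monotone function [coneA x] skips a rational number, and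
    different jumps skip different ones. *)
Lemma leftA_jumps x :
  countable [set t | 0 < t /\ (leftA (x, t) < coneA x t)%E].
Proof.
pose J (q : rat) := [set t | 0 < t /\ (leftA (x, t) <= (ratr q)%:E < coneA x t)%E].
apply: (@sub_countable _ _ _ (\bigcup_(q in [set: rat]) J q)).
  apply: subset_card_le => t [t0 lt].
  have l0' := leftA_ge0 (x, t).
  move: lt; rewrite /J; case E : (leftA (x, t)) l0' => [a| |]// _; last by rewrite ltNge leey.
  case E' : (coneA x t) => [b| |]//.
    rewrite lte_fin => /rat_in_itvoo[q]; rewrite in_itv/= => /andP[h1 h2].
    by exists q => //; split => //; rewrite E E' lee_fin lte_fin h2 ltW.
  move=> _; have : a < a + 1 by lra.
  move=> /rat_in_itvoo[q]; rewrite in_itv/= => /andP[h1 h2].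
  by exists q => //; split => //; rewrite E E' lee_fin ltry ltW.
apply: bigcup_countable => [|q _]; first exact: countableP.
have J1 t t' : J q t -> J q t' -> t < t' -> False.
  move=> [t0 /andP[_ qt]] [t'0 /andP[t'q _]] tt'.
  have := lt_le_trans qt (@leftA_ge x t t' _); rewrite t0 tt' => /(_ isT).
  by move=> /lt_le_trans/(_ t'q); rewrite ltxx.
have [[t Jt]|noJ] := pselect (exists t, J q t).
  have -> : J q = [set t].
    apply/seteqP; split=> [t' Jt'|_ ->]//=.
    by case: (ltgtP t' t) => // tt'; [case: (J1 _ _ Jt' Jt tt')|case: (J1 _ _ Jt Jt' tt')].
  exact: countable1.
have -> : J q = set0 by apply/seteqP; split=> // t Jt; apply: noJ; exists t.
exact: countable0.
Qed.

Lemma coneA_measurable x (E : set (measurableTypeR R)) : measurable E ->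
  E `<=` `]0, +oo[%classic -> measurable_fun E (coneA x).
Proof.
move=> mE E0.
suff H : measurable_fun (`]0%R, +oo[%classic : set (measurableTypeR R)) (coneA x).
  by apply: measurable_funS H => //; exact: measurable_itv.
move=> mD; apply: (measurability _ (ErealGenOInfty.measurableE R)) => //.
move=> _ [_ [a ->] <-].
apply: is_interval_measurable => s t /=; rewrite !in_itv/= !andbT.
move=> [s0 sa] [t0 ta] z /andP[sz zt]; have z0 : 0 < z by exact: lt_le_trans sz.
split; first by rewrite in_itv/= andbT.
move: sa; rewrite ?in_itv/= ?andbT => sa.
exact: lt_le_trans sa (coneA_nd x s0 sz).
Qed.

(** [coneA x t ^+ 2 * omega t] is [A x t ^+ 2 / t] for [t > 0]; the powers make
    measurability on the whole line immediate. *)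
Let omega t : R := ((t `^ (-1)) ^+ n * t `^ (- alpha)) ^+ 2 * t `^ (-1).

Let omega_measurable : measurable_fun [set: measurableTypeR R] omega.
Proof.
apply: measurable_funM; last exact: measurable_powR.
apply: measurable_funX; apply: measurable_funM; last exact: measurable_powR.
by apply: measurable_funX; exact: measurable_powR.
Qed.

Let omega_ge0 t : 0 <= omega t.
Proof. by rewrite mulr_ge0 ?sqr_ge0// powR_ge0. Qed.

Lemma square_coneA x t : 0 < t ->
  (A x t ^+ 2 * (t^-1)%:E = coneA x t ^+ 2 * (omega t)%:E)%E.
Proof.
move=> t0; have a0 := Aweight_gt0 (n:=n) alpha t0.
have oE : omega t = @Aweight R n alpha t ^- 2 * t^-1.
  rewrite /omega powR_inv1 ?(ltW t0)// powRN /Aweight exprVn.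
  by rewrite -invfM exprVn.
have Ap : (0 <= A x t)%E by exact: Aalpha_ge0.
rewrite /coneA; case: (A x t) Ap => [r| |]// _.
  by rewrite -!EFinM oE; congr EFin; field; rewrite !gt_eqF.
rewrite gt0_muley ?lte_fin//= ?expe2 ?mulyy !gt0_mulye ?lte_fin ?invr_gt0//.
by rewrite oE mulr_gt0 ?invr_gt0// exprn_gt0.
Qed.

Lemma square_measurable x (E : set (measurableTypeR R)) : measurable E ->
  E `<=` `]0, +oo[%classic -> measurable_fun E (fun t => A x t ^+ 2 * (t^-1)%:E)%E.
Proof.
move=> mE E0.
apply: (eq_measurable_fun (fun t => (coneA x t ^+ 2 * (omega t)%:E)%E)).
  move=> t; rewrite inE => /E0/=; rewrite in_itv/= andbT => t0.
  by rewrite square_coneA.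
apply: emeasurable_funM; last first.
  by apply/measurable_EFinP; exact: measurable_funTS.
under eq_fun do rewrite expe2.
by apply: emeasurable_funM; exact: coneA_measurable.
Qed.

Lemma integral_leftA x (E : set (measurableTypeR R)) : measurable E ->
  E `<=` `]0, +oo[%classic ->
  (\int[@lebesgue_measure R]_(t in E) (A x t ^+ 2 * (t^-1)%:E) =
   \int[@lebesgue_measure R]_(t in E) (leftA (x, t) ^+ 2 * (omega t)%:E))%E.
Proof.
move=> mE E0.
have E0' t : E t -> 0 < t by move=> /E0/=; rewrite in_itv/= andbT.
transitivity (\int[@lebesgue_measure R]_(t in E) (coneA x t ^+ 2 * (omega t)%:E))%E.
  by apply: eq_integral => t; rewrite inE => /E0' t0; exact: square_coneA.
have mo : measurable_fun E (EFin \o omega).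
  by apply/measurable_EFinP; exact: measurable_funTS.
apply: ge0_ae_eq_integral => //.
- apply: emeasurable_funM => //; under eq_fun do rewrite expe2.
  by apply: emeasurable_funM; exact: coneA_measurable.
- apply: emeasurable_funM => //; under eq_fun do rewrite expe2.
  have ml : measurable_fun E (fun t => leftA (x, t)).
    apply: measurable_funTS.
    apply: (measurableT_comp leftA_measurable).
    exact: measurable_pair1.
  by apply: emeasurable_funM.
- by move=> t _; rewrite mule_ge0 ?sqre_ge0// lee_fin.
- by move=> t _; rewrite mule_ge0 ?sqre_ge0// lee_fin.
- pose N := [set t | 0 < t /\ (leftA (x, t) < coneA x t)%E].
  exists N; split.
  + apply: countable_measurable; last exact: leftA_jumps.
    by move=> t; exact: measurable_set1.
  + exact: (countable_lebesgue_measure0 (leftA_jumps x)).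
  + move=> t /= /not_implyP[/E0' t0 ne]; split => //.
    rewrite lt_neqAle leftA_le// andbT; apply/eqP => e; apply: ne.
    by rewrite e.
Qed.

Lemma square_integral_measurable (E : set (measurableTypeR R)) : measurable E ->
  E `<=` `]0, +oo[%classic ->
  measurable_fun [set: lebesgue_rV R n]
    (fun x => \int[@lebesgue_measure R]_(t in E) (A x t ^+ 2 * (t^-1)%:E))%E.
Proof.
move=> mE E0.
pose F (p : lebesgue_rV R n * measurableTypeR R) : \bar R :=
  (leftA p ^+ 2 * (omega p.2 * \1_E p.2)%:E)%E.
have mF : measurable_fun setT F.
  apply: emeasurable_funM.
    under eq_fun do rewrite expe2.
    by apply: emeasurable_funM; exact: leftA_measurable.
  apply/measurable_EFinP; apply: measurable_funM.
    by apply: (measurableT_comp omega_measurable); exact: measurable_snd.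
  exact: (measurableT_comp (measurable_indic mE) measurable_snd).
have F0 p : (0 <= F p)%E.
  by rewrite mule_ge0 ?sqre_ge0// lee_fin mulr_ge0.
have := @measurable_fun_fubini_tonelli_F _ _ _ _ R (@lebesgue_measure R) F mF F0.
rewrite /fubini_F; apply: eq_measurable_fun => x _.
rewrite integral_leftA// [RHS]integral_mkcond; apply: eq_integral => t _.
by rewrite patchE /F/= indicE; case: (_ \in _); rewrite ?mulr1 ?mulr0 ?mule0.
Qed.

Lemma galpha_measurable :
  measurable_fun [set: lebesgue_rV R n] (galpha alpha f).
Proof.
have := square_integral_measurable (measurable_itv `]0, +oo[) (@subset_refl _ _).
move=> mI; apply: (measurableT_comp (measurable_poweR _) mI).
Qed.

End measurability.

(** * From the discrete square function to the continuous one *)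

Section estimates.
Context {R : realType} {n : nat}.
Local Notation leb := (@lebesgueRn R n).
Variables (alpha : R).
Hypotheses (n_gt0 : (0 < n)%N) (alpha_gt0 : 0 < alpha) (alpha_le1 : alpha <= 1).
Implicit Types (o x y z : 'rV[R]_n) (f : 'rV[R]_n -> R).

(** For [t] between [side h m / 2] and [side h m], the ball of radius [t] around
    [x] lies in the ball attached to the cube of [x], with radii in bounded
    ratio. *)
Lemma square_integral_le o h f N x : 0 < h ->
  measurable_fun [set: lebesgue_rV R n] f ->
  (\int[@lebesgue_measure R]_(t in `](h / 2)%R, (side h N / 2)%R])
     (Aalpha alpha f x t ^+ 2 * (t^-1)%:E) <=
   (((2 * n.+1%:R) ^+ n.+1) ^+ 2)%:E * Gsq alpha o h f N x)%E.
Proof.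
move=> h0 mf; set c := (2 * n.+1%:R) ^+ n.+1.
have c0 : 0 <= c by rewrite exprn_ge0// mulr_ge0.
pose phi t := (Aalpha alpha f x t ^+ 2 * (t^-1)%:E)%E.
have phi0 t : 0 < t -> (0 <= phi t)%E.
  by move=> t0; rewrite mule_ge0 ?sqre_ge0// lee_fin invr_ge0 ltW.
have mphi (E : set (measurableTypeR R)) : measurable E ->
    E `<=` `]0, +oo[%classic -> measurable_fun E phi.
  by move=> mE E0; exact: square_measurable.
elim: N => [|N IH].
  rewrite /side expr0 mulr1 set_itvoc0 integral_set0 mule_ge0// ?Gsq_ge0// lee_fin.
  exact: sqr_ge0.
have s0 := side_gt0 N h0.
have hs : h <= side h N by rewrite /side ler_peMr ?exprn_ege1 ?ler1n// ltW.
have -> : `]h / 2, side h N.+1 / 2]%classic =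
    `]h / 2, side h N / 2] `|` `]side h N / 2, side h N.+1 / 2] :> set R.
  apply/seteqP; split => t /=; rewrite !in_itv/= sideS.
    by move=> /andP[h1 h2]; have [] := leP t (side h N / 2) => h3; [left|right]; apply/andP.
  by case=> /andP[h1 h2]; apply/andP; split; lra.
have sub1 : (`]h / 2, side h N / 2]%classic : set R) `<=` `]0, +oo[%classic.
  by move=> t /=; rewrite !in_itv/= => /andP[h1 h2]; rewrite andbT; lra.
have sub2 : (`]side h N / 2, side h N.+1 / 2]%classic : set R) `<=` `]0, +oo[%classic.
  by move=> t /=; rewrite !in_itv/= => /andP[h1 h2]; rewrite andbT; lra.
have m1 : measurable (`]h / 2, side h N / 2]%classic : set (measurableTypeR R)).
  exact: measurable_itv.
have m2 : measurable (`]side h N / 2, side h N.+1 / 2]%classic : set (measurableTypeR R)).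
  exact: measurable_itv.
rewrite (ge0_integral_setU (@lebesgue_measure R) m1 m2); last 3 first.
- by apply: mphi; [exact: measurableU|rewrite subUset].
- by move=> t [/sub1|/sub2]/=; rewrite in_itv/= andbT => /phi0.
- apply/disj_setPS => t /= []; rewrite !in_itv/= => /andP[_ h1] /andP[h2 _].
  by move: (lt_le_trans h2 h1); rewrite ltxx.
rewrite /Gsq big_ord_recr/= -/(Gsq alpha o h f N x) ge0_muleDr; last 2 first.
- exact: Gsq_ge0.
- exact: sqre_ge0.
apply: leeD; first exact: IH.
have ub t : side h N / 2 < t <= side h N ->
    (Aalpha alpha f x t <= c%:E * cellA alpha o h f N x)%E.
  move=> /andP[t1 t2]; have t0 : 0 < t by lra.
  have r0 : 0 < radius n h N by exact: radius_gt0.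
  have := cube_enorm s0 (cube_idx o (side h N) x).
  set y := corner o _ _ => xy.
  have := @Aalpha_mono _ _ alpha alpha_gt0 f y x (radius n h N) t mf t0.
  have n1 : (n.+1%:R : R) = n%:R + 1 by rewrite natr1.
  have -> : enorm (x - y) <= radius n h N - t by move: xy; rewrite /radius n1; lra.
  move=> /(_ isT); have wt0 := Aweight_gt0 (n:=n) alpha t0.
  rewrite -lee_pdivlMl// => /le_trans; apply.
  rewrite muleA -EFinM; apply: lee_wpmul2r; first exact: Aalpha_ge0.
  rewrite lee_fin ler_pdivrMl//.
  have rt : radius n h N <= (2 * n.+1%:R) * t.
    rewrite /radius (_ : 2 * n.+1%:R * t = n.+1%:R * (2 * t)); last by ring.
    by apply: ler_wpM2l => //; lra.
  have r2 : 0 <= 2 * n.+1%:R * t by rewrite !mulr_ge0// ltW.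
  have c1 : 1 <= 2 * n.+1%:R :> R by rewrite -natrM ler1n.
  rewrite /Aweight /c exprSr mulrA.
  rewrite [leRHS](_ : _ = ((2 * n.+1%:R) ^+ n * t ^+ n) * (2 * n.+1%:R * t `^ alpha)); last by ring.
  apply: ler_pM; rewrite ?exprn_ge0 ?powR_ge0 ?(ltW r0)//.
    by rewrite -exprMn; apply: lerXn2r; rewrite ?nnegrE// ltW.
  apply: (@le_trans _ _ ((2 * n.+1%:R * t) `^ alpha)).
    by apply: ge0_ler_powR => //; rewrite ?nnegrE// ltW.
  have -> : (2 * n.+1%:R * t) `^ alpha = (2 * n.+1%:R) `^ alpha * t `^ alpha.
    by apply: powRM; [rewrite mulr_ge0|exact: ltW].
  apply: (ler_wpM2r (powR_ge0 t alpha)).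
  by rewrite -[leRHS]powRr1 ?mulr_ge0//; exact: ler_powR.
have cc0 : (0 <= (c ^+ 2)%:E * cellA alpha o h f N x ^+ 2)%E.
  by rewrite mule_ge0 ?sqre_ge0// lee_fin sqr_ge0.
apply: (@le_trans _ _ (\int[@lebesgue_measure R]_(t in `](side h N / 2)%R, (side h N.+1 / 2)%R])
  (((c ^+ 2)%:E * cellA alpha o h f N x ^+ 2) * (2 / side h N)%:E))%E).
  apply: ge0_le_integral => //.
  - by move=> t /sub2/=; rewrite in_itv/= andbT => /phi0.
  - exact: mphi.
  - move=> t /=; rewrite in_itv/= sideS => /andP[t1 t2].
    have t0 : 0 < t by lra.
    have t3 : side h N / 2 < t <= side h N by apply/andP; split => //; lra.
    have A0 : (0 <= Aalpha alpha f x t)%E by exact: Aalpha_ge0.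
    have ub2 : (Aalpha alpha f x t ^+ 2 <= (c ^+ 2)%:E * cellA alpha o h f N x ^+ 2)%E.
      rewrite !expe2 expr2 EFinM muleACA; apply: lee_pmul => //; exact: ub.
    have ut : ((t^-1)%:E <= (2 / side h N)%:E)%E.
      rewrite lee_fin -[2 / side h N]invrK invf_div lef_pV2 ?posrE ?divr_gt0//.
      exact: ltW.
    apply: lee_pmul => //; first exact: sqre_ge0.
    by rewrite lee_fin invr_ge0 ltW.
have len : lebesgue_measure (`]side h N / 2, side h N.+1 / 2]%classic : set R) =
    (side h N / 2)%:E.
  rewrite lebesgue_measure_itv/= lte_fin sideS ifT; last by lra.
  by rewrite -EFinB; congr (_%:E); lra.
rewrite (integral_cst (@lebesgue_measure R) m2) -muleA.
rewrite [X in (_ * (_ * X))%E](_ : _ = (side h N / 2)%:E); last exact: len.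
by rewrite -EFinM (_ : 2 / side h N * _ = 1) ?mule1//; field; rewrite gt_eqF.
Qed.

Variable (w : 'rV[R]_n -> R).
Hypotheses (weight_w : weight w).
Variable (K : R).
Hypotheses (K_gt0 : 0 < K) (HK : A1_bound w K).

(** The decomposition starts from a cube so large that it contains the support of
    [f] and that the average of [f] on it is below [sigma]; the constant does not
    depend on it. *)
Lemma weak_type : exists2 C : R, 0 < C & forall o h f sigma N (L : R),
  0 < h -> 0 < sigma -> leb.-integrable setT (EFin \o f) ->
  (forall x, f x != 0 -> forall i, o ord0 i <= x ord0 i < o ord0 i + L) ->
  (\int[leb]_x ((w x)%:E *
      (\1_[set z | (((2 * sigma) ^+ 2)%:E < Gsq alpha o h f N z)%E] x)%:E) <=
   (sigma^-1 * C)%:E * \int[leb]_x (`|f x|%:E * (w x)%:E))%E.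
Proof.
have [C C0 HC] := Gsq_weighted n_gt0 alpha_gt0 alpha_le1 weight_w K_gt0 HK.
set q : R := 2^-1 `^ alpha.
have q1 : q < 1 by exact: powR_half_lt1.
exists (C * (2 ^+ n * K * n.+1%:R ^+ n) + K * (4 * n.+1%:R) ^+ n +
      2 * K * 4 ^+ n * (2 * (1 - q)^-1)).
  have qi : 0 < (1 - q)^-1 by rewrite invr_gt0 subr_gt0.
  by rewrite !addr_gt0// !mulr_gt0// ?exprn_gt0// ?mulr_gt0.
move=> o h f sigma N L h0 s0 intf suppf.
pose I := \int[leb]_x `|f x|.
(* A side at least [B] makes the volume at least [I / sigma], because it is
   at least [1]. *)
pose B := Num.max (Num.max 1 L) (I / sigma).
pose M := (Num.trunc (B / h)).+1.
have MB : B <= side h M.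
  rewrite /side mulrC -ler_pdivrMr//; apply: ltW; apply: lt_le_trans (truncnS_gt _) _.
  by rewrite -natrX ler_nat ltnW// ltn_expl.
have s1 : 1 <= side h M by apply: le_trans MB; rewrite !le_max lexx.
have sL : L <= side h M by apply: le_trans MB; rewrite !le_max lexx orbT.
have sI : I / sigma <= side h M by apply: le_trans MB; rewrite !le_max lexx orbT.
have supp x : f x != 0 -> cube o (side h M) 0 x.
  move=> /suppf H; have [_] := cubeP o 0 x (side_gt0 M h0); apply => i.
  by have := H i; rewrite !mxE mulr0 addr0 => /andP[h1 h2]; apply/andP; split; lra.
have mass : \int[leb]_(x in cube o (side h M) 0) `|f x| <= sigma * side h M ^+ n.
  apply: (@le_trans _ _ I).
    have int1 := integrable_norm intf.
    have mc : measurable (cube o (side h M) 0 : set (lebesgue_rV R n)).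
      by apply: cube_leb; exact: side_gt0.
    rewrite -lee_fin /I /Rintegral !fineK; last 2 first.
    - exact: (integrable_fin_num measurableT int1).
    - apply: (integrable_fin_num mc).
      by apply: integrableS int1.
    apply: (ge0_subset_integral leb mc measurableT); [exact: measurable_int int1| |by []].
    by move=> x _; rewrite lee_fin.
  apply: (@le_trans _ _ (sigma * side h M)).
    by rewrite -ler_pdivrMl// mulrC.
  rewrite ler_pM2l//; case: (n) n_gt0 => // n' _.
  by rewrite exprS ler_peMr ?exprn_ege1// ltW// side_gt0.
have H := @weak_type_CZ R n alpha n_gt0 alpha_gt0 alpha_le1 o h M f sigma h0 s0
  intf supp mass w weight_w K K_gt0 HK C N (ltW C0).
apply: H; apply: HC => //.
- exact: good_integrable.
- exact: good_sqr_integrable.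
Qed.

End estimates.

(** * The part of the function far from a ball *)

Lemma sqre_leD (R : realType) (a b c : \bar R) :
  (0 <= a -> 0 <= b -> 0 <= c -> c <= a + b ->
  c ^+ 2 <= 2%:E * a ^+ 2 + 2%:E * b ^+ 2)%E.
Proof.
have top : (2%:E * (+oo * +oo) = +oo :> \bar R)%E by rewrite mulyy gt0_muley// lte_fin.
have np (d : \bar R) : (0 <= d -> 2%:E * (d * d) != -oo)%E.
  by move=> d0; rewrite gt_eqF// (lt_le_trans ltNy0)// !mule_ge0// lee_fin.
rewrite !expe2 => a0 b0; have na := np _ a0; have nb := np _ b0.
case: a a0 na => [a||] //; case: b b0 nb => [b||] // b0 nb a0 na c0 H.
- move: c c0 H => [c||]; rewrite -?EFinD -?EFinM ?lee_fin//.
  move: a0 b0; rewrite -?EFinM -?EFinD ?lee_fin => a0 b0 c0 cab; rewrite ?lee_fin in cab *.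
  have : 0 <= (a + b - c) * (a + b + c) by rewrite mulr_ge0// ?subr_ge0// !addr_ge0.
  by have := sqr_ge0 (a - b); nra.
- by rewrite top addey// leey.
- by rewrite top addye// leey.
- by rewrite top leey.
Qed.

Section far.
Context {R : realType} {n : nat}.
Local Notation leb := (@lebesgueRn R n).
Variables (alpha : R).
Hypotheses (n_gt0 : (0 < n)%N) (alpha_gt0 : 0 < alpha) (alpha_le1 : alpha <= 1).
Variable (w : 'rV[R]_n -> R).
Hypotheses (weight_w : weight w).
Variable (K : R).
Hypotheses (K_gt0 : 0 < K) (HK : A1_bound w K).
Implicit Types (o x y z : 'rV[R]_n) (f : 'rV[R]_n -> R).

(** The double ball contains a ball of radius [s / 2] disjoint from the ball of
    radius [s], and by doubling this smaller ball carries a fixed proportion of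
    the weight. *)
Lemma vol_reverse_doubling : exists2 e : R, 0 < e & forall x s, 0 < s ->
  (1 + e) * vol w x s <= vol w x (2 * s).
Proof.
pose c := K * (4 * n.+1%:R) ^+ n.
have c0 : 0 < c by rewrite mulr_gt0// exprn_gt0// mulr_gt0.
exists c^-1; first by rewrite invr_gt0.
move=> x s s0; have s2 : 0 < 2 * s by rewrite mulr_gt0.
have sh : 0 < s / 2 by rewrite divr_gt0.
pose i0 : 'I_n := Ordinal n_gt0.
pose y := x + (3 / 2 * s) *: delta_mx ord0 i0.
have yx : enorm (y - x) = 3 / 2 * s.
  by rewrite /y addrAC subrr add0r enormZ enorm_delta mulr1 ger0_norm// ltW// mulr_gt0.
have sub1 : eball x s `<=` eball x (2 * s).
  by apply: sub_eball; rewrite enormxx; lra.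
have sub2 : eball y (s / 2) `<=` eball x (2 * s).
  by apply: sub_eball; rewrite yx; lra.
have dis : [disjoint eball x s & eball y (s / 2)].
  apply/disj_setPS => z []; rewrite /eball/= => z1 z2.
  have := ler_enorm_dist y z x; rewrite yx (enormB y z); lra.
have H : vol w x s + vol w y (s / 2) <= vol w x (2 * s).
  rewrite -lee_fin EFinD -!wmeas_eball//.
  have m1 : measurable (eball x s : set (lebesgue_rV R n)) by exact: eball_leb.
  have m2 : measurable (eball y (s / 2) : set (lebesgue_rV R n)) by exact: eball_leb.
  have m3 : measurable (eball x (2 * s) : set (lebesgue_rV R n)) by exact: eball_leb.
  have mw (E : set (lebesgue_rV R n)) : measurable_fun E (EFin \o w).
    by apply: measurable_funTS; apply/measurable_EFinP; exact: weight_measurable.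
  have w0 (E : set (lebesgue_rV R n)) z : E z -> (0 <= (w z)%:E)%E.
    by move=> _; rewrite lee_fin weight_ge0.
  rewrite /wmeas -(ge0_integral_setU leb m1 m2 (mw _) (w0 _) dis).
  apply: (ge0_subset_integral leb (measurableU _ _ m1 m2) m3 (mw _) (w0 _)).
  by rewrite subUset.
have := vol_doubling weight_w K_gt0 HK s2 sh sub2.
have -> : 2 * s / (s / 2) = 4 by field; rewrite gt_eqF.
rewrite (mulrC n.+1%:R) -/c -ler_pdivrMl// => H2.
have := le_vol weight_w s0 s2 sub1.
have : 0 < c^-1 by rewrite invr_gt0.
by move: H H2; set V := vol w x (2 * s); set u := c^-1; nra.
Qed.

Lemma vol_growth e x s i : 0 < e -> 0 < s ->
  (forall s, 0 < s -> (1 + e) * vol w x s <= vol w x (2 * s)) ->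
  (1 + e) ^+ i * vol w x s <= vol w x (2 ^+ i * s).
Proof.
move=> e0 s0 He; elim: i => [|i IH]; first by rewrite !mul1r.
rewrite !exprS -!mulrA; apply: le_trans (He _ _); last by rewrite mulr_gt0// exprn_gt0.
by apply: ler_wpM2l IH; rewrite addr_ge0 ?ltW.
Qed.

Variable (kappa : R).
Hypotheses (kappa_gt0 : 0 < kappa) (kappa_lt1 : kappa < 1).

(** [f] is invisible from [eball x0 r] until [3 * radius n h m] exceeds [r].  From
    that scale on, the growth assumption, [A_1] and reverse doubling bound the
    terms by a geometric progression of ratio [theta], whose first term involves
    the weight of [eball x0 r]. *)
Lemma Gsq_far : exists2 D : R, 0 < D & forall o h f N Fn x0 r x,
  0 < h -> 0 < r -> 0 <= Fn -> measurable_fun [set: lebesgue_rV R n] f ->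
  (forall s, 0 < s -> (\int[leb]_(z in eball x0 s) (`|f z|%:E * (w z)%:E) <=
    (Fn * vol w x0 s `^ kappa)%:E)%E) ->
  (forall z, eball x0 (2 * r) z -> f z = 0) -> eball x0 r x -> 0 < vol w x0 r ->
  (Gsq alpha o h f N x <= ((D * Fn / vol w x0 r `^ (1 - kappa)) ^+ 2)%:E)%E.
Proof.
have [e e0 He] := vol_reverse_doubling.
have b0 : 0 < 1 - kappa by rewrite subr_gt0.
pose T := ((1 + e) `^ (1 - kappa)); pose theta := T^-1.
have T1 : 1 < T.
  have -> : 1 = 1 `^ (1 - kappa) :> R by rewrite powR1.
  by apply: gt0_ltr_powR => //; rewrite ?nnegrE ?addr_ge0 ?ltrDl// ltW.
have th01 : 0 < theta < 1.
  by rewrite invr_gt0 (lt_trans _ T1)//= invf_lt1// (lt_trans _ T1).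
have /andP[th0 th1] := th01.
pose D0 := 3 * K * 6 ^+ n.
have D00 : 0 < D0 by rewrite !mulr_gt0// exprn_gt0.
pose S := 2 * (1 - theta)^-1.
have S0 : 0 < S by rewrite mulr_gt0// invr_gt0 subr_gt0.
exists (D0 * (1 + S)); first by rewrite mulr_gt0// addr_gt0.
move=> o h f N Fn x0 r x h0 r0 Fn0 mf Hf f0 xr.
set v := vol w x0 r => v0.
set B := D0 * Fn / v `^ (1 - kappa).
have vb0 : 0 < v `^ (1 - kappa) by exact: powR_gt0.
have B0 : 0 <= B by rewrite !mulr_ge0 ?invr_ge0// ltW.
have exm : exists m, r < 3 * radius n h m.
  exists (Num.trunc (r / h)).+1; rewrite /radius /side.
  apply: (@lt_le_trans _ _ (h * (Num.trunc (r / h)).+1%:R)).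
    by rewrite mulrC -ltr_pdivrMr//; exact: truncnS_gt.
  rewrite mulrA mulrCA; apply: ler_wpM2l; first exact: ltW.
  rewrite -!natrM -natrX -natrM ler_nat.
  by rewrite (leq_trans (ltnW (ltn_expl _ (ltnSn 1))))// leq_pmull.
have [m0 m0P m0min] := ex_minnP exm.
have cellf m : (cellA alpha o h f m x <= (B * theta ^+ (m0 - m + (m - m0)))%:E)%E.
  have rm : 0 < radius n h m by exact: radius_gt0.
  have := cube_enorm (side_gt0 m h0) (cube_idx o (side h m) x).
  rewrite /cellA; set c := corner _ _ _ => xc.
  have xc' : enorm (x - c) < radius n h m.
    by apply: le_lt_trans xc _; rewrite /radius ltr_pM2r ?side_gt0// ltr_nat.
  have cx0 : enorm (c - x0) < radius n h m + r.
    apply: le_lt_trans (ler_enorm_dist c x x0) _.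
    by move: xr; rewrite /eball/= (enormB c x); lra.
  have [rr|rr] := leP (3 * radius n h m) r.
    rewrite Aalpha_eq0//; last first.
      by move=> z cz; apply: f0; move: cz; apply: sub_eball; lra.
    by rewrite lee_fin; apply: mulr_ge0 => //; rewrite exprn_ge0// ltW.
  have mm0 : (m0 <= m)%N by exact: m0min.
  have -> : (m0 - m = 0)%N by apply/eqP; rewrite subn_eq0.
  rewrite add0n.
  set s := 6 * radius n h m; have s0 : 0 < s by rewrite mulr_gt0.
  have sub : eball c (2 * radius n h m) `<=` eball x0 s.
    by apply: sub_eball; rewrite /s; lra.
  have mB : measurable (eball x0 s : set (lebesgue_rV R n)) by exact: eball_leb.
  have mc : measurable (eball c (2 * radius n h m) : set (lebesgue_rV R n)).
    exact: eball_leb.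
  have mnf (E : set (lebesgue_rV R n)) : measurable_fun E (fun z => (`|f z|)%:E).
    apply: measurable_funTS; apply/measurable_EFinP.
    exact: (measurableT_comp _ mf).
  have V1 : (1 + e) ^+ (m - m0) * v <= vol w x0 s.
    pose s' := 6 * radius n h m0.
    have s'0 : 0 < s' by rewrite mulr_gt0// radius_gt0.
    have -> : s = 2 ^+ (m - m0) * s'.
      rewrite /s /s' /radius /side -[in LHS](subnK mm0) exprD; ring.
    apply: le_trans (vol_growth (m - m0) e0 s'0 (He x0)).
    rewrite ler_pM2l ?exprn_gt0 ?addr_gt0//.
    apply: le_vol => //; apply: sub_eball.
    by rewrite enormxx /s'; lra.
  set V := vol w x0 s in V1.
  have V0 : 0 < V by apply: lt_le_trans V1; rewrite mulr_gt0// exprn_gt0 ?addr_gt0.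
  have Vth : V `^ kappa / V <= theta ^+ (m - m0) / v `^ (1 - kappa).
    have -> : V `^ kappa / V = (V `^ (1 - kappa))^-1.
      rewrite powRB ?gt_eqF ?implybT// powRr1 ?(ltW V0)// invf_div//.
    have T0 : 0 < T by exact: lt_trans T1.
    have TB : 0 < T ^+ (m - m0) * v `^ (1 - kappa) by rewrite mulr_gt0// exprn_gt0.
    have VB : 0 < V `^ (1 - kappa) by exact: powR_gt0.
    have -> : theta ^+ (m - m0) / v `^ (1 - kappa) = (T ^+ (m - m0) * v `^ (1 - kappa))^-1.
      by rewrite invfM -exprVn.
    rewrite (_ : ((V `^ (1 - kappa))^-1 <= _) =
       (T ^+ (m - m0) * v `^ (1 - kappa) <= V `^ (1 - kappa))); last first.
      by apply: lef_pV2; rewrite posrE.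
    have -> : T ^+ (m - m0) * v `^ (1 - kappa) = ((1 + e) ^+ (m - m0) * v) `^ (1 - kappa).
      rewrite powRM ?exprn_ge0 ?addr_ge0 ?(ltW e0) ?(ltW v0)//.
      congr (_ * _); have e1 : 0 <= 1 + e by rewrite addr_ge0// ltW.
      by rewrite -(powR_mulrn _ (ltW T0)) /T -(powR_mulrn _ e1) -!powRrM mulrC.
    apply: ge0_ler_powR => //; rewrite ?nnegrE ?(ltW V0)// ?(ltW b0)//.
    by rewrite mulr_ge0 ?exprn_ge0 ?addr_ge0 ?(ltW e0)// ltW.
  apply: le_trans (Aalpha_le n_gt0 alpha_gt0 alpha_le1 _ mf rm) _.
  have I1 : (\int[leb]_(z in eball c (2 * radius n h m)) `|f z|%:E <=
             \int[leb]_(z in eball x0 s) `|f z|%:E)%E.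
    by apply: (ge0_subset_integral leb mc mB (mnf _) _ sub) => z _; rewrite lee_fin.
  have I2 := A1_integral weight_w K_gt0 HK s0 mB (@subset_refl _ _) (mnf _)
     (fun z => ltac:(by rewrite lee_fin)).
  rewrite -/V -lee_pdivlMl// in I2.
  have I3 : (\int[leb]_(z in eball x0 s) `|f z|%:E <=
     (K * s ^+ n * (Fn * (V `^ kappa / V)))%:E)%E.
    apply: le_trans I2 _.
    apply: (@le_trans _ _ ((V^-1)%:E * ((K * s ^+ n)%:E * (Fn * V `^ kappa)%:E)))%E.
      apply: lee_wpmul2l; first by rewrite lee_fin invr_ge0 ltW.
      apply: lee_wpmul2l; last exact: Hf.
      by rewrite lee_fin mulr_ge0 ?exprn_ge0// ltW.
    by rewrite -!EFinM lee_fin le_eqVlt; apply/orP; left; apply/eqP; field; rewrite gt_eqF.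
  have rn0 : 0 < radius n h m ^+ n by rewrite exprn_gt0.
  apply: (@le_trans _ _ ((3 * radius n h m ^- n)%:E *
      (K * s ^+ n * (Fn * (V `^ kappa / V)))%:E)%E).
    apply: lee_wpmul2l; first by rewrite lee_fin mulr_ge0// invr_ge0 ltW.
    exact: le_trans I3.
  rewrite -EFinM lee_fin /s (exprMn n 6).
  rewrite [leLHS](_ : _ = D0 * Fn * (V `^ kappa / V)); last first.
    rewrite /D0; move: rn0; move: (radius n h m ^+ n) (6 ^+ n) => a b' a0.
    by field; rewrite !gt_eqF.
  rewrite (_ : B * theta ^+ (m - m0) = D0 * Fn * (theta ^+ (m - m0) / v `^ (1 - kappa))).
    by apply: ler_wpM2l Vth; rewrite mulr_ge0// ltW.
  by rewrite /B [RHS]mulrA mulrAC.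
apply: (@le_trans _ _ (\sum_(m < N) ((B * theta ^+ (m0 - m + (m - m0))) ^+ 2)%:E)%E).
  apply: lee_sum => m _; rewrite expr2 EFinM -expe2.
  have := cellf m; have := cellA_ge0 alpha_gt0 o f m x h0.
  by rewrite !expe2 => c0 cm; apply: lee_pmul.
rewrite sumEFin lee_fin.
apply: (@le_trans _ _ (B ^+ 2 * S)).
  under eq_bigr do rewrite exprMn.
  rewrite -mulr_sumr; apply: ler_wpM2l; first exact: sqr_ge0.
  apply: le_trans (geo_dist_sum_le m0 N th01).
  apply: ler_sum => m _; rewrite expr2 ler_piMl ?exprn_ge0 ?exprn_ile1 ?(ltW th0) ?(ltW th1)//.
(* The factor [1 + S] avoids a square root, as [S <= (1 + S) ^+ 2]. *)
rewrite (_ : D0 * (1 + S) * Fn / _ = B * (1 + S)); last by rewrite /B; ring.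
rewrite [leRHS](exprMn 2 B); apply: ler_wpM2l; first exact: sqr_ge0.
by move: S0; clearbody S; nra.
Qed.

Lemma Gsq_split o h f g N x : 0 < h ->
  locally_integrable_rV f -> locally_integrable_rV g ->
  (Gsq alpha o h (f \+ g)%R N x <= 2%:E * Gsq alpha o h f N x + 2%:E * Gsq alpha o h g N x)%E.
Proof.
move=> h0 lf lg; rewrite /Gsq.
rewrite !ge0_sume_distrr; try by move=> m _; exact: sqre_ge0.
rewrite -big_split/=; apply: lee_sum => m _.
have rm : 0 < radius n h m by exact: radius_gt0.
have rm2 : 0 < 2 * radius n h m by rewrite mulr_gt0.
apply: sqre_leD; try exact: cellA_ge0.
exact: (AalphaD n_gt0 alpha_gt0 alpha_le1 rm (lf _ (eball_balls _ rm2))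
  (lg _ (eball_balls _ rm2))).
Qed.

End far.

(** * Level sets in a fixed ball *)

Section assembly.
Context {R : realType} {n : nat}.
Local Notation leb := (@lebesgueRn R n).
Variables (alpha : R).
Hypotheses (n_gt0 : (0 < n)%N) (alpha_gt0 : 0 < alpha) (alpha_le1 : alpha <= 1).
Variable (w : 'rV[R]_n -> R).
Hypotheses (weight_w : weight w).
Variable (K : R).
Hypotheses (K_gt0 : 0 < K) (HK : A1_bound w K).
Implicit Types (o x y z : 'rV[R]_n) (f : 'rV[R]_n -> R).
Variable (kappa : R).
Hypotheses (kappa_gt0 : 0 < kappa) (kappa_lt1 : kappa < 1).

Lemma wmeas_le (S T : set 'rV[R]_n) :
  measurable (S : set (lebesgue_rV R n)) -> measurable (T : set (lebesgue_rV R n)) ->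
  S `<=` T -> (wmeas w S <= wmeas w T)%E.
Proof.
move=> mS mT ST; apply: (ge0_subset_integral leb mS mT _ _ ST).
  by apply: measurable_funTS; apply/measurable_EFinP; exact: weight_measurable.
by move=> z _; rewrite lee_fin (weight_ge0 weight_w).
Qed.

(** The far part contributes at most [u] to the square root of [Gsq] on the ball.
    If [sigma] is at most a multiple of [u], the trivial bound of the level set
    by the ball suffices; otherwise the local part must exceed a multiple of
    [sigma], and the weak type inequality applies to it. *)
Lemma truncated_level_le : exists2 C : R, 0 < C & forall f Fn h N x0 r sigma,
  0 < h -> 0 < r -> 0 < sigma -> 0 <= Fn -> locally_integrable_rV f ->
  (forall s, 0 < s -> (\int[leb]_(z in eball x0 s) (`|f z|%:E * (w z)%:E) <=
    (Fn * vol w x0 s `^ kappa)%:E)%E) ->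
  0 < vol w x0 r ->
  (sigma%:E * wmeas w [set x | eball x0 r x /\ ((sigma ^+ 2)%:E <
     \int[@lebesgue_measure R]_(t in `](h / 2)%R, (side h N / 2)%R])
       (Aalpha alpha f x t ^+ 2 * (t^-1)%:E))%E] <=
   (C * Fn * vol w x0 r `^ kappa)%:E)%E.
Proof.
have [C1 C10 HC1] := weak_type n_gt0 alpha_gt0 alpha_le1 weight_w K_gt0 HK.
have [D D0 HD] := Gsq_far n_gt0 alpha_gt0 alpha_le1 weight_w K_gt0 HK kappa_lt1.
pose k0 : R := (2 * n.+1%:R) ^+ n.+1.
have k00 : 0 < k0 by rewrite exprn_gt0// mulr_gt0.
pose Kd := K * (n.+1%:R * 2) ^+ n.
have Kd0 : 0 < Kd by rewrite mulr_gt0// exprn_gt0// mulr_gt0.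
exists (4 * k0 * C1 * (1 + Kd) + 2 * k0 * D).
  by rewrite addr_gt0 ?mulr_gt0// addr_gt0.
move=> f Fn h N x0 r sigma h0 r0 s0 Fn0 lf Hf.
set v := vol w x0 r => v0; set S := [set x | _ /\ _].
have mf := locally_integrable_measurable lf.
have vk0 : 0 < v `^ kappa by exact: powR_gt0.
have vb0 : 0 < v `^ (1 - kappa) by exact: powR_gt0.
have vE : v / v `^ (1 - kappa) = v `^ kappa.
  rewrite -[X in X / _](powRr1 (ltW v0)) -powRB ?(gt_eqF v0) ?implybT//.
  by congr (_ `^ _); ring.
have mB : measurable (eball x0 r : set (lebesgue_rV R n)) by exact: eball_leb.
have mS : measurable (S : set (lebesgue_rV R n)).
  have := square_integral_measurable alpha_gt0 mf (E := `](h / 2)%R, (side h N / 2)%R]%classic)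
    (measurable_itv _).
  have E0 : (`](h / 2)%R, (side h N / 2)%R]%classic : set R) `<=` `]0, +oo[%classic.
    move=> t /=; rewrite !in_itv/= => /andP[h1 h2]; rewrite andbT.
    by apply: lt_trans h1; rewrite divr_gt0.
  move=> /(_ E0) mI.
  have := emeasurable_fun_o_infty measurableT mI (sigma ^+ 2)%:E.
  rewrite setTI => mI'.
  rewrite [S](_ : _ = eball x0 r `&` [set x | ((sigma ^+ 2)%:E <
     \int[@lebesgue_measure R]_(t in `](h / 2)%R, (side h N / 2)%R])
       (Aalpha alpha f x t ^+ 2 * (t^-1)%:E))%E])//.
  exact: measurableI.
set u := D * Fn / v `^ (1 - kappa).
have u0 : 0 <= u by rewrite !mulr_ge0 ?invr_ge0// ltW.
have [su|us] := leP sigma (2 * k0 * u).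
  apply: (@le_trans _ _ (sigma%:E * v%:E)%E).
    apply: lee_wpmul2l; first by rewrite lee_fin ltW.
    by rewrite /v -wmeas_eball//; apply: wmeas_le => // x [].
  rewrite -EFinM lee_fin; apply: (@le_trans _ _ (2 * k0 * u * v)).
    by apply: ler_wpM2r => //; exact: ltW.
  rewrite (_ : 2 * k0 * u * v = 2 * k0 * D * Fn * (v / v `^ (1 - kappa))); last first.
    by rewrite /u; ring.
  rewrite vE -!(mulrA _ Fn); apply: ler_wpM2r; first by rewrite mulr_ge0// ltW.
  by rewrite lerDr !mulr_ge0 ?addr_ge0// ltW.
have r2 : 0 < 2 * r by rewrite mulr_gt0.
have m2 : measurable (eball x0 (2 * r) : set (lebesgue_rV R n)) by exact: eball_leb.
pose f1 z := f z * \1_(eball x0 (2 * r)) z.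
pose f2 z := f z - f1 z.
have intf1 : leb.-integrable setT (EFin \o f1).
  have := lf _ (eball_balls x0 r2); rewrite integrable_mkcond//.
  apply: eq_integrable => // z _; rewrite patchE /f1/= indicE.
  by case: (_ \in _); rewrite ?mulr1 ?mulr0.
have lf1 : locally_integrable_rV f1.
  by move=> B [y [s [ss ->]]]; apply: integrableS intf1 => //; exact: eball_leb.
have lf2 : locally_integrable_rV f2.
  move=> B bB; have [y [s [ss BE]]] := bB.
  have mB' : measurable (B : set (lebesgue_rV R n)) by rewrite BE; exact: eball_leb.
  rewrite (_ : EFin \o f2 = (EFin \o f) \- (EFin \o f1))%E//.
  by apply: integrableB => //; [exact: lf|exact: lf1].
have fE : f = f1 \+ f2 by apply/funext => z; rewrite /= /f2; ring.
have f2le z : `|f2 z| <= `|f z|.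
  rewrite /f2 /f1 indicE; case: (_ \in _); rewrite ?mulr1 ?mulr0 ?subrr ?subr0 ?normr0//.
have mw (E : set (lebesgue_rV R n)) : measurable_fun E (EFin \o w).
  by apply: measurable_funTS; apply/measurable_EFinP; exact: weight_measurable.
have mn (g : 'rV[R]_n -> R) (E : set (lebesgue_rV R n)) : measurable_fun [set: lebesgue_rV R n] g ->
    measurable_fun E (fun z => `|g z|%:E * (w z)%:E)%E.
  move=> mg; apply: emeasurable_funM; last exact: mw.
  by apply: measurable_funTS; apply/measurable_EFinP; exact: (measurableT_comp _ mg).
have mf1 := locally_integrable_measurable lf1.
have mf2 := locally_integrable_measurable lf2.
(* With this origin the first cube of side [4 * r] contains the double ball. *)
pose o : 'rV[R]_n := x0 - const_mx (2 * r).
have supp1 x : f1 x != 0 -> forall i, o ord0 i <= x ord0 i < o ord0 i + 4 * r.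
  rewrite /f1 indicE; have [zB _ i|_] := boolP (_ \in _); last by rewrite mulr0 eqxx.
have := coord_le_enorm (x - x0) i; rewrite inE /eball/= in zB.
  move=> /le_lt_trans /(_ zB); rewrite !mxE ltr_norml => /andP[h1 h2].
  by apply/andP; split; lra.
have supp2 z : eball x0 (2 * r) z -> f2 z = 0.
  by move=> zB; rewrite /f2 /f1 indicE mem_set// mulr1 subrr.
have Hf2 s : 0 < s -> (\int[leb]_(z in eball x0 s) (`|f2 z|%:E * (w z)%:E) <=
    (Fn * vol w x0 s `^ kappa)%:E)%E.
  move=> ss; apply: le_trans (Hf s ss).
  have mE : measurable (eball x0 s : set (lebesgue_rV R n)) by exact: eball_leb.
  apply: (ge0_le_integral leb mE _ (mn _ _ mf2) (mn _ _ mf)) => z _.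
    by rewrite mule_ge0// lee_fin ?(weight_ge0 weight_w).
  by rewrite -!EFinM lee_fin ler_wpM2r// (weight_ge0 weight_w).
(* [2 * tau] is the level left to the local part: [Gsq] of the sum is at most
   twice the sum of both, multiplied by [k0 ^+ 2], and half of [sigma ^+ 2] is
   reserved for the far part. *)
pose tau := sigma / (4 * k0).
have tau0 : 0 < tau by rewrite divr_gt0// mulr_gt0.
set T := [set z | (((2 * tau) ^+ 2)%:E < Gsq alpha o h f1 N z)%E].
have mT : measurable (T : set (lebesgue_rV R n)).
  have := emeasurable_fun_o_infty measurableT (Gsq_measurable alpha o f1 N h0)
    ((2 * tau) ^+ 2)%:E.
  by rewrite setTI.
have ST : S `<=` T.
  move=> x [xB Ix]; rewrite /T/=.
  have G2 := HD o h f2 N Fn x0 r x h0 r0 Fn0 mf2 Hf2 supp2 xB v0.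
  have G12 := Gsq_split n_gt0 alpha_gt0 alpha_le1 o N x h0 lf1 lf2.
  rewrite -fE in G12.
  have := lt_le_trans Ix (square_integral_le alpha_gt0 alpha_le1 o N x h0 mf).
  rewrite -/k0 => I1.
  rewrite ltNge; apply/negP => G1.
  have : ((sigma ^+ 2)%:E < (k0 ^+ 2 * (2 * (2 * tau) ^+ 2 + 2 * u ^+ 2))%:E)%E.
    rewrite (EFinM (k0 ^+ 2)) EFinD (EFinM _ (u ^+ 2)) (EFinM _ ((2 * tau) ^+ 2)).
    apply: (lt_le_trans I1); apply: lee_wpmul2l; first by rewrite lee_fin sqr_ge0.
    apply: le_trans G12 _; apply: leeD; apply: lee_wpmul2l => //; rewrite lee_fin//.
  rewrite lte_fin.
  rewrite (_ : k0 ^+ 2 * _ = sigma ^+ 2 / 2 + (2 * k0 * u) ^+ 2 / 2); last first.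
    by rewrite /tau; field; rewrite gt_eqF.
  have : (2 * k0 * u) ^+ 2 < sigma ^+ 2.
    have ku0 : 0 <= 2 * k0 * u.
      exact: (mulr_ge0 (mulr_ge0 (ler0n _ 2) (ltW k00)) u0).
    by rewrite ltr_pXn2r ?nnegrE ?ku0 ?(ltW s0).
  lra.
have v2 : vol w x0 (2 * r) <= Kd * v.
  have := @vol_doubling R n w weight_w K K_gt0 HK x0 x0 (2 * r) r r2 r0.
  rewrite (_ : 2 * r / r = 2); last by field; rewrite gt_eqF.
  apply; apply: sub_eball.
  by rewrite enormxx; lra.
have v2k : vol w x0 (2 * r) `^ kappa <= (1 + Kd) * v `^ kappa.
  apply: (@le_trans _ _ (((1 + Kd) * v) `^ kappa)).
    apply: ge0_ler_powR; rewrite ?nnegrE ?vol_ge0 ?mulr_ge0 ?addr_ge0 ?ltW//.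
    by apply: (le_lt_trans v2); rewrite ltr_pM2r// ltrDr.
  rewrite powRM ?addr_ge0 ?(ltW Kd0) ?(ltW v0)//.
  apply: (ler_wpM2r (ltW vk0)).
  rewrite -[leRHS]powRr1 ?addr_ge0 ?(ltW Kd0)//.
  by apply: ler_powR; [rewrite lerDl ltW|exact: ltW].
apply: (@le_trans _ _ (sigma%:E * ((tau^-1 * C1)%:E * (Fn * vol w x0 (2 * r) `^ kappa)%:E))%E).
  apply: lee_wpmul2l; first by rewrite lee_fin ltW.
  apply: (@le_trans _ _ (wmeas w T)); first exact: wmeas_le.
  have -> : wmeas w T = (\int[leb]_x ((w x)%:E * (\1_T x)%:E))%E.
    rewrite /wmeas integral_mkcond; apply: eq_integral => z _.
    by rewrite patchE indicE; case: (_ \in _); rewrite ?mule1 ?mule0.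
  apply: le_trans (HC1 o h f1 tau N (4 * r) h0 tau0 intf1 supp1) _.
  apply: lee_wpmul2l; first by rewrite lee_fin mulr_ge0 ?invr_ge0// ltW.
  apply: le_trans (Hf _ r2); rewrite [leRHS]integral_mkcond.
  rewrite le_eqVlt; apply/orP; left; apply/eqP; apply: eq_integral => z _.
  rewrite patchE /f1 indicE; case: (_ \in _); rewrite ?mulr1// mulr0 normr0 mul0e//.
rewrite -!EFinM lee_fin.
rewrite (_ : sigma * _ = 4 * k0 * C1 * Fn * vol w x0 (2 * r) `^ kappa); last first.
  by rewrite /tau; field; rewrite !gt_eqF.
apply: (@le_trans _ _ (4 * k0 * C1 * Fn * ((1 + Kd) * v `^ kappa))).
  by apply: ler_wpM2l v2k; rewrite !mulr_ge0// ltW.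
rewrite (_ : 4 * k0 * C1 * Fn * _ = 4 * k0 * C1 * (1 + Kd) * (Fn * v `^ kappa)); last by ring.
rewrite -(mulrA _ Fn); apply: ler_wpM2r; first by rewrite mulr_ge0// ltW.
by rewrite lerDl !mulr_ge0// ltW.
Qed.

(** Monotone convergence: the truncated integrals increase to the whole one, so
    that the truncated level sets increase to the level set. *)
Lemma morrey_level_le : exists2 C : R, 0 < C & forall f Fn x0 r sigma,
  0 < r -> 0 < sigma -> 0 <= Fn -> locally_integrable_rV f ->
  (forall s, 0 < s -> (\int[leb]_(z in eball x0 s) (`|f z|%:E * (w z)%:E) <=
    (Fn * vol w x0 s `^ kappa)%:E)%E) ->
  0 < vol w x0 r ->
  (sigma%:E * wmeas w [set x | eball x0 r x /\ (sigma%:E < `|galpha alpha f x|)%E] <=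
   (C * Fn * vol w x0 r `^ kappa)%:E)%E.
Proof.
have [C C0 HC] := truncated_level_le; exists C => //.
move=> f Fn x0 r sigma r0 s0 Fn0 lf Hf v0.
have mf := locally_integrable_measurable lf.
(* The truncations to [2 ^- k / 2 < t <= 2 ^+ k] exhaust the half line. *)
pose h k : R := 2 ^- k.
have h0 k : 0 < h k by rewrite invr_gt0 exprn_gt0.
pose E k : set R := `](h k / 2), (side (h k) (2 * k).+1 / 2)]%classic.
have sE k : side (h k) (2 * k).+1 / 2 = 2 ^+ k.
  rewrite /side /h exprS mul2n -addnn exprD; field.
  by rewrite expf_neq0.
have E0 k : E k `<=` `]0, +oo[%classic.
  move=> t /=; rewrite !in_itv/= => /andP[h1 h2]; rewrite andbT.
  by apply: lt_trans h1; rewrite divr_gt0.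
have mE k : measurable (E k : set (measurableTypeR R)) by exact: measurable_itv.
have ndE : {homo E : i j / (i <= j)%N >-> (i <= j)%O}.
  move=> i j ij; apply/subsetPset => t; rewrite /E/= !in_itv/= !sE => /andP[h1 h2].
  apply/andP; split.
    apply: le_lt_trans h1; rewrite ler_pM2r// /h lef_pV2 ?posrE ?exprn_gt0//.
    by rewrite ler_weXn2l// ler1n.
  by apply: (le_trans h2); rewrite ler_weXn2l// ler1n.
have UE : \bigcup_k E k = `]0, +oo[%classic.
  apply/seteqP; split => t; first by move=> [k _ /E0].
  rewrite /= in_itv/= andbT => t0.
  pose k := (Num.trunc t + Num.trunc t^-1).+1.
  have pk (s : R) (j : nat) : s < j%:R -> (j <= k)%N -> s < 2 ^+ k.
    move=> sj jk; apply: (lt_le_trans sj); rewrite -natrX ler_nat.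
    by rewrite (leq_trans jk)// ltnW// ltn_expl.
  exists k => //; rewrite /E/= in_itv/= sE; apply/andP; split; last first.
    by apply/ltW/(pk _ _ (truncnS_gt t)); rewrite /k ltnS leq_addr.
  have tk : t^-1 < 2 ^+ k.
    by apply: (pk _ _ (truncnS_gt t^-1)); rewrite /k ltnS leq_addl.
  have : h k < t by rewrite /h -[ltRHS]invrK ltf_pV2 ?posrE ?invr_gt0 ?exprn_gt0.
  by have := h0 k; lra.
pose phi x t := (Aalpha alpha f x t ^+ 2 * (t^-1)%:E)%E.
have phi0 x (t : measurableTypeR R) : `]0%R, +oo[%classic t -> (0 <= phi x t)%E.
  rewrite /= in_itv/= andbT => t0.
  by rewrite mule_ge0 ?sqre_ge0// lee_fin invr_ge0 ltW.
have mphi x (F : set (measurableTypeR R)) : measurable F -> F `<=` `]0, +oo[%classic ->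
    measurable_fun F (phi x).
  by move=> mF F0; exact: square_measurable.
pose I k x := (\int[@lebesgue_measure R]_(t in E k) phi x t)%E.
pose S k := [set x | eball x0 r x /\ ((sigma ^+ 2)%:E < I k x)%E].
have ndI i j x : (i <= j)%N -> (I i x <= I j x)%E.
  move=> ij; apply: (ge0_subset_integral _ (mE i) (mE j)).
  - by apply: mphi; [exact: mE|exact: E0].
  - by move=> t /E0; exact: phi0.
  - by apply/subsetPset; exact: ndE.
have mB : measurable (eball x0 r : set (lebesgue_rV R n)) by exact: eball_leb.
have mS k : measurable (S k : set (lebesgue_rV R n)).
  have := square_integral_measurable alpha_gt0 mf (mE k) (E0 k) => mI.
  have := emeasurable_fun_o_infty measurableT mI (sigma ^+ 2)%:E.
  rewrite setTI => mI'.
  have -> : S k = eball x0 r `&` [set x | ((sigma ^+ 2)%:E < I k x)%E] by [].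
  exact: measurableI.
have US : [set x | eball x0 r x /\ (sigma%:E < `|galpha alpha f x|)%E] = \bigcup_k S k.
  have gE x : galpha alpha f x =
      sqrte (\int[@lebesgue_measure R]_(t in `]0%R, +oo[) phi x t).
    rewrite /galpha poweR12_sqrt//; apply: integral_ge0 => t; exact: phi0.
  have sqrtP (y : \bar R) : (0 <= y)%E -> (sigma%:E < sqrte y)%E = ((sigma ^+ 2)%:E < y)%E.
    case: y => [y| |]// y0; rewrite /= ?lte_fin ?ltry//; rewrite lee_fin in y0.
    by rewrite -[in RHS](sqr_sqrtr y0) ltr_pXn2r ?nnegrE ?sqrtr_ge0// ltW.
  have cvI x : I k x @[k --> \oo] --> (\int[@lebesgue_measure R]_(t in `]0%R, +oo[) phi x t)%E.
    rewrite -UE; apply: (@ge0_nondecreasing_set_cvg_integral _ (measurableTypeR R) _ E (phi x) (@lebesgue_measure R) ndE mE).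
      by move=> k; apply: mphi; [exact: mE|exact: E0].
    by move=> k t /E0; exact: phi0.
  have I0 x : (0 <= \int[@lebesgue_measure R]_(t in `]0%R, +oo[) phi x t)%E.
    by apply: integral_ge0 => t; exact: phi0.
  apply/seteqP; split => x /=.
    move=> [xB]; rewrite gE gee0_abs ?sqrte_ge0// sqrtP// => H.
    apply: contrapT => nS; move: H; apply/negP; rewrite -leNgt.
    rewrite -(cvg_lim (@ereal_hausdorff R) (cvI x)).
    apply: lime_le; first by apply/cvg_ex; eexists; exact: cvI.
    by apply: nearW => k; rewrite leNgt; apply/negP => Ik; apply: nS; exists k.
  move=> [k _ [xB Ik]]; split => //; rewrite gE gee0_abs ?sqrte_ge0// sqrtP//.
  apply: (lt_le_trans Ik); apply: (ge0_subset_integral _ (mE k) (measurable_itv _)).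
  - by apply: mphi => //; exact: measurable_itv.
  - by move=> t; exact: phi0.
  - exact: E0.
rewrite US.
have ndS : {homo S : i j / (i <= j)%N >-> (i <= j)%O}.
  move=> i j ij; apply/subsetPset => x [xB Ix]; split => //.
  by apply: (lt_le_trans Ix); exact: ndI.
have cvS : wmeas w (S k) @[k --> \oo] --> wmeas w (\bigcup_k S k).
  apply: (@ge0_nondecreasing_set_cvg_integral _ (lebesgue_rV R n) _ S (EFin \o w) leb ndS mS).
    move=> k; apply: measurable_funTS; apply/measurable_EFinP.
    exact: weight_measurable.
  by move=> k x _; rewrite lee_fin (weight_ge0 weight_w).
have HS k : (wmeas w (S k) <= (sigma^-1 * (C * Fn * vol w x0 r `^ kappa))%:E)%E.
  have := HC f Fn (h k) (2 * k).+1 x0 r sigma (h0 k) r0 s0 Fn0 lf Hf v0.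
  by rewrite -lee_pdivlMl// -EFinM.
rewrite -lee_pdivlMl// -EFinM.
rewrite -(cvg_lim (@ereal_hausdorff R) cvS).
apply: lime_le; first by apply/cvg_ex; eexists; exact: cvS.
by apply: nearW => k; exact: HS.
Qed.

End assembly.

(** * Morrey norms *)

Section norms.
Context {R : realType} {n : nat}.
Local Notation leb := (@lebesgueRn R n).
Variable (w : 'rV[R]_n -> R).
Hypotheses (weight_w : weight w).
Implicit Types (f : 'rV[R]_n -> R) (h : 'rV[R]_n -> \bar R).

(** Doubling in a third ball, which contains both. *)
Lemma vol_eq0 (K : R) x y r s : 0 < K -> A1_bound w K ->
  0 < r -> 0 < s -> vol w x r = 0 -> vol w y s = 0.
Proof.
move=> K0 HK r0 s0 v0; pose t := r + enorm (y - x) + s.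
have e0 := enorm_ge0 (y - x).
have t0 : 0 < t by rewrite /t; lra.
have rt : eball x r `<=` eball x t.
  by apply: sub_eball; rewrite enormxx /t; lra.
have st : eball y s `<=` eball x t by apply: sub_eball; rewrite /t; lra.
have := vol_doubling weight_w K0 HK t0 r0 rt; rewrite v0 mulr0 => H.
apply/eqP; rewrite eq_le vol_ge0// andbT.
exact: le_trans (le_vol weight_w s0 t0 st) H.
Qed.

Lemma morrey_norm_ge0 kappa f : (0 <= morrey_norm kappa w f)%E.
Proof.
apply: le_ereal_sup_tmp; eexists; first by exists (eball 0 1); [exact: eball_balls|reflexivity].
rewrite mule_ge0 ?inve_ge0 ?poweR_ge0//; apply: integral_ge0 => z _.
by rewrite lee_fin mulr_ge0// (weight_ge0 weight_w).
Qed.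

Lemma morrey_norm_le kappa f x r : 0 < r -> 0 < vol w x r ->
  (morrey_norm kappa w f < +oo)%E ->
  (\int[leb]_(z in eball x r) (`|f z|%:E * (w z)%:E) <=
    (fine (morrey_norm kappa w f) * vol w x r `^ kappa)%:E)%E.
Proof.
move=> r0 v0 foo.
have F0 := morrey_norm_ge0 kappa f.
have Fin : morrey_norm kappa w f \is a fin_num by rewrite ge0_fin_numE.
have vk0 : 0 < vol w x r `^ kappa by exact: powR_gt0.
rewrite EFinM fineK// muleC -lee_pdivrMl//.
apply: ereal_sup_ubound; exists (eball x r); first exact: eball_balls.
by rewrite wmeas_eball// poweR_EFin inver gt_eqF//.
Qed.

(** On each ball [w] is almost everywhere at least a positive constant. *)
Lemma morrey_locally_integrable (K : R) kappa f : 0 < K -> A1_bound w K ->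
  (forall x r, 0 < r -> 0 < vol w x r) -> morrey kappa w f ->
  locally_integrable_rV f.
Proof.
move=> K0 HK v0 [[mf _] foo] B [x [r [r0 ->]]].
have mB : measurable (eball x r : set (lebesgue_rV R n)) by exact: eball_leb.
have mnf : measurable_fun (eball x r : set (lebesgue_rV R n)) (fun z => (`|f z|)%:E).
  by apply: measurable_funTS; apply/measurable_EFinP; exact: (measurableT_comp _ mf).
have nf0 (z : 'rV[R]_n) : (0 <= `|f z|%:E)%E by rewrite lee_fin.
apply/integrableP; split; first by apply: measurable_funTS; apply/measurable_EFinP.
have := A1_integral weight_w K0 HK r0 mB (@subset_refl _ _) mnf nf0.
rewrite -lee_pdivlMl ?v0// => /le_lt_trans; apply.
have := morrey_norm_le r0 (v0 x r r0) foo => /(lee_wpmul2l _) H.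
apply: (@le_lt_trans _ _ (((vol w x r)^-1)%:E * ((K * r ^+ n)%:E *
  (fine (morrey_norm kappa w f) * vol w x r `^ kappa)%:E))%E).
  apply: lee_wpmul2l; first by rewrite lee_fin invr_ge0 vol_ge0.
  by apply: H; rewrite lee_fin mulr_ge0 ?exprn_ge0 ?ltW.
by rewrite -!EFinM ltry.
Qed.

Lemma weak_morrey_norm_leP kappa h (M : R) :
  (forall x r sigma, 0 < r -> 0 < sigma ->
    ((wmeas w (eball x r) `^ kappa)^-1 *
      (sigma%:E * wmeas w [set z | eball x r z /\ sigma%:E < `|h z|]) <= M%:E)%E) ->
  (weak_morrey_norm kappa w h <= M%:E)%E.
Proof.
move=> H; apply: ge_ereal_sup => _ [B [x [r [r0 ->]]] <-].
by apply: ge_ereal_sup => _ [sigma /= s0 <-]; exact: H.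
Qed.

End norms.

Theorem corollary1p3 (R : realType) (n : nat) (alpha kappa : R)
    (w : 'rV[R]_n -> R)
    (n_gt0 : (0 < n)%N) (alpha_gt0 : 0 < alpha) (alpha_le1 : alpha <= 1)
    (kappa_gt0 : 0 < kappa) (kappa_lt1 : kappa < 1)
    (weight_w : weight w) (A1_w : A1 w) :
  exists C : R, 0 < C /\
    forall f : 'rV[R]_n -> R, morrey kappa w f ->
      weak_morrey kappa w (galpha alpha f) /\
      (weak_morrey_norm kappa w (galpha alpha f) <=
         C%:E * morrey_norm kappa w f)%E.
Proof.
have [K K0 HK] := A1_ae weight_w A1_w.
have [C C0 HC] := morrey_level_le n_gt0 alpha_gt0 alpha_le1 weight_w K0 HK kappa_gt0 kappa_lt1.
exists C; split; [exact: C0|move=> f fm].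
have [[mf _] foo] := fm.
have F0 := morrey_norm_ge0 weight_w kappa f.
have FE : morrey_norm kappa w f = (fine (morrey_norm kappa w f))%:E.
  by rewrite fineK// ge0_fin_numE.
set Fn := fine _ in FE.
have Fn0 : 0 <= Fn by rewrite -lee_fin -FE.
suff H : (weak_morrey_norm kappa w (galpha alpha f) <= C%:E * morrey_norm kappa w f)%E.
  split; [split|exact: H]; first exact: (galpha_measurable alpha_gt0 mf).
  by apply: (le_lt_trans H); rewrite FE -EFinM ltry.
rewrite FE -EFinM; apply: weak_morrey_norm_leP => x r sigma r0 s0.
have mB : measurable (eball x r : set (lebesgue_rV R n)) by exact: eball_leb.
have mg := galpha_measurable alpha_gt0 mf.
set S := [set z | _ /\ _].
have mS : measurable (S : set (lebesgue_rV R n)).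
  have := emeasurable_fun_o_infty measurableT (measurableT_comp (@abse_measurable R setT) mg) sigma%:E.
  rewrite setTI => mS'.
  have -> : S = eball x r `&` [set z | (sigma%:E < `|galpha alpha f z|)%E] by [].
  exact: measurableI.
rewrite wmeas_eball//.
(* If the weight vanishes on the ball then [f] may fail to be locally
   integrable, but the level set has weight zero. *)
have /predU1P[v0|v0] : (vol w x r == 0) || (0 < vol w x r) by rewrite -le0r vol_ge0.
  have -> : wmeas w S = 0%E.
    apply/eqP; rewrite eq_le; apply/andP; split; last first.
      by apply: integral_ge0 => z _; rewrite lee_fin (weight_ge0 weight_w).
    apply: (@le_trans _ _ (wmeas w (eball x r))); first by apply: (wmeas_le weight_w) => // z [].
    by rewrite wmeas_eball// v0.
  by rewrite !mule0 lee_fin mulr_ge0// ltW.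
have vpos y s : 0 < s -> 0 < vol w y s.
  move=> ss; rewrite lt0r vol_ge0// andbT; apply/eqP => vs.
  by move: v0; rewrite (vol_eq0 weight_w x K0 HK ss r0 vs) ltxx.
have lf := morrey_locally_integrable weight_w K0 HK vpos fm.
have Hf s : 0 < s -> (\int[@lebesgueRn R n]_(z in eball x s) (`|f z|%:E * (w z)%:E) <=
    (Fn * vol w x s `^ kappa)%:E)%E.
  by move=> ss; exact: (morrey_norm_le weight_w ss (vpos x s ss) foo).
have := HC f Fn x r sigma r0 s0 Fn0 lf Hf v0.
rewrite -/S => H.
have vk0 : 0 < vol w x r `^ kappa by exact: powR_gt0.
rewrite poweR_EFin inver gt_eqF// lee_pdivrMl//.
by apply: (le_trans H); rewrite -EFinM mulrC.
Qed.
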